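(* Let $P_t(\mu,d\nu)$ be the Markov kernel of a $(\xi,\phi,\psi)$-superprocess on $M_h(E)$ (with parameters satisfying the standing assumptions (A1)--(A3) given in the context). Suppose that the superprocess is subcritical and that $$\int_{\{\nu\in M_h(E)^\circ:\ \langle h,\nu\rangle>1\}}\log(\langle h,\nu\rangle)\,H_2(d\nu)<\infty .$$ Then there exists a unique invariant measure $\pi\in\mathcal P(M_h(E))$. Moreover, for each $\mu\in M_h(E)$, $P_t(\mu,\cdot)\to\pi$ weakly as $t\to\infty$, and $$\int_{M_h(E)}e^{-\langle f,\nu\rangle}\pi(d\nu)=\exp\left(-\int_0^\infty\psi(V_sf)\,ds\right),\qquad f\in B_h(E)^+ .$$
   Context: Spaces. $E$ is a Lusin topological space and $h:E\to(0,\infty)$ is continuous. $B_h(E)$ is the Banach space of Borel functions $f:E\to\mathbb R$ with $\|f\|_h:=\sup_{x\in E}|f(x)|/h(x)<\infty$; $C_h(E)\subset B_h(E)$ is the subspace of continuous functions; $B_h(E)^+,C_h(E)^+$ are the cones of nonnegative functions; $B_{\mathbf 1}(E)$ is the case $h\equiv1$ (bounded Borel functions). $M_h(E)$ is the space of (nonnegative) Borel measures $\mu$ on $E$ with $\int_E h\,d\mu<\infty$, $\langle f,\mu\rangle=\int_E f\,d\mu$, with topology given by $\mu_n\to\mu$ iff $\langle f,\mu_n\rangle\to\langle f,\mu\rangle$ for all $f\in C_h(E)$, and its Borel $\sigma$-algebra. $M_h(E)^\circ=M_h(E)\setminus\{0\}$. $\mathcal P(M_h(E))$ is the set of Borel probability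 measures on $M_h(E)$. Standing assumptions. (A1) $p^\xi_t(x,dy)$ is the transition kernel of a conservative Borel right process $\xi$ on $E$, and there is $\alpha\ge0$ such that $e^{-\alpha t}\int_E h(y)p^\xi_t(x,dy)\nearrow h(x)$ as $t\searrow0$ for each $x\in E$. (A2) $b\in B_{\mathbf 1}(E)$, $ch\in B_{\mathbf 1}(E)^+$, $\eta(x,dy)$ is a $\sigma$-finite kernel on $E$, $H_1(x,d\nu)$ is a $\sigma$-finite kernel from $E$ to $M_h(E)^\circ$, and for some constant $C>0$ and all $x\in E$, $\int_E h(y)\eta(x,dy)+\int_{M_h(E)^\circ}(\langle h,\nu\rangle\wedge\langle h,\nu\rangle^2+\langle h,\nu_x\rangle)H_1(x,d\nu)\le Ch(x)$, where $\nu_x$ is the restriction of $\nu$ to $E\setminus\{x\}$. (A3) $\beta\in M_h(E)$ and $H_2$ is a Borel measure on $M_h(E)^\circ$ with $\int_{M_h(E)^\circ}1\wedge\langle h,\nu\rangle\,H_2(d\nu)<\infty$. Branching and immigration mechanisms. For $x\in E$, $f\in B_h(E)^+$: $$\phi(x,f)=c(x)f(x)^2+b(x)f(x)-\int_E f(y)\eta(x,dy)+\int_{M_h(E)^\circ}\left(e^{-\langle f,\nu\rangle}-1+f(x)\nu(\{x\})\right)H_1(x,d\nu),$$ $$\psi(f)=\langle f,\beta\rangle+\int_{M_h(E)^\circ}\left(1-e^{-\langle f,\nu\rangle}\right)H_2(d\nu).$$ The superprocess. For $f\in B_h(E)^+$, $V_tf(x)=v_t(x,f)$ is the unique nonnegative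 solution, with $t\mapsto\|v_t(\cdot,f)\|_h$ bounded on bounded intervals, of $v_t(x,f)=\int_E f(y)p^\xi_t(x,dy)-\int_0^t\int_E\phi(y,v_s(\cdot,f))p^\xi_{t-s}(x,dy)ds$. The $(\xi,\phi,\psi)$-superprocess is the Markov process on $M_h(E)$ whose Markov kernel $P_t(\mu,d\nu)$ is uniquely determined by $\int_{M_h(E)}e^{-\langle f,\nu\rangle}P_t(\mu,d\nu)=\exp(-\langle V_tf,\mu\rangle-\int_0^t\psi(V_sf)ds)$ for $t\ge0$, $\mu\in M_h(E)$, $f\in B_h(E)^+$. First-moment semigroup and subcriticality. Let $\gamma(x,dy)=\eta(x,dy)+\int_{M_h(E)^\circ}\nu_x(dy)H_1(x,d\nu)$ and $\Gamma f(x)=\int_E f(y)\gamma(x,dy)$. $(R_t)_{t\ge0}$ is the unique semigroup on $B_h(E)$ with $R_tf(x)=p_t^\xi f(x)+\int_0^t\int_E(\Gamma R_{t-s}f(y)-b(y)R_{t-s}f(y))p_s^\xi(x,dy)ds$, where $p_t^\xi f(x)=\int_E f(y)p_t^\xi(x,dy)$; it is represented by nonnegative kernels, $R_tf(x)=\int_E f(y)r_t(x,dy)$. The superprocess is subcritical if there are constants $C,\delta>0$ with $\int_E h(y)r_t(x,dy)\le Ch(x)e^{-\delta t}$ for all $t\ge0$, $x\in E$. Invariant measure: $\pi\in\mathcal P(M_h(E))$ with $\int_{M_h(E)}P_t(\mu,d\nu)\pi(d\mu)=\pi(d\nu)$ for all $t\ge0$. *)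

(* Defs.v *)
From HB Require Import structures.
From mathcomp Require Import all_boot all_order all_algebra.
From mathcomp Require Import all_classical all_reals all_analysis.
From mathcomp Require Import measurable_realfun.

Set Implicit Arguments.
Unset Strict Implicit.
Unset Printing Implicit Defensive.

Import Order.TTheory GRing.Theory Num.Theory.
Import numFieldNormedType.Exports.

Local Open Scope classical_set_scope.
Local Open Scope ring_scope.

(* [measurableType]s are inhabited in the library, hence the pointed [E]: the
   state space is nonempty. *)
Notation Borel E := (g_sigma_algebraType (@open E)).

(* Homeomorphic to a Borel subset of a compact metric space. *)
Definition lusin_space (R : realType) (E : topologicalType) : Prop :=
  exists (K : metricType R) (i : E -> K),
    [/\ compact [set: K], injective i,
        forall U : set E, open U <-> exists2 O : set K, open O & i @^-1` O = U
      & <<s @open K >> (range i)].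

Section function_spaces.
Context {R : realType} {E : ptopologicalType}.
Implicit Types (h f : E -> R).

Definition hnorm h f : \bar R := ereal_sup (range (fun x => (`|f x| / h x)%:E)).

Definition Bh h : set (E -> R) :=
  [set f | measurable_fun [set: Borel E] (f : Borel E -> R) /\
           (hnorm h f < +oo)%E].

Definition Bh_pos h : set (E -> R) := [set f | Bh h f /\ forall x, 0 <= f x].

Definition Ch h : set (E -> R) := [set f | Bh h f /\ continuous f].

Definition pairing (f : E -> R) (mu : {measure set (Borel E) -> \bar R}) : R :=
  \int[mu]_x f x.

End function_spaces.

(* Measures of the library are functions on all subsets, of which only the
   values on measurable sets are meaningful; normalizing the other values to 0
   makes equality in [Mh h] the equality of Borel measures (see [Mh_eq]). *)
Record Mh (R : realType) (E : ptopologicalType) (h : E -> R) := MkMh {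
  Mh_measure :> {measure set (Borel E) -> \bar R} ;
  Mh_finite : (\int[Mh_measure]_x (h x)%:E < +oo)%E ;
  Mh_nonmeasurable :
    forall A : set (Borel E), ~ measurable A -> Mh_measure A = 0%E }.

Lemma Mh_eq (R : realType) (E : ptopologicalType) (h : E -> R) (mu nu : Mh h) :
  (forall A : set (Borel E), measurable A -> mu A = nu A) -> mu = nu.
Proof.
case: mu nu => [m mf m0] [n nf n0] /= mn.
have emn : m = n.
  apply: eq_measure; apply/funext => A.
  by have [/mn//|nA] := pselect (measurable A); rewrite m0// n0.
by subst n; congr MkMh; exact: Prop_irrelevance.
Qed.

Section space_of_measures.
Context (R : realType) (E : ptopologicalType) (h : E -> R).

Lemma Mh_zero_finite :
  (\int[@mzero _ (Borel E) R]_x (h x)%:E < +oo)%E.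
Proof. by rewrite integral_measure_zero ltry. Qed.

Definition Mh_zero : Mh h :=
  MkMh Mh_zero_finite (fun (A : set (Borel E)) _ => erefl).

HB.instance Definition _ := gen_eqMixin (Mh h).
HB.instance Definition _ := gen_choiceMixin (Mh h).
HB.instance Definition _ := isPointed.Build (Mh h) Mh_zero.

Definition Mh_eval (mu : Mh h) : prod_topology (fun _ : Ch h => R) :=
  fun f => pairing (val f) mu.

(* The coarsest topology making every mu |-> <f, mu>, f in C_h(E),
   continuous. *)
HB.instance Definition _ := Topological.copy (Mh h) (initial_topology Mh_eval).
HB.instance Definition _ :=
  Measurable.copy (Mh h) (g_sigma_algebraType (@open (Mh h))).

End space_of_measures.

Lemma Mh_cvgP (R : realType) (E : ptopologicalType) (h : E -> R)
    (u : nat -> Mh h) (mu : Mh h) :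
  u n @[n --> \oo] --> mu <->
  forall f, Ch h f -> pairing f (u n) @[n --> \oo] --> pairing f mu.
Proof.
split=> [umu f Cf|H].
  have ev := cvg_comp _ _ umu (@initial_continuous (Mh h) _ (@Mh_eval R E h) mu).
  have pf := @proj_continuous (Ch h) (fun=> R) (SigSub (mem_set Cf)) (Mh_eval mu).
  exact: (cvg_comp _ _ ev pf).
have ev : Mh_eval (u n) @[n --> \oo] --> Mh_eval mu.
  apply/cvg_sup => f.
  have Cf : Ch h (val f) by apply: set_mem; exact: (valP f).
  move=> A [B [[C oC <-] Cm] CA]; apply: filterS CA _.
  by apply: (H _ Cf); exact: open_nbhs_nbhs.
move=> A [B [[C oC <-] Cm] CA]; apply: filterS CA _.
by apply: ev; exact: open_nbhs_nbhs.
Qed.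

Definition Mho (R : realType) (E : ptopologicalType) (h : E -> R) :
  set (Mh h) := ~` [set Mh_zero h].
Arguments Mho {R E} h.

Section right_processes.
Context {R : realType} {E : ptopologicalType}.
Variable p : R -> R.-pker (Borel E) ~> (Borel E).

(* Integrals of nonnegative universally measurable functions: the library
   integral of a nonnegative function is the supremum of the integrals of the
   simple functions below it, which agrees with the integral for the
   completion. *)
Definition universally_measurable (f : E -> \bar R) : Prop :=
  forall mu : probability (Borel E) R, exists g1 g2 : Borel E -> \bar R,
    [/\ measurable_fun [set: Borel E] g1,
        measurable_fun [set: Borel E] g2,
        forall x, (g1 x <= f x <= g2 x)%E
      & mu [set x | g1 x != g2 x] = 0%E].

(* e^{- alpha t} p_t f increases to f as t decreases to 0. *)
Definition increases_to (alpha : R) (f : E -> \bar R) : Prop :=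
  forall x,
    (forall s t, 0 < s -> s <= t ->
      ((expR (- (alpha * t)))%:E * \int[p t x]_y f y <=
       (expR (- (alpha * s)))%:E * \int[p s x]_y f y)%E) /\
    ((expR (- (alpha * t)))%:E * \int[p t x]_y f y)%E @[t --> 0^'+] --> f x.

Definition excessive (alpha : R) (f : E -> \bar R) : Prop :=
  [/\ forall x, (0 <= f x)%E, universally_measurable f & increases_to alpha f].

Definition past (T : Type) (X : R -> T -> E) (t : R) : set (set T) :=
  <<s [set A | exists s (B : set (Borel E)),
         [/\ 0 <= s, s <= t, measurable B & A = X s @^-1` B]] >>.

(* [Pr mu] is the law of the process with initial law [mu]. *)
Record right_process d (W : measurableType d) (X : R -> W -> E)
    (Pr : probability (Borel E) R -> probability W R) : Prop := {
  right_process_measurable : forall t, 0 <= t ->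
    measurable_fun [set: W] (X t : W -> Borel E) ;
  right_process_right_continuous : forall w t, 0 <= t ->
    X s w @[s --> t^'+] --> X t w ;
  right_process_initial : forall mu (B : set (Borel E)), measurable B ->
    Pr mu (X 0 @^-1` B) = mu B ;
  right_process_markov : forall mu s t (A : set W) (B : set (Borel E)),
    0 <= s -> 0 <= t -> past X s A -> measurable B ->
    Pr mu (A `&` X (s + t) @^-1` B) = (\int[Pr mu]_(w in A) p t (X s w) B)%E ;
  right_process_excessive : forall mu alpha f, 0 < alpha ->
    excessive alpha f ->
    {ae Pr mu, forall w, forall t, 0 <= t ->
       f (X s w) @[s --> t^'+] --> f (X t w)} }.

(* Conservativeness is built in: each p t x is a probability measure. *)
Record borel_right_semigroup : Prop := {
  brs_normal : forall x (B : set (Borel E)), measurable B ->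
    p 0 x B = \d_x B ;
  brs_chapman_kolmogorov : forall s t x (B : set (Borel E)),
    0 <= s -> 0 <= t -> measurable B ->
    p (s + t) x B = (\int[p s x]_y p t y B)%E ;
  brs_process : exists d (W : measurableType d) (X : R -> W -> E)
    (Pr : probability (Borel E) R -> probability W R), right_process X Pr }.

End right_processes.

(* Measures on M_h(E) \ {0} are encoded as measures on M_h(E) that do not
   charge the zero measure. *)
Section mechanisms.
Context {R : realType} {E : ptopologicalType} {h : E -> R}.
Variables (b c : E -> R).
Variable eta : R.-sigmafker (Borel E) ~> (Borel E).
Variable H1 : R.-sigmafker (Borel E) ~> (Mh h).
Variable beta : Mh h.
Variable H2 : {measure set (Mh h) -> \bar R}.

Definition assumption_A1 (p : R -> R.-pker (Borel E) ~> (Borel E)) : Prop :=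
  borel_right_semigroup p /\
  exists2 alpha, 0 <= alpha & increases_to p alpha (fun x => (h x)%:E).

Definition assumption_A2 : Prop :=
  [/\ Bh (cst 1) b, Bh_pos (cst 1) (fun x => c x * h x),
      forall x, H1 x [set Mh_zero h] = 0%E
    & exists2 C : R, 0 < C & forall x,
      (\int[eta x]_y (h y)%:E +
       \int[H1 x]_(nu in Mho h)
         ((Num.min (pairing h nu) (pairing h nu ^+ 2))%:E +
          \int[nu]_(y in ~` [set x]) (h y)%:E)
       <= (C * h x)%:E)%E].

Definition assumption_A3 : Prop :=
  H2 [set Mh_zero h] = 0%E /\
  (\int[H2]_(nu in Mho h) (Num.min 1 (pairing h nu))%:E < +oo)%E.

Definition phi (x : E) (f : E -> R) : R :=
  c x * f x ^+ 2 + b x * f x - \int[eta x]_y f y +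
  \int[H1 x]_(nu in Mho h)
    (expR (- pairing f nu) - 1 + f x * fine (nu [set x])).

Definition psi (f : E -> R) : R :=
  pairing f beta + \int[H2]_(nu in Mho h) (1 - expR (- pairing f nu)).

Definition gamma (x : E) (A : set (Borel E)) : \bar R :=
  (eta x A + \int[H1 x]_(nu in Mho h) nu (A `\` [set x]))%E.

Definition Gamma (f : E -> R) (x : E) : R :=
  fine (\int[gamma x]_y (f y)%:E)%E.

End mechanisms.

Section superprocess.
Context {R : realType} {E : ptopologicalType} {h : E -> R}.
Variable p : R -> R.-pker (Borel E) ~> (Borel E).
Variables (b c : E -> R).
Variable eta : R.-sigmafker (Borel E) ~> (Borel E).
Variable H1 : R.-sigmafker (Borel E) ~> (Mh h).
Variable beta : Mh h.
Variable H2 : {measure set (Mh h) -> \bar R}.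

Definition time_space_measurable (v : R -> E -> R) : Prop :=
  measurable_fun ([set t : R | 0 <= t] `*` [set: Borel E])
    (fun z : R * Borel E => v z.1 z.2).

Record cumulant_solution (f : E -> R) (v : R -> E -> R) : Prop := {
  cumulant_measurable : time_space_measurable v ;
  cumulant_Bh_pos : forall t, 0 <= t -> Bh_pos h (v t) ;
  cumulant_locally_bounded : forall T : R, exists M : R, forall t,
    0 <= t -> t <= T -> (hnorm h (v t) <= M%:E)%E ;
  cumulant_equation : forall t x, 0 <= t ->
    v t x = \int[p t x]_y f y -
      \int[lebesgue_measure]_(s in `[0, t])
        (\int[p (t - s) x]_y phi b c eta H1 y (v s)) }.

Definition cumulant_semigroup (V : R -> (E -> R) -> E -> R) : Prop :=
  forall f, Bh_pos h f -> cumulant_solution f (fun t => V t f).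

Record superprocess_kernel (V : R -> (E -> R) -> E -> R)
    (P : R -> R.-pker (Mh h) ~> (Mh h)) : Prop := {
  superprocess_chapman_kolmogorov : forall s t mu (A : set (Mh h)),
    0 <= s -> 0 <= t -> measurable A ->
    P (s + t) mu A = (\int[P s mu]_nu P t nu A)%E ;
  superprocess_laplace : forall t (mu : Mh h) f, 0 <= t -> Bh_pos h f ->
    \int[P t mu]_nu expR (- pairing f nu) =
    expR (- pairing (V t f) mu -
          \int[lebesgue_measure]_(s in `[0, t]) psi beta H2 (V s f)) }.

Definition kernel_op (r : R -> R.-ker (Borel E) ~> (Borel E))
    (t : R) (f : E -> R) : E -> R := fun x => \int[r t x]_y f y.

(* The third condition makes every r_t f, f in B_h(E), well defined and gives
   the local boundedness under which the equation has a unique solution. *)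
Record first_moment_semigroup (r : R -> R.-ker (Borel E) ~> (Borel E))
    : Prop := {
  first_moment_zero : forall f, Bh h f -> kernel_op r 0 f = f ;
  first_moment_add : forall s t f, 0 <= s -> 0 <= t -> Bh h f ->
    kernel_op r (s + t) f = kernel_op r s (kernel_op r t f) ;
  first_moment_locally_bounded : forall T : R, exists M : R, forall t x,
    0 <= t -> t <= T -> (\int[r t x]_y (h y)%:E <= (M * h x)%:E)%E ;
  first_moment_measurable : forall f, Bh h f ->
    time_space_measurable (fun t => kernel_op r t f) ;
  first_moment_equation : forall t f x, 0 <= t -> Bh h f ->
    kernel_op r t f x = \int[p t x]_y f y +
      \int[lebesgue_measure]_(s in `[0, t])
        (\int[p s x]_y (Gamma eta H1 (kernel_op r (t - s) f) y
                        - b y * kernel_op r (t - s) f y)) }.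

Definition subcritical (r : R -> R.-ker (Borel E) ~> (Borel E)) : Prop :=
  exists C delta : R, [/\ 0 < C, 0 < delta & forall t x, 0 <= t ->
    (\int[r t x]_y (h y)%:E <= (C * h x * expR (- (delta * t)))%:E)%E].

Definition invariant_measure (P : R -> R.-pker (Mh h) ~> (Mh h))
    (pi : probability (Mh h) R) : Prop :=
  forall t (A : set (Mh h)), 0 <= t -> measurable A ->
    (\int[pi]_mu P t mu A)%E = pi A.

Definition weak_cvg_pinfty (Q : R -> {measure set (Mh h) -> \bar R})
    (pi : {measure set (Mh h) -> \bar R}) : Prop :=
  forall F : Mh h -> R, continuous F -> (exists M : R, forall nu, `|F nu| <= M) ->
    \int[Q t]_nu F nu @[t --> +oo] --> \int[pi]_nu F nu.

End superprocess.

(* Main.v *)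
Require Import Defs.
From HB Require Import structures.
From mathcomp Require Import all_boot all_order all_algebra.
From mathcomp Require Import all_classical all_reals all_analysis.
From mathcomp Require Import measurable_realfun.
From mathcomp Require Import ring lra.
Import Order.TTheory GRing.Theory Num.Theory.
Import numFieldNormedType.Exports.
Local Open Scope classical_set_scope.
Local Open Scope ring_scope.
Set Implicit Arguments.
Unset Strict Implicit.
Unset Printing Implicit Defensive.

(** The proof rests on Laplace functionals. By definition that of [P t mu] at [f]
    is [exp (- <V_t f, mu> - int_0^t psi (V_s f) ds)], so two things have to be
    shown: these numbers converge as [t] tends to infinity, to a limit [L f] that
    does not depend on [mu]; and [L] is the Laplace functional of a probability
    measure on the space of measures.

    Convergence. The branching mechanism lies above its linearization
    ([phi_ge]), so [V_t f] lies below the first moment [R_t f]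
    ([cumulant_le_first_moment]). This is obtained by telescoping the products
    [R_((n-k)e) V_(ke) f], [e = t/n], whose consecutive terms differ by at most
    [O(e^2)] in the wrong direction ([cumulant_short_time]); the semigroup property
    of [V] needed here is read off the Chapman-Kolmogorov equation of [P].
    Subcriticality then gives [V_t f <= const e^(- delta t) h], hence
    [<V_t f, mu>] tends to 0 and [psi (V_s f)] is at most an integral against [H2]
    of [min 1 (const e^(- delta s) <h, nu>)], plus an exponentially small term.
    Summed over integers [s], this integrand is of order
    [min 1 <h, nu> + log^+ <h, nu>], which [H2] integrates by hypothesis
    ([rate_summable]). So the immigration integral converges, with tails that are
    uniform over [f <= M h] ([total_immigrationP]).

    Existence of the limit law ([Laplace_limit]). By the uniform tails [L] is
    continuous under pointwise convergence of functions dominated by [M h]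
    ([limit_Laplace_cont]). As [E] need not be Polish, tightness arguments are
    replaced by a construction on codes. A Lusin space is a Borel retract of
    the space of binary sequences ([lusin_retract]), so a measure on [E] is
    described by the masses of the countably many cylinders. The exponentials of
    these masses are random variables in [0, 1] whose mixed moments, values of the
    Laplace functionals, converge; hence they have a limit law ([limit_law]), under
    which they satisfy almost surely the additivity relations of cylinder masses,
    because such a relation between exponentials is the vanishing of a second
    moment ([ae_step_fun]). Consistent masses of cylinders are those of a measure
    ([tree_measure]). The resulting random measure has Laplace functional [L],
    first on functions of finitely many bits and then on all bounded functions by
    monotone classes and the continuity of [L] ([Laplace_random_measure]).

    Conclusion. The topology of the space of measures has a countable base made
    from exponentials of integrals ([Mh_tent_base]), so continuous functions and
    indicators of open sets are increasing limits of elements of the uniformly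
    closed algebra they generate. Therefore convergence of Laplace functionals to
    that of a probability measure is weak convergence ([Laplace_weak_cvg]), and a
    probability measure is determined by its Laplace functional
    ([Laplace_unique]). Invariance of the limit law is the identity
    [total_immigrationD], and an invariant law is the limit law because its Laplace
    functional, constant in time, tends to [L]. *)

(** * Lower integrals *)

Section image_measure.
Context d d' (T1 : measurableType d) (T2 : measurableType d') (R : realType).
Variables (m : {measure set T1 -> \bar R}) (f : T1 -> T2).
Hypothesis mf : measurable_fun [set: T1] f.

Definition image_measure : {measure set T2 -> \bar R} :=
  measure_function_pushforward__canonical__measure_function_Measure m mf.

Lemma image_measureE (A : set T2) : image_measure A = m (f @^-1` A).
Proof. by []. Qed.

Lemma ge0_integral_image (g : T2 -> \bar R) :
  measurable_fun [set: T2] g -> (forall y, 0 <= g y)%E ->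
  (\int[image_measure]_y g y = \int[m]_x g (f x))%E.
Proof. by move=> mg g0; rewrite ge0_integral_pushforward. Qed.

End image_measure.

Section lower_integral.
Context d (T : measurableType d) (R : realType).
Variable mu : {measure set T -> \bar R}.
Local Open Scope ereal_scope.

Import HBNNSimple.

(** The integral of a nonnegative function is the supremum of the integrals of
    the simple functions below it; as such it makes sense for every function, is
    monotone, and is subadditive when one of the summands is measurable. This
    calculus serves for the evolution equations, whose inner integrals are not
    known to depend measurably on time. *)
Lemma le_lower_integral (D : set T) (f g : T -> \bar R) :
  (forall x, D x -> 0 <= f x) -> (forall x, D x -> f x <= g x) ->
  \int[mu]_(x in D) f x <= \int[mu]_(x in D) g x.
Proof.
move=> f0 fg.
have g0 x : D x -> 0 <= g x by move=> Dx; exact: le_trans (f0 _ Dx) (fg _ Dx).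
rewrite !ge0_integralE//; apply: ge_ereal_sup => _ [k/= kf <-].
apply: ereal_sup_ubound; exists k => //= x; apply: le_trans (kf x) _.
rewrite /patch; case: ifPn => // /set_mem Dx; exact: fg.
Qed.

Lemma lower_integral_subset (D D' : set T) (f : T -> \bar R) : D `<=` D' ->
  (forall x, D' x -> 0 <= f x) -> \int[mu]_(x in D) f x <= \int[mu]_(x in D') f x.
Proof.
move=> DD' f0; rewrite integral_mkcond [leRHS]integral_mkcond; apply: le_lower_integral => x _.
  by apply: erestrict_ge0 => y /DD'; exact: f0.
rewrite /patch; case: ifPn => [/set_mem/DD' D'x|_]; first by rewrite mem_set.
by case: ifPn => // /set_mem; exact: f0.
Qed.

Let integral_nnsfun_restrict (D : set T) (f : T -> \bar R) (k : {nnsfun T >-> R}) :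
  (forall x, (k x)%:E <= (f \_ D) x) ->
  \int[mu]_x (k x)%:E = \int[mu]_(x in D) (k x)%:E.
Proof.
move=> kf; rewrite [RHS]integral_mkcond; apply: eq_integral => x _.
rewrite /patch; case: ifPn => // xD; apply/eqP; rewrite eq_le.
apply/andP; split; last by rewrite lee_fin; exact: fun_ge0.
by apply: le_trans (kf x) _; rewrite /patch (negbTE xD).
Qed.

(** For a simple [k <= f], the function [Num.max (k - c) 0] is measurable and lies
    below [g], and together with [c] it dominates [k]. *)
Lemma lower_integral_leD (D : set T) (f g : T -> \bar R) (c : T -> R) :
  measurable D -> measurable_fun D c ->
  (forall x, D x -> 0 <= f x) -> (forall x, D x -> 0 <= g x) ->
  (forall x, D x -> 0 <= c x)%R ->
  (forall x, D x -> f x <= g x + (c x)%:E) ->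
  \int[mu]_(x in D) f x <= \int[mu]_(x in D) g x + \int[mu]_(x in D) (c x)%:E.
Proof.
move=> mD mc f0 g0 c0 fgc.
rewrite ge0_integralE//; apply: ge_ereal_sup => _ [k/= kf <-].
rewrite -integralT_nnsfun (integral_nnsfun_restrict kf).
pose m x := (Num.max (k x - c x) 0)%R.
have mm : measurable_fun D m.
  apply: measurable_maxr => //; apply: measurable_funB => //.
  by apply: measurable_funTS.
have m0 x : (0 <= m x)%R by rewrite /m le_max lexx orbT.
apply: (@le_trans _ _ (\int[mu]_(x in D) ((m x)%:E + (c x)%:E))).
  apply: le_lower_integral => x Dx; first by rewrite lee_fin fun_ge0.
  by rewrite -EFinD lee_fin -lerBlDr /m le_max lexx.
rewrite ge0_integralD//; last 3 first.
- by move=> x _; rewrite lee_fin.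
- exact/measurable_EFinP.
- exact/measurable_EFinP.
rewrite leeD2r//; apply: le_lower_integral => x Dx; first by rewrite lee_fin.
rewrite /m /Num.max; case: ifPn => // _; [exact: g0|].
rewrite EFinB leeBlDr//; apply: le_trans (fgc _ Dx).
by have := kf x; rewrite /patch mem_set.
Qed.

(** Monotone convergence along the domain, again through the simple functions
    below [f]. *)
Lemma lower_integral_exhaust (D : nat -> set T) (f : T -> \bar R) (K : \bar R) :
  (forall n, measurable (D n)) -> {homo D : n m / (n <= m)%N >-> (n <= m)%O} ->
  (forall n x, D n x -> 0 <= f x) -> (forall n, \int[mu]_(x in D n) f x <= K) ->
  \int[mu]_(x in \bigcup_n D n) f x <= K.
Proof.
move=> mD ndD f0 fK; rewrite ge0_integralE; last by move=> x [n _]; exact: f0.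
apply: ge_ereal_sup => _ [k/= kf <-].
have kf' x : (\bigcup_n D n) x -> (k x)%:E <= f x.
  by move=> Dx; have := kf x; rewrite /patch mem_set.
rewrite -integralT_nnsfun (integral_nnsfun_restrict kf).
have mk n : measurable_fun (D n) (fun x => (k x)%:E).
  by apply/measurable_EFinP; exact: measurable_funTS.
have k0 n x : D n x -> 0 <= (k x)%:E by rewrite lee_fin fun_ge0.
apply: (cvge_to_le (ge0_nondecreasing_set_cvg_integral ndD mD mk k0)).
apply: nearW => n; apply: le_trans (fK n); apply: le_lower_integral => x Dx; first exact: k0 Dx.
by apply: kf'; exists n.
Qed.

Lemma lower_integral_invol (D : set T) (rho : T -> T) (f : T -> \bar R) :
  measurable_fun [set: T] rho -> involutive rho ->
  (forall A, measurable A -> mu (rho @^-1` A) = mu A) ->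
  (forall x, D (rho x) = D x) ->
  (forall x, D x -> 0 <= f x) ->
  \int[mu]_(x in D) f (rho x) = \int[mu]_(x in D) f x.
Proof.
move=> mrho rhoK murho Drho.
suff H (g : T -> \bar R) : (forall x, 0 <= g x) -> \int[mu]_x g (rho x) <= \int[mu]_x g x.
  move=> f0; have fD0 x : 0 <= (f \_ D) x by exact: erestrict_ge0.
  rewrite !(integral_mkcond D).
  have -> : (fun x => f (rho x)) \_ D = (f \_ D) \o rho.
    by apply/funext => x; rewrite /patch/=; congr (if _ then _ else _);
      apply/idP/idP; rewrite !inE Drho.
  apply/eqP; rewrite eq_le; apply/andP; split; first exact: H.
  have := H ((f \_ D) \o rho) (fun x => fD0 (rho x)).
  by apply: le_trans; apply: le_lower_integral => // x _ /=; rewrite rhoK.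
move=> g0; rewrite ge0_integralTE//; apply: ge_ereal_sup => _ [k/= kg <-].
rewrite -integralT_nnsfun.
have -> : \int[mu]_x (k x)%:E = \int[mu]_x (k (rho x))%:E.
  rewrite -(ge0_integral_image mu mrho (g := fun x => (k x)%:E)); first last.
  - by move=> y; rewrite lee_fin.
  - exact/measurable_EFinP.
  by apply: eq_measure_integral => A mA _; rewrite image_measureE murho.
apply: le_lower_integral => x _; first by rewrite lee_fin.
by rewrite -{2}(rhoK x).
Qed.

Let dominated_parts (D : set T) (f c : T -> R) : (forall x, D x -> `|f x| <= c x)%R ->
  (\int[mu]_(x in D) ((EFin \o f)^\+ x) <= \int[mu]_(x in D) (c x)%:E) /\
  (\int[mu]_(x in D) ((EFin \o f)^\- x) <= \int[mu]_(x in D) (c x)%:E).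
Proof.
move=> fc; split; apply: le_lower_integral => // x Dx.
  rewrite funeposE ge_max !lee_fin; apply/andP; split.
    exact: le_trans (ler_norm _) (fc _ Dx).
  exact: le_trans (normr_ge0 _) (fc _ Dx).
rewrite funenegE ge_max !lee_fin; apply/andP; split.
  by apply: le_trans (fc _ Dx); rewrite -normrN ler_norm.
exact: le_trans (normr_ge0 _) (fc _ Dx).
Qed.

Let dominated_fin (D : set T) (f c : T -> R) : (forall x, D x -> `|f x| <= c x)%R ->
  \int[mu]_(x in D) (c x)%:E < +oo ->
  (\int[mu]_(x in D) ((EFin \o f)^\+ x) \is a fin_num) /\
  (\int[mu]_(x in D) ((EFin \o f)^\- x) \is a fin_num).
Proof.
move=> /dominated_parts[fp fn] coo.
by split; rewrite ge0_fin_numE; do ?[exact: integral_ge0]; [exact: le_lt_trans fp coo|exact: le_lt_trans fn coo].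
Qed.

Lemma Rintegral_le_norm (D : set T) (f : T -> R) (c : T -> R) (K : R) :
  (forall x, D x -> `|f x| <= c x)%R -> \int[mu]_(x in D) (c x)%:E <= K%:E ->
  (`|\int[mu]_(x in D) f x| <= K)%R.
Proof.
move=> fc cK; have [Af Bf] := dominated_fin fc (le_lt_trans cK (ltry _)).
have [/le_trans/(_ cK) AK /le_trans/(_ cK) BK] := dominated_parts fc.
rewrite /Rintegral integralE; move: Af Bf AK BK.
set A := integral _ _ _; set B := integral _ _ _ => Af Bf AK BK.
have A0 : 0 <= A by exact: integral_ge0.
have B0 : 0 <= B by exact: integral_ge0.
move: A0 B0 AK BK; rewrite -(fineK Af) -(fineK Bf) -EFinB !lee_fin/= => *.
by rewrite ler_norml; lra.
Qed.

(** The factor 2 is the price of treating the positive and the negative parts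
    separately: lower integrals are only superadditive. *)
Lemma Rintegral_leD2 (D : set T) (f g c c0 : T -> R) (K : R) :
  measurable D -> measurable_fun D c -> (forall x, D x -> 0 <= c x)%R ->
  (forall x, D x -> `|f x| <= c0 x)%R -> (forall x, D x -> `|g x| <= c0 x)%R ->
  \int[mu]_(x in D) (c0 x)%:E < +oo ->
  (forall x, D x -> f x <= g x + c x)%R -> \int[mu]_(x in D) (c x)%:E <= K%:E ->
  (\int[mu]_(x in D) f x <= \int[mu]_(x in D) g x + 2 * K)%R.
Proof.
move=> mD mc c_ge0 fc gc c0oo fgc cK; rewrite /Rintegral.
rewrite [in X in (X <= _)%R]integralE [in X in (_ <= X + _)%R]integralE.
set A := integral _ _ _; set B := integral _ _ _.
set A' := integral _ _ _; set B' := integral _ _ _.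
have AA' : A <= A' + K%:E.
  apply: le_trans (leeD2l _ cK).
  apply: lower_integral_leD => // x Dx.
  rewrite funeposE ge_max; apply/andP; split; last first.
    by rewrite adde_ge0// lee_fin c_ge0.
  apply: (@le_trans _ _ ((g x)%:E + (c x)%:E)).
    by rewrite -EFinD lee_fin fgc.
  by rewrite leeD2r// funeposE le_max lexx.
have BB' : B' <= B + K%:E.
  apply: le_trans (leeD2l _ cK).
  apply: lower_integral_leD => // x Dx.
  rewrite funenegE ge_max; apply/andP; split; last first.
    by rewrite adde_ge0// lee_fin c_ge0.
  apply: (@le_trans _ _ (- (f x)%:E + (c x)%:E)).
    by have := fgc _ Dx; rewrite -!EFinN -EFinD !lee_fin; lra.
  by rewrite leeD2r// funenegE le_max lexx.
have [Af Bf] := dominated_fin fc c0oo; have [A'f B'f] := dominated_fin gc c0oo.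
move: AA' BB'; rewrite -/A -/B -/A' -/B' in Af Bf A'f B'f *.
rewrite -(fineK Af) -(fineK Bf) -(fineK A'f) -(fineK B'f) -!EFinB -!EFinD !lee_fin/=.
lra.
Qed.

Lemma Rintegral_opp (D : set T) (f c : T -> R) :
  (forall x, D x -> `|f x| <= c x)%R -> (\int[mu]_(x in D) (c x)%:E < +oo)%E ->
  (\int[mu]_(x in D) (- f x) = - \int[mu]_(x in D) f x)%R.
Proof.
move=> fc coo; rewrite /Rintegral.
have [fp fn] := dominated_fin fc coo.
rewrite -fineN; congr fine; rewrite integralE [in RHS]integralE.
have -> : (\int[mu]_(x in D) ((fun x => (- f x)%R%:E)^\+)%E x =
           \int[mu]_(x in D) ((EFin \o f)^\-)%E x)%E.
  by apply: eq_integral => x _; rewrite funeposE funenegE.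
have -> : (\int[mu]_(x in D) ((fun x => (- f x)%R%:E)^\-)%E x =
           \int[mu]_(x in D) ((EFin \o f)^\+)%E x)%E.
  by apply: eq_integral => x _; rewrite funeposE funenegE/= opprK.
by rewrite fin_num_oppeB// addeC.
Qed.

Lemma Rintegral_le (D : set T) (f g c : T -> R) : measurable D ->
  (forall x, D x -> `|f x| <= c x)%R -> (forall x, D x -> `|g x| <= c x)%R ->
  (\int[mu]_(x in D) (c x)%:E < +oo)%E ->
  (forall x, D x -> f x <= g x)%R ->
  (\int[mu]_(x in D) f x <= \int[mu]_(x in D) g x)%R.
Proof.
move=> mD fc gc coo fg.
have -> : (\int[mu]_(x in D) g x = \int[mu]_(x in D) g x + 2 * 0)%R by rewrite mulr0 addr0.
apply: (Rintegral_leD2 mD (measurable_cst (0%R : R)) _ fc gc coo) => //.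
  by move=> x Dx; rewrite addr0 fg.
by rewrite integral0.
Qed.

End lower_integral.

Lemma lebesgue_reflect (R : realType) (t : R) (A : set R) : measurable A ->
  lebesgue_measure ((fun s : R => t - s) @^-1` A) = lebesgue_measure A.
Proof.
have mrho : measurable_fun [set: measurableTypeR R] (fun s : measurableTypeR R => t - s : measurableTypeR R).
  by apply: measurable_funB => //; exact: measurable_cst.
rewrite -[LHS]/(pushforward lebesgue_measure
  (fun s : measurableTypeR R => t - s : measurableTypeR R) A).
move=> mA; apply/esym/lebesgue_measure_unique => //= _ [[a b]] _ <-.
rewrite /pushforward.
have -> : (fun s : R => t - s) @^-1` `]a, b] = `[t - b, t - a[%classic.
  by apply/seteqP; split => x /=; rewrite !in_itv/=; lra.
rewrite !lebesgue_measure_itv/= !lte_fin ltrD2l ltrN2.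
by case: ifPn => // _; rewrite -!EFinB; congr EFin; ring.
Qed.

(** Reversing time in the convolutions of the evolution equations. *)
Lemma Rintegral_reflect (R : realType) (t : R) (f : R -> R) :
  \int[lebesgue_measure]_(s in `[0, t]) f (t - s) =
  \int[lebesgue_measure]_(s in `[0, t]) f s.
Proof.
rewrite /Rintegral; congr fine; rewrite integralE [RHS]integralE.
pose rho (s : measurableTypeR R) : measurableTypeR R := t - s.
have mrho : measurable_fun [set: measurableTypeR R] rho.
  by apply: measurable_funB => //; exact: measurable_cst.
have rhoK : involutive rho by move=> s; rewrite /rho; ring.
have Drho x : `[0, t]%classic (rho x) = `[0, t]%classic x.
  by apply/propext; rewrite /rho/= !in_itv/=; split; lra.
have E (g : R -> \bar R) : (forall x, 0 <= g x)%E ->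
    (\int[lebesgue_measure]_(s in `[0%R, t]) g (t - s)%R =
     \int[lebesgue_measure]_(s in `[0%R, t]) g s)%E.
  move=> g0.
  exact: (lower_integral_invol mrho rhoK (@lebesgue_reflect R t) Drho).
have Ep := E ((EFin \o f)^\+)%E (fun x => funepos_ge0 _ x).
have En := E ((EFin \o f)^\-)%E (fun x => funeneg_ge0 _ x).
congr (_ - _)%E.
  by rewrite -[RHS]Ep; apply: eq_integral => x _; rewrite !funeposE.
by rewrite -[RHS]En; apply: eq_integral => x _; rewrite !funenegE.
Qed.

Lemma cvg_EFin_seq (R : realType) T (F : set_system T) {FF : Filter F} (u : T -> R) (l : R) :
  u @ F --> l -> (u t)%:E @[t --> F] --> l%:E.
Proof. by move=> ul; apply: cvg_EFin => //; exact: nearW. Qed.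

Lemma integrable_bounded d (T : measurableType d) (R : realType) (m : {measure set T -> \bar R})
    (f : T -> R) (M : R) : (m setT < +oo)%E -> measurable_fun [set: T] f ->
  (forall t, `|f t| <= M) -> m.-integrable setT (EFin \o f).
Proof.
move=> mT mf fM; apply: measurable_bounded_integrable => //.
by exists M; split => [|x Mx y _]; [exact: num_real|apply: le_trans (fM y) (ltW Mx)].
Qed.

Lemma Rintegral_bounded_cvg d (T : measurableType d) (R : realType)
    (m : {measure set T -> \bar R}) (f_ : nat -> T -> R) (f : T -> R) (M : R) :
  (m setT < +oo)%E -> (forall n, measurable_fun [set: T] (f_ n)) ->
  (forall n t, `|f_ n t| <= M) -> (forall t, f_ n t @[n --> \oo] --> f t) ->
  \int[m]_t f_ n t @[n --> \oo] --> \int[m]_t f t.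
Proof.
move=> mT mf_ fM cf.
have mf : measurable_fun [set: T] f by apply: (@measurable_fun_cvg _ _ _ _ f_).
have fb t : `|f t| <= M.
  have H : `|f_ n t| @[n --> \oo] --> `|f t| by apply: cvg_norm; exact: cf.
  by apply: (cvgr_to_le H); exact: nearW.
have iM : m.-integrable setT (EFin \o cst M).
  by apply: (integrable_bounded (M := `|M|)) => // t; rewrite /cst.
have mEf_ n : measurable_fun [set: T] (EFin \o f_ n) by exact/measurable_EFinP.
have mEf : measurable_fun [set: T] (EFin \o f) by exact/measurable_EFinP.
have [_ _ /=] := @dominated_convergence _ T R m setT measurableT
  (fun n => EFin \o f_ n) (EFin \o f) (EFin \o cst M) mEf_ mEf
  (aeW _ (fun (x : T) _ => cvg_EFin_seq (cf x))) iM
  (aeW _ (fun (x : T) n _ => fM n x)).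
rewrite -(@fineK _ (\int[m]_t (EFin \o f) t)%E); last first.
  by apply: integrable_fin_num => //; exact: (integrable_bounded (M := M)).
by move=> /fine_cvg; exact.
Qed.

Lemma Rintegral_dist_le d (T : measurableType d) (R : realType)
    (m : {measure set T -> \bar R}) (f g : T -> R) (e : R) : m setT = 1%E ->
  measurable_fun [set: T] f -> measurable_fun [set: T] g ->
  (exists M : R, forall t, `|f t| <= M) -> (exists M : R, forall t, `|g t| <= M) ->
  (forall t, `|f t - g t| <= e) -> `|\int[m]_t f t - \int[m]_t g t| <= e.
Proof.
move=> m1 mf mg [M fM] [N gN] fg; have mfin : (m setT < +oo)%E by rewrite m1 ltry.
rewrite -RintegralB//; [|exact: integrable_bounded fM|exact: integrable_bounded gN].
apply: (@Rintegral_le_norm _ _ _ _ _ _ (cst e)); first by move=> t _; exact: fg.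
have -> : (\int[m]_t (cst e t)%:E = e%:E * m setT)%E.
  exact: (@integral_cst _ T R m setT measurableT e%:E).
by rewrite m1 mule1.
Qed.

(** * Countable families of tents *)

Section tents.
Context (R : realType).

Lemma continuous_minr (X : topologicalType) (f g : X -> R) :
  continuous f -> continuous g -> continuous (fun y => Num.min (f y) (g y)).
Proof. by move=> cf cg x; exact: (@continuous_min R X f g x (cf x) (cg x)). Qed.

Lemma continuous_maxr (X : topologicalType) (f g : X -> R) :
  continuous f -> continuous g -> continuous (fun y => Num.max (f y) (g y)).
Proof. by move=> cf cg x; exact: (@continuous_max R X f g x (cf x) (cg x)). Qed.

Lemma continuous_tent (X : topologicalType) (f : X -> R) (r q : R) :
  continuous f -> continuous (fun x => Num.max 0 (r - `|expR (- f x) - q|)).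
Proof.
move=> cf; apply: continuous_maxr => x; first exact: cvg_cst.
apply: cvgB; first exact: cvg_cst.
apply: cvg_norm; apply: cvgB; last exact: cvg_cst.
apply: (@continuous_comp _ _ _ (fun x => - f x) expR); first by apply: cvgN; exact: cf.
exact: continuous_expR.
Qed.

Lemma continuous_affine (X : topologicalType) (f : X -> R) (a s : R) :
  continuous f -> continuous (fun x => a + s * f x).
Proof.
move=> cf x; apply: cvgD; first exact: cvg_cst.
by apply: cvgM; [exact: cvg_cst|exact: cf].
Qed.

(** A countable base of the topology, given by continuous functions whose
    positivity sets form it; functions can be added, multiplied and cut off,
    which sets cannot. *)
Definition tent_base (X : topologicalType) (psi : nat -> X -> R) : Prop :=
  [/\ forall n x, 0 <= psi n x, forall n, continuous (psi n) &
      forall (O : set X) x, open O -> O x ->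
        exists2 n, 0 < psi n x & [set y | 0 < psi n y] `<=` O].

(** Compactness is applied to the covering by balls in the form of near
    coverings, filtered by the finite sets of centres. *)
Lemma compact_net (K : metricType R) (e : R) : compact [set: K] -> 0 < e ->
  exists s : seq K, forall x, exists2 c, c \in s & mdist c x < e.
Proof.
move=> /compact_near_coveringP cK e0.
pose F : set_system (seq K) :=
  filter_from [set: seq K] (fun s => [set t : seq K | {subset s <= t}]).
have FF : Filter F.
  apply: filter_fromT_filter; first by exists [::].
  move=> s t; exists (s ++ t) => u /= H; split => x xs; apply: H.
    by rewrite mem_cat xs.
  by rewrite mem_cat xs orbT.
have [] := cK _ F (fun s x => exists2 c, c \in s & mdist c x < e) FF.
  move=> x _; exists (ball x e, [set t : seq K | {subset [:: x] <= t}]) => /=.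
    split; first exact: nbhsx_ballx.
    by exists [:: x].
  move=> [y s]/= [xy xs]; exists x; first by rewrite xs ?mem_head.
  by move: xy; rewrite ballEmdist.
by move=> s _ /(_ s (fun x xs => xs)) H; exists s => x; exact: H.
Qed.

Lemma compact_dense_sequence (K : metricType R) (k0 : K) : compact [set: K] ->
  exists c : nat -> K, forall x e, 0 < e -> exists n, mdist (c n) x < e.
Proof.
move=> cK.
have net n : exists s : seq K, forall x, exists2 c, c \in s & mdist c x < n.+1%:R^-1.
  exact: compact_net.
pose s n := projT1 (cid (net n)).
have sP n x : exists2 c, c \in s n & mdist c x < n.+1%:R^-1.
  exact: (projT2 (cid (net n))).
exists (fun k => if unpickle k is Some p then nth k0 (s p.1) p.2 else k0) => x e e0.
have [n] := ltr_add_invr e0; rewrite add0r => ne.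
have [c cs cx] := sP n x.
exists (pickle (n, index c (s n))); rewrite pickleK/= nth_index//.
exact: lt_trans cx ne.
Qed.

Lemma continuous_mdist (K : metricType R) (c : K) : continuous (fun x => mdist c x : R).
Proof.
move=> x; apply/cvgrPdist_lt => e e0; near=> y.
have xy : mdist x y < e.
  by near: y; apply/nbhs_ballP; exists e => //= z; rewrite ballEmdist.
have /= := metric_triangle c x y; have /= := metric_triangle c y x.
by rewrite (metric_sym y x) ltr_norml => *; lra.
Unshelve. all: by end_near. Qed.

(** A Lusin space inherits from the compact metric space into which it embeds
    the cones over the balls centred at a dense sequence. *)
Lemma lusin_tent_base (E : ptopologicalType) : lusin_space R E ->
  exists psi : nat -> E -> R, tent_base psi.
Proof.
move=> [K [i [cK _ iopen _]]].
have [c cP] := compact_dense_sequence (i point) cK.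
have icont : continuous i.
  by apply/continuousP => A oA; apply/iopen; exists A.
exists (fun k x => if unpickle k is Some p then
   Num.max 0 (p.1.+1%:R^-1 - mdist (c p.2) (i x)) else 0); split.
- by move=> k x; case: unpickle => // p; rewrite le_max lexx.
- move=> k; case: unpickle => [p|]; last by move=> x; exact: cvg_cst.
  move=> x; apply: (@continuous_comp _ _ _
    (fun x => p.1.+1%:R^-1 - mdist (c p.2) (i x) : R) (fun y : R => Num.max 0 y)).
    apply: cvgB; first exact: cvg_cst.
    apply: (@continuous_comp _ _ _ i (fun z => mdist (c p.2) z : R)); first exact: icont.
    exact: continuous_mdist.
  apply: (@continuous_maxr R (cst 0) id) => y; [exact: cvg_cst|exact: cvg_id].
- move=> W x /iopen [U oU <-] /= Ux.
  have [e/= e0 eU] : exists2 e : R, 0 < e & ball (i x) e `<=` U.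
    by have /nbhs_ballP[e /= e0 h] := open_nbhs_nbhs (conj oU Ux); exists e.
  have e20 : 0 < e / 2 by rewrite divr_gt0.
  have [n] := ltr_add_invr e20; rewrite add0r => ne.
  have n0 : 0 < n.+1%:R^-1 :> R by [].
  have [k ck] := cP (i x) _ n0.
  exists (pickle (n, k)); rewrite pickleK/=; first by rewrite lt_max subr_gt0 ck orbT.
  move=> y; rewrite /= lt_max ltxx/= subr_gt0 => cky; apply: eU.
  rewrite ballEmdist/=; have := metric_triangle (i x) (c k) (i y).
  move=> /le_lt_trans; apply; rewrite (metric_sym (i x)) (splitr e).
  by apply: ltrD; [exact: lt_trans ck ne|exact: lt_trans cky ne].
Qed.

Lemma continuous_lsc (X : topologicalType) (G : X -> R) : continuous G ->
  forall q, open [set y | q < G y].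
Proof.
move=> cG q; apply: (@open_comp _ _ G [set z | q < z]); last exact: open_gt.
by move=> ? _; exact: cG.
Qed.

Lemma indic_lsc (X : topologicalType) (O : set X) : open O ->
  forall q, open [set y | q < (\1_O y : R)].
Proof.
move=> oO q; have [q0|q0] := ltP q 0.
  rewrite (_ : [set y | _] = setT); first exact: openT.
  by apply/seteqP; split => // y _ /=; rewrite indicE (lt_le_trans q0).
have [q1|q1] := ltP q 1; last first.
  rewrite (_ : [set y | _] = set0); first exact: open0.
  apply/seteqP; split => // y /=; rewrite indicE ltNge => /negP; apply.
  by apply: le_trans q1; case: (_ \in _).
rewrite (_ : [set y | _] = O)//; apply/seteqP; split => y /=; rewrite indicE.
  by case: (boolP (y \in O)) => [/set_mem//|_]; rewrite ltNge q0.
by move=> Oy; rewrite mem_set.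
Qed.

Section lower_approximation.
Variables (X : topologicalType) (psi : nat -> X -> R).
Hypothesis psiP : tent_base psi.

(* A tent times a natural number, cut off at a rational height; the rational
   may be negative, hence the maximum with 0. *)
Let elem (p : nat * nat * rat) (x : X) : R :=
  Num.min (Num.max 0 (ratr p.2)) (p.1.2%:R * psi p.1.1 x).

Let elem_ge0 p x : 0 <= elem p x.
Proof.
by case: psiP => p0 _ _; rewrite le_min le_max lexx/= mulr_ge0.
Qed.

Let elem_cont p : continuous (elem p).
Proof.
case: psiP => _ pc _; apply: continuous_minr => x; first exact: cvg_cst.
by apply: cvgM; [exact: cvg_cst|exact: pc].
Qed.

Definition tent_sup (l : seq (nat * nat * rat)) (x : X) : R :=
  foldr (fun p m => Num.max (elem p x) m) 0 l.

Let tent_sup_ge0 l x : 0 <= tent_sup l x.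
Proof. by elim: l => //= p l ih; rewrite le_max ih orbT. Qed.

Let tent_sup_cont l : continuous (tent_sup l).
Proof.
elim: l => [|p l ih]; first by move=> x; exact: cvg_cst.
by apply: continuous_maxr; [exact: elem_cont|exact: ih].
Qed.

Let tent_sup_bound l : exists M, forall x, tent_sup l x <= M.
Proof.
elim: l => [|p l [M ih]]; first by exists 0.
exists (Num.max (Num.max 0 (ratr p.2)) M) => x /=.
rewrite ge_max !le_max ih orbT andbT; apply/orP; left; apply/orP.
by rewrite /elem; case: (leP 0 (ratr p.2 : R)) => h; [right|left];
  rewrite ge_min lexx.
Qed.

Let tent_sup_le l (G : X -> R) x : 0 <= G x ->
  (forall p, p \in l -> elem p x <= G x) -> tent_sup l x <= G x.
Proof.
move=> G0; elim: l => //= p l ih H; rewrite ge_max H ?mem_head//= ih// => q ql.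
by apply: H; rewrite inE ql orbT.
Qed.

Let tent_sup_mem l p x : p \in l -> elem p x <= tent_sup l x.
Proof.
elim: l => //= q l ih; rewrite inE => /orP[/eqP ->|/ih h]; rewrite le_max ?lexx//.
by rewrite h orbT.
Qed.

Definition tent_fun (k : nat) : X -> R :=
  if unpickle k is Some l then tent_sup l else cst 0.

Lemma tent_fun_ge0 k x : 0 <= tent_fun k x.
Proof. by rewrite /tent_fun; case: unpickle. Qed.

Lemma tent_fun_cont k : continuous (tent_fun k).
Proof.
by rewrite /tent_fun; case: unpickle => [l|]; [exact: tent_sup_cont|move=> x; exact: cvg_cst].
Qed.

Lemma tent_fun_bound k : exists M, forall x, tent_fun k x <= M.
Proof. by rewrite /tent_fun; case: unpickle => [l|]; [exact: tent_sup_bound|exists 0]. Qed.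

(** Every nonnegative lower semicontinuous function is the supremum of the
    truncated tents below it, and there are countably many of them. *)
Lemma tent_fun_approx (G : X -> R) : (forall q, open [set y | q < G y]) ->
  (forall x, 0 <= G x) ->
  exists kappa : nat -> nat, [/\ forall N x, tent_fun (kappa N) x <= G x,
    forall x, {homo (fun N => tent_fun (kappa N) x) : m n / (m <= n)%N >-> m <= n} &
    forall x, tent_fun (kappa N) x @[N --> \oo] --> G x].
Proof.
move=> oG G0; case: psiP => p0 _ pO.
pose adm p := `[< forall x, elem p x <= G x >].
pose l N := [seq p <- pmap unpickle (iota 0 N) | adm p] : seq (nat * nat * rat).
have lE N x : tent_fun (pickle (l N)) x = tent_sup (l N) x.
  by rewrite /tent_fun pickleK.
have lG N x : tent_sup (l N) x <= G x.
  apply: tent_sup_le => // p; rewrite mem_filter => /andP[/asboolP h _]; exact: h.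
have sub m n : (m <= n)%N -> {subset l m <= l n}.
  move=> mn p; rewrite !mem_filter => /andP[-> /=].
  rewrite !mem_pmap => /mapP[k]; rewrite mem_iota/= => km e.
  by apply/mapP; exists k; rewrite ?mem_iota//= (leq_trans km).
have mono x : {homo (fun N => tent_sup (l N) x) : m n / (m <= n)%N >-> m <= n}.
  move=> m n mn; apply: tent_sup_le => // p /(sub _ _ mn); exact: tent_sup_mem.
exists (fun N => pickle (l N)); split => [N x|x m n mn|x].
- by rewrite lE.
- by rewrite !lE; exact: mono.
under eq_fun do rewrite lE.
apply/cvgrPdist_le => e e0.
suff [N HN] : exists N, G x - e <= tent_sup (l N) x.
  exists N => // n /= Nn; have mNn := mono x _ _ Nn; have lGn := lG n x.
  by rewrite ger0_norm; lra.
have [Ge|Ge] := leP (G x) e.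
  by exists 0%N; apply: le_trans (tent_sup_ge0 _ _); lra.
(* A rational height just below [G x], reached near [x] by a steep tent. *)
have [q /andP[q1 q2]] : exists q : rat, (G x - e < ratr q < G x).
  by have := @rat_in_itvoo R (G x - e) (G x); rewrite ltrBlDr ltrDl => /(_ e0)[q]; exists q.
have q0 : 0 < ratr q :> R by lra.
have [n pn pnO] := pO _ _ (oG _) q2.
pose m := Num.bound (ratr q / psi n x).
have mq : ratr q <= m%:R * psi n x.
  rewrite -ler_pdivrMr//; apply: ltW; apply: archi_boundP.
  by rewrite divr_ge0// ltW.
have adm0 : adm (n, m, q).
  apply/asboolP => y; rewrite /elem/=.
  have [py|py] := ltP 0 (psi n y).
    by rewrite ge_min ge_max G0/= (ltW (pnO y py)).
  have -> : psi n y = 0 by apply/eqP; rewrite eq_le py p0.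
  by rewrite mulr0 ge_min G0 orbT.
exists (pickle (n, m, q)).+1.
apply: (@le_trans _ _ (elem (n, m, q) x)).
  by rewrite /elem/= le_min le_max (ltW q1) orbT/= (le_trans _ mq)// ltW.
apply: tent_sup_mem; rewrite mem_filter adm0 mem_pmap; apply/mapP.
by exists (pickle (n, m, q)); rewrite ?mem_iota ?pickleK// add0n ltnSn.
Qed.

End lower_approximation.

Lemma continuous_measurable_Borel (X : ptopologicalType) (f : X -> R) :
  continuous f -> measurable_fun [set: Borel X] (f : Borel X -> R).
Proof.
move=> cf; apply: (measurability _ (RGenOpens.measurableE R)).
move=> _ [_ [a [b ->] <-]]; rewrite setTI; apply: sub_sigma_algebra.
by apply: open_comp; [move=> ? _; exact: cf|exact: interval_open].
Qed.

End tents.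

(** * Mixtures and densities *)

(** The measure [\int m(dx) k(x, .)], for a family [k] of measures that need not
    be packaged as a kernel. *)
Section mixture.
Context d d' (X : measurableType d) (Y : measurableType d') (R : realType).
Variables (m : {measure set X -> \bar R}) (k : X -> {measure set Y -> \bar R}).
Hypothesis mk : forall A, measurable A -> measurable_fun [set: X] (k ^~ A).
Local Open Scope ereal_scope.

Import HBNNSimple.

Definition mixture_fun (A : set Y) : \bar R := \int[m]_x k x A.

Let mixture0 : mixture_fun set0 = 0.
Proof. by rewrite /mixture_fun integral0_eq// => x _; rewrite measure0. Qed.

Let mixture_ge0 A : 0 <= mixture_fun A.
Proof. exact: integral_ge0. Qed.

Let mixture_sigma_additive : semi_sigma_additive mixture_fun.
Proof.
move=> F mF tF mUF; rewrite /mixture_fun.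
rewrite (_ : \int[m]_x _ = \int[m]_x (\sum_(n <oo) k x (F n))); last first.
  by apply: eq_integral => x _; rewrite measure_semi_bigcup.
rewrite integral_nneseries//; last by move=> n; exact: mk.
by apply: is_cvg_ereal_nneg_natsum_cond => n _ _; exact: mixture_ge0.
Qed.

Let mixture_isMeasure := isMeasure.Build _ _ _ mixture_fun
  mixture0 mixture_ge0 mixture_sigma_additive.

Definition mixture : {measure set Y -> \bar R} := HB.pack mixture_fun mixture_isMeasure.

Lemma mixtureE (A : set Y) : mixture A = \int[m]_x k x A.
Proof. by []. Qed.

Lemma ge0_integral_mixture (f : Y -> \bar R) :
  measurable_fun [set: Y] f -> (forall y, 0 <= f y) ->
  \int[mixture]_y f y = \int[m]_x \int[k x]_y f y.
Proof.
move=> mf f0; pose f_ := nnsfun_approx measurableT mf.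
have mf_ n : measurable_fun [set: Y] (EFin \o f_ n) by exact/measurable_EFinP.
have f_0 n y : 0 <= (f_ n y)%:E by rewrite lee_fin.
have f_nd y : {homo (fun n => (f_ n y)%:E) : a b / (a <= b)%N >-> a <= b}.
  by move=> a b ab; rewrite lee_fin; exact/lefP/nd_nnsfun_approx.
have limE (mu : {measure set Y -> \bar R}) :
    \int[mu]_y f y = limn (fun n => \int[mu]_y (f_ n y)%:E).
  rewrite -monotone_convergence//.
  by apply: eq_integral => y _; apply/esym/cvg_lim => //; exact: cvg_nnsfun_approx.
rewrite limE; under [RHS]eq_integral do rewrite limE.
rewrite monotone_convergence//; last 3 first.
- by move=> n; exact: (@measurable_fun_integral_kernel _ _ X Y R k mk (fun y => (f_ n y)%:E) (f_0 n) (mf_ n)).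
- by move=> n x _; exact: integral_ge0.
- by move=> x _ a b ab; apply: le_lower_integral => // y _; exact: f_nd.
congr (limn _); apply/funext => n; rewrite integralT_nnsfun sintegralE.
under [RHS]eq_integral do rewrite integralT_nnsfun sintegralE.
rewrite ge0_integral_fsum//; last 2 first.
- move=> r; have [r0|r0] := leP 0%R r; first by apply: measurable_funeM; exact: mk.
  by under eq_fun do rewrite preimage_nnfun0// measure0 mule0; exact: measurable_cst.
- by move=> r x _; apply: (mulemu_ge0 (fun r => f_ n @^-1` [set r])); exact: preimage_nnfun0.
apply: eq_fsbigr => r _; have [r0|r0] := leP 0%R r.
  by rewrite mixtureE ge0_integralZl//; exact: mk.
rewrite preimage_nnfun0// measure0 mule0 integral0_eq// => x _.
by rewrite measure0 mule0.
Qed.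

End mixture.

(** A density is a mixture of weighted Dirac masses. *)
Section density.
Context d (T : measurableType d) (R : realType).
Variables (m : {measure set T -> \bar R}) (k : T -> R).
Hypothesis mk : measurable_fun [set: T] k.
Hypothesis k_ge0 : forall x, 0 <= k x.
Local Open Scope ereal_scope.

Let weighted (x : T) : {measure set T -> \bar R} := mscale (NngNum (k_ge0 x)) \d_x.

Let measurable_weighted A : measurable A -> measurable_fun [set: T] (weighted ^~ A).
Proof.
move=> mA; rewrite /weighted /mscale/= /dirac.
by apply: emeasurable_funM; apply/measurable_EFinP => //; exact: measurable_indic.
Qed.

Definition density : {measure set T -> \bar R} := mixture m measurable_weighted.

Lemma densityE (A : set T) : density A = \int[m]_(x in A) (k x)%:E.
Proof.
rewrite [RHS]integral_mkcond; apply: eq_integral => x _.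
rewrite -[LHS]/((k x)%:E * \d_x A) diracE /patch.
by case: (x \in A); rewrite ?mule1 ?mule0.
Qed.

Lemma ge0_integral_density (f : T -> \bar R) :
  measurable_fun [set: T] f -> (forall x, 0 <= f x) ->
  \int[density]_x f x = \int[m]_x (f x * (k x)%:E).
Proof.
move=> mf f0; rewrite ge0_integral_mixture//; apply: eq_integral => x _.
by rewrite ge0_integral_mscale// integral_dirac// diracT mul1e muleC.
Qed.

End density.

Lemma ge0_integral_mrestr d (T : measurableType d) (R : realType) (m : {measure set T -> \bar R})
    (D : set T) (mD : measurable D) (f : T -> \bar R) :
  measurable_fun [set: T] f -> (forall x, 0 <= f x)%E ->
  (\int[mrestr m mD]_x f x = \int[m]_(x in D) f x)%E.
Proof.
move=> mf f0; have mI : measurable_fun [set: T] (\1_D : T -> R) by exact: measurable_indic.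
have I0 x : 0 <= (\1_D x : R) by rewrite indicE.
rewrite (_ : (\int[_]_x f x = \int[density m mI I0]_x f x)%E).
  rewrite ge0_integral_density// [RHS]integral_mkcond; apply: eq_integral => x _.
  by rewrite patchE indicE; case: ifPn => _; rewrite ?mule1 ?mule0.
apply: eq_measure_integral => A mA _.
by rewrite densityE integral_indic// setIC.
Qed.

(** The argument [m1] of [to_probability_fun] keeps the probability structure
    attached to this measure rather than to all measures. *)
Section to_probability.
Context d (T : measurableType d) (R : realType) (m : {measure set T -> \bar R}).
Hypothesis m1 : m setT = 1%E.

Definition to_probability_fun (_ : m setT = 1%E) : set T -> \bar R := m.

HB.instance Definition _ := Measure.on (to_probability_fun m1).
HB.instance Definition _ := Measure_isProbability.Build _ _ _ (to_probability_fun m1) m1.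

Definition to_probability : probability T R := to_probability_fun m1.

End to_probability.

(** The values of a measure on nonmeasurable sets are reset to 0, the
    normalization required of the points of [Mh h]. *)
Section measurable_values.
Context d (T : measurableType d) (R : realType).
Variable m : {measure set T -> \bar R}.
Local Open Scope ereal_scope.

Definition on_measurable_fun (A : set T) : \bar R := if `[<measurable A>] then m A else 0.

Let om0 : on_measurable_fun set0 = 0.
Proof. by rewrite /on_measurable_fun; case: asboolP => // _; exact: measure0. Qed.

Let om_ge0 A : 0 <= on_measurable_fun A.
Proof. by rewrite /on_measurable_fun; case: asboolP. Qed.

Let om_sigma_additive : semi_sigma_additive on_measurable_fun.
Proof.
move=> F mF tF mUF; rewrite /on_measurable_fun asboolT//.
have -> : (fun n => \sum_(0 <= i < n) (if `[< measurable (F i) >] then m (F i) else 0)) =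
  (fun n => \sum_(0 <= i < n) m (F i)).
  by apply/funext => n; apply: eq_bigr => i _; rewrite asboolT.
exact: measure_semi_sigma_additive.
Qed.

Let om_isMeasure := isMeasure.Build _ _ _ on_measurable_fun om0 om_ge0 om_sigma_additive.

Definition on_measurable : {measure set T -> \bar R} := HB.pack on_measurable_fun om_isMeasure.

Lemma on_measurableE (A : set T) : measurable A -> on_measurable A = m A.
Proof. by move=> mA; rewrite /on_measurable/= /on_measurable_fun asboolT. Qed.

Lemma on_measurable_nonmeasurable (A : set T) : ~ measurable A -> on_measurable A = 0.
Proof. by move=> mA; rewrite /on_measurable/= /on_measurable_fun asboolF. Qed.

Lemma integral_on_measurable (D : set T) (f : T -> \bar R) : measurable D ->
  \int[on_measurable]_(x in D) f x = \int[m]_(x in D) f x.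
Proof.
by move=> mD; apply: eq_measure_integral => A mA _; rewrite on_measurableE.
Qed.

End measurable_values.

(** * The space of measures *)

Section Mh_pairing.
Context (R : realType) (E : ptopologicalType) (h : E -> R).
Hypothesis h_gt0 : forall x, 0 < h x.
Implicit Types (f g : E -> R) (nu : Mh h).

Lemma hnorm_leP f (M : R) : (hnorm h f <= M%:E)%E <-> forall x, `|f x| <= M * h x.
Proof.
split=> [H x|H].
  rewrite -ler_pdivrMr// -lee_fin; apply: le_trans H.
  by apply: ereal_sup_ubound; exists x.
apply: ge_ereal_sup => _ [x _ <-]; by rewrite lee_fin ler_pdivrMr.
Qed.

Lemma Bh_bound f : Bh h f -> exists2 M : R, 0 <= M & forall x, `|f x| <= M * h x.
Proof.
move=> [_ Hf].
have h0 : (0 <= hnorm h f)%E.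
  apply: le_trans (ereal_sup_ubound _); last by exists point.
  by rewrite lee_fin divr_ge0// ltW.
exists (fine (hnorm h f)); first exact: fine_ge0.
by apply/hnorm_leP; rewrite fineK// ge0_fin_numE.
Qed.

Lemma Bh_intro f (M : R) : measurable_fun [set: Borel E] (f : Borel E -> R) ->
  (forall x, `|f x| <= M * h x) -> Bh h f.
Proof. by move=> mf /hnorm_leP H; split => //; apply: le_lt_trans H (ltry _). Qed.

Lemma Bh_measurable f : Bh h f -> measurable_fun [set: Borel E] (f : Borel E -> R).
Proof. by case. Qed.

Hypothesis h_cont : continuous h.

Lemma measurable_h : measurable_fun [set: Borel E] (h : Borel E -> R).
Proof. exact: continuous_measurable_Borel. Qed.

Lemma Bh_weight : Bh_pos h h.
Proof.
split; last by move=> x; exact: ltW.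
by apply: (@Bh_intro _ 1); [exact: measurable_h|move=> x; rewrite mul1r gtr0_norm].
Qed.

Lemma Bh_weightM g (M : R) : measurable_fun [set: Borel E] (g : Borel E -> R) ->
  (forall x, 0 <= g x) -> (forall x, g x <= M) -> Bh_pos h (fun x => h x * g x).
Proof.
move=> mg g0 gM; split; last by move=> x; rewrite mulr_ge0// ltW.
apply: (@Bh_intro _ M); first by apply: measurable_funM => //; exact: measurable_h.
by move=> x; rewrite normrM gtr0_norm// ger0_norm// mulrC ler_wpM2r// ltW.
Qed.

Lemma Bh_div f : Bh_pos h f -> measurable_fun [set: Borel E] ((fun x => f x / h x) : Borel E -> R).
Proof.
move=> [[mf _] _]; apply: measurable_funM => //.
apply: continuous_measurable_Borel => x; apply: cvgV; first by rewrite gt_eqF.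
exact: h_cont.
Qed.

Lemma BhD f g : Bh h f -> Bh h g -> Bh h (f \+ g).
Proof.
move=> Bf Bg; have [M _ fM] := Bh_bound Bf; have [N _ gN] := Bh_bound Bg.
apply: (@Bh_intro _ (M + N)).
  by apply: measurable_funD; exact: Bh_measurable.
by move=> x; rewrite mulrDl; apply: le_trans (ler_normD _ _) _; rewrite lerD.
Qed.

Lemma BhZ (a : R) f : Bh h f -> Bh h (fun x => a * f x).
Proof.
move=> Bf; have [M _ fM] := Bh_bound Bf.
apply: (@Bh_intro _ (`|a| * M)).
  by apply: measurable_funM => //; exact: Bh_measurable.
by move=> x; rewrite normrM -mulrA ler_wpM2l.
Qed.

Lemma Bh_pos0 : Bh_pos h (cst 0).
Proof.
by split => //; apply: (@Bh_intro _ 0) => // x; rewrite normr0 mul0r.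
Qed.

Lemma Bh_integrable nu f : Bh h f -> nu.-integrable [set: Borel E] (EFin \o f).
Proof.
move=> Bf; have [M M0 fM] := Bh_bound Bf.
apply/integrableP; split; first by apply/measurable_EFinP; exact: Bh_measurable.
apply: (@le_lt_trans _ _ (\int[nu]_x (M%:E * (h x)%:E))%E).
  by apply: le_lower_integral => // x _ /=; rewrite -EFinM lee_fin.
rewrite ge0_integralZl//.
- by apply: lte_mul_pinfty => //; rewrite ?lee_fin// Mh_finite.
- by apply/measurable_EFinP; exact: measurable_h.
- by move=> x _; rewrite lee_fin ltW.
Qed.

Lemma pairingE nu f : Bh h f -> (pairing f nu)%:E = (\int[nu]_x (f x)%:E)%E.
Proof.
move=> Bf; rewrite /pairing /Rintegral fineK//.
apply: integrable_fin_num => //; exact: Bh_integrable.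
Qed.

Let Mh_of_subproof (m : {measure set (Borel E) -> \bar R}) :
  (\int[m]_x (h x)%:E < +oo)%E -> (\int[on_measurable m]_x (h x)%:E < +oo)%E.
Proof. by rewrite integral_on_measurable. Qed.

Definition Mh_of (m : {measure set (Borel E) -> \bar R})
    (m_fin : (\int[m]_x (h x)%:E < +oo)%E) : Mh h :=
  MkMh (Mh_of_subproof m_fin)
    (@on_measurable_nonmeasurable _ _ _ m).

Lemma Mh_ofE m m_fin f : pairing f (@Mh_of m m_fin) = \int[m]_x f x.
Proof. by rewrite /pairing /Rintegral integral_on_measurable. Qed.

Lemma pairing_ge0 nu f : (forall x, 0 <= f x) -> 0 <= pairing f nu.
Proof. by move=> f0; exact: Rintegral_ge0. Qed.

Lemma le_pairing nu f g : Bh h f -> Bh h g -> (forall x, f x <= g x) ->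
  pairing f nu <= pairing g nu.
Proof. by move=> Bf Bg fg; apply: le_Rintegral => //; exact: Bh_integrable. Qed.

Lemma pairingD nu f g : Bh h f -> Bh h g ->
  pairing (f \+ g) nu = pairing f nu + pairing g nu.
Proof. by move=> Bf Bg; apply: RintegralD => //; exact: Bh_integrable. Qed.

Lemma pairingZ nu (a : R) f : Bh h f -> pairing (fun x => a * f x) nu = a * pairing f nu.
Proof. by move=> Bf; apply: RintegralZl => //; exact: Bh_integrable. Qed.

Lemma pairing_leM nu f (M : R) : Bh h f -> (forall x, f x <= M * h x) ->
  pairing f nu <= M * pairing h nu.
Proof.
move=> Bf fM; rewrite -(pairingZ nu M Bh_weight.1); apply: le_pairing => //.
by apply: BhZ; exact: Bh_weight.1.
Qed.

(** Estimates for integrals against an arbitrary measure integrating [h] thereby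
    follow from the calculus of [pairing]. *)
Lemma Mh_represents (m : {measure set (Borel E) -> \bar R}) (C : R) :
  (\int[m]_x (h x)%:E <= C%:E)%E ->
  exists nu : Mh h, (forall f, \int[m]_x f x = pairing f nu) /\ pairing h nu <= C.
Proof.
move=> mC; have mfin : (\int[m]_x (h x)%:E < +oo)%E by exact: le_lt_trans mC (ltry _).
exists (Mh_of mfin); split=> [f|]; first by rewrite Mh_ofE.
by rewrite -lee_fin (pairingE _ Bh_weight.1) integral_on_measurable.
Qed.

Lemma pairing0 nu : pairing (cst 0) nu = 0.
Proof. by rewrite /pairing /Rintegral integral0. Qed.

Lemma pairing_zero f : pairing f (Mh_zero h) = 0.
Proof. by rewrite /pairing /Rintegral integral_measure_zero. Qed.

Lemma Ch_weightM g (M : R) : continuous g -> (forall x, 0 <= g x) ->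
  (forall x, g x <= M) -> Ch h (fun x => h x * g x).
Proof.
move=> cg g0 gM; split.
  by have [] := Bh_weightM (continuous_measurable_Borel cg) g0 gM.
by move=> x; apply: cvgM; [exact: h_cont|exact: cg].
Qed.

Lemma Ch_weight : Ch h h.
Proof. by split; [have [] := Bh_weight|exact: h_cont]. Qed.

Lemma continuous_pairing f : Ch h f -> continuous (fun nu : Mh h => pairing f nu).
Proof.
move=> Cf nu.
have ev := @initial_continuous (Mh h) _ (@Mh_eval R E h) nu.
have pf := @proj_continuous (Ch h) (fun=> R) (SigSub (mem_set Cf)) (Mh_eval nu).
exact: (cvg_comp _ _ ev pf).
Qed.

Lemma cvg_pairing nu (f_ : nat -> E -> R) f (M : R) :
  (forall n, measurable_fun [set: Borel E] (f_ n : Borel E -> R)) ->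
  (forall n x, `|f_ n x| <= M * h x) ->
  (forall x, f_ n x @[n --> \oo] --> f x) ->
  pairing (f_ n) nu @[n --> \oo] --> pairing f nu.
Proof.
move=> mf_ fM cvg.
have mf : measurable_fun [set: Borel E] (f : Borel E -> R).
  by apply: (@measurable_fun_cvg _ _ _ _ (f_ : nat -> Borel E -> R)) => // x _; exact: cvg.
have fb x : `|f x| <= M * h x.
  have H : `|f_ n x| @[n --> \oo] --> `|f x| by apply: cvg_norm; exact: cvg.
  by apply: (cvgr_to_le H); exact: nearW.
have Bf := Bh_intro mf fb.
have mEf_ n : measurable_fun [set: Borel E] (EFin \o f_ n).
  by apply/measurable_EFinP; exact: mf_.
have mEf : measurable_fun [set: Borel E] (EFin \o f).
  by apply/measurable_EFinP; exact: mf.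
have [_ _ /=] := @dominated_convergence _ (Borel E) R nu setT measurableT
  (fun n => EFin \o f_ n) (EFin \o f) (fun x => (M * h x)%:E) mEf_ mEf
  (aeW _ (fun (x : Borel E) _ => cvg_EFin_seq (cvg x))) (Bh_integrable nu (BhZ M Bh_weight.1))
  (aeW _ (fun (x : Borel E) n _ => fM n x)).
rewrite -pairingE// => /fine_cvg; rewrite /pairing/= => H.
exact: H.
Qed.

End Mh_pairing.

(** * The topology and the Borel structure of the space of measures *)

Section Mh_borel.
Context (R : realType) (E : ptopologicalType) (h : E -> R).
Hypothesis h_gt0 : forall x, 0 < h x.
Hypothesis h_cont : continuous h.
Variable psi : nat -> E -> R.
Hypothesis psiP : tent_base psi.
Implicit Types (f g : E -> R) (nu : Mh h).

Let mh := measurable_h h_cont.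
Let h_ge0 x : 0 <= h x. Proof. exact: ltW. Qed.

Let measurable_pairing_cont f : Ch h f ->
  measurable_fun [set: Mh h] (fun nu : Mh h => pairing f nu).
Proof.
by move=> Cf; apply: continuous_measurable_Borel; exact: continuous_pairing.
Qed.

Let measurable_pairing_open (O : set E) : open O ->
  measurable_fun [set: Mh h] (fun nu : Mh h => pairing (fun x => h x * \1_O x) nu).
Proof.
move=> oO.
have I01 x : 0 <= (\1_O x : R) <= 1 by rewrite indicE; case: (_ \in _); rewrite ?lexx ?ler01.
have [kap [k1 _ k3]] := tent_fun_approx psiP (indic_lsc oO) (fun x => (andP (I01 x)).1).
have tent1 N x : tent_fun psi (kap N) x <= 1 by apply: le_trans (k1 N x) _; case/andP: (I01 x).
apply: (@measurable_fun_cvg _ _ _ _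
  (fun N (nu : Mh h) => pairing (fun x => h x * tent_fun psi (kap N) x) nu)).
  move=> N; apply: measurable_pairing_cont.
  apply: (@Ch_weightM _ _ _ h_gt0 h_cont _ 1) => //; first exact: tent_fun_cont.
  by move=> x; exact: tent_fun_ge0.
move=> nu _; apply: (@cvg_pairing _ _ _ h_gt0 h_cont _ _ _ 1).
- move=> N; apply: measurable_funM => //.
  by apply: continuous_measurable_Borel; exact: tent_fun_cont.
- by move=> N x; rewrite mul1r ger0_norm ?mulr_ge0 ?tent_fun_ge0// ler_piMr.
- by move=> x; apply: cvgM; [exact: cvg_cst|exact: k3].
Qed.

Let hd (nu : Mh h) : {measure set (Borel E) -> \bar R} := density nu mh h_ge0.

(* The measures [h nu] are finite, so the evaluations extend from open sets to
   Borel sets by a Dynkin argument. *)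
Let measurable_hd (A : set (Borel E)) : measurable A ->
  measurable_fun [set: Mh h] (fun nu : Mh h => hd nu A).
Proof.
move=> mA.
have hopen (O : set E) : open O -> measurable_fun [set: Mh h] (fun nu : Mh h => hd nu O).
  move=> oO; have mO : measurable (O : set (Borel E)) by exact: sub_sigma_algebra.
  have Bf : Bh h (fun x => h x * \1_O x).
    have mI : measurable_fun [set: Borel E] (\1_O : Borel E -> R).
      exact: measurable_indic.
    have I1 x : \1_O x <= 1 :> R by rewrite indicE lern1; case: (_ \in _).
    by have [] := @Bh_weightM _ _ _ h_gt0 h_cont _ 1 mI (fun x => ler0n _ _) I1.
  rewrite (_ : (fun nu => _) = fun nu => (pairing (fun x => h x * \1_O x) nu)%:E).
    by apply/measurable_EFinP; exact: measurable_pairing_open.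
  apply/funext => nu; rewrite (pairingE h_gt0 h_cont nu Bf) /hd densityE [LHS]integral_mkcond.
  by apply: eq_integral => x _; rewrite patchE indicE; case: ifPn => _; rewrite ?mulr1 ?mulr0.
apply: (@dynkin_induction _ (Borel E) (@open E)
  (fun A => measurable_fun [set: Mh h] (fun nu : Mh h => hd nu A))); first by [].
- by move=> A1 A2; exact: openI.
- by apply: hopen; exact: openT.
- exact: hopen.
- move=> S mS H.
  rewrite (_ : (fun nu => _) = fun nu => (hd nu setT - hd nu S)%E).
    by apply: emeasurable_funB => //; apply: hopen; exact: openT.
  apply/funext => nu.
  have fS : hd nu S \is a fin_num.
    rewrite ge0_fin_numE//; apply: le_lt_trans (Mh_finite nu).
    rewrite -(densityE nu mh h_ge0); apply: le_measure; rewrite ?inE//.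
  have : hd nu setT = (hd nu S + hd nu (~` S))%E.
    by rewrite -(setUv S) measureU//; [exact: measurableC|rewrite setICr].
  by move=> ->; rewrite addeAC subee// add0e.
- move=> F mF tF HF.
  rewrite (_ : (fun nu => _) = fun nu => (\sum_(n <oo) hd nu (F n))%E).
    apply: ge0_emeasurable_sum => //.
  by apply/funext => nu; rewrite measure_semi_bigcup//; exact: bigcupT_measurable.
- exact: mA.
Qed.

Lemma measurable_integral_Mh (f : Borel E -> \bar R) :
  measurable_fun [set: Borel E] f -> (forall x, 0 <= f x)%E ->
  measurable_fun [set: Mh h] (fun nu : Mh h => \int[nu]_x f x)%E.
Proof.
move=> mf f0.
have mhV : measurable_fun [set: Borel E] (fun x : Borel E => (h x)^-1).
  apply: continuous_measurable_Borel => x; apply: cvgV; first by rewrite gt_eqF.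
  exact: h_cont.
rewrite (_ : (fun nu => _) = fun nu => (\int[hd nu]_x (f x * ((h x)^-1)%:E))%E).
  apply: measurable_fun_integral_kernel.
  - by move=> U mU; exact: measurable_hd.
  - by move=> x; rewrite mule_ge0// lee_fin invr_ge0.
  - by apply: emeasurable_funM => //; exact/measurable_EFinP.
apply/funext => nu; rewrite /hd ge0_integral_density//.
- apply: eq_integral => x _; rewrite -muleA -EFinM mulVf ?mule1//.
  by rewrite gt_eqF.
- by apply: emeasurable_funM => //; exact/measurable_EFinP.
- by move=> x; rewrite mule_ge0// lee_fin invr_ge0.
Qed.

Lemma measurable_pairing f : Bh_pos h f ->
  measurable_fun [set: Mh h] (fun nu : Mh h => pairing f nu).
Proof.
move=> [Bf f0]; apply/measurable_EFinP => /=.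
rewrite (_ : _ \o _ = fun nu : Mh h => (\int[nu]_x (f x)%:E)%E).
  apply: measurable_integral_Mh => [|x]; last by rewrite lee_fin.
  by apply/measurable_EFinP; exact: (Bh_measurable Bf).
by apply/funext => nu /=; rewrite (pairingE h_gt0 h_cont).
Qed.

Lemma measurable_eval_Mh (A : set (Borel E)) : measurable A ->
  measurable_fun [set: Mh h] (fun nu : Mh h => nu A).
Proof.
move=> mA; rewrite (_ : (fun nu => _) = fun nu : Mh h => (\int[nu]_x (\1_A x)%:E)%E).
  apply: measurable_integral_Mh => [|x]; last by rewrite lee_fin.
  by apply/measurable_EFinP; exact: measurable_indic.
by apply/funext => nu; rewrite integral_indic// setIT.
Qed.

(** Countably many coordinates that determine the topology: the total [h]-mass
    and the integrals of the truncated tents, weighted by [h]. *)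
Definition Mh_coord (k : nat) : E -> R :=
  if k is k'.+1 then fun x => h x * tent_fun psi k' x else h.

Lemma Mh_coord_Ch k : Ch h (Mh_coord k).
Proof.
case: k => [|k]; first exact: Ch_weight.
have [M gM] := tent_fun_bound psi k.
apply: (Ch_weightM h_gt0 h_cont (M := M)) => //; first exact: tent_fun_cont.
by move=> x; exact: tent_fun_ge0.
Qed.

Lemma Mh_coord_ge0 k x : 0 <= Mh_coord k x.
Proof. by case: k => //= k; rewrite mulr_ge0// tent_fun_ge0. Qed.

Lemma Mh_coord_pos k : Bh_pos h (Mh_coord k).
Proof. by split; [have [] := Mh_coord_Ch k|exact: Mh_coord_ge0]. Qed.

Section coord_cvg.
Variables (u : nat -> Mh h) (mu : Mh h).
Hypothesis u_cvg : forall k,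
  pairing (Mh_coord k) (u n) @[n --> \oo] --> pairing (Mh_coord k) mu.

(* Adding a multiple of [h] makes [f] nonnegative; the truncated tents below
   then give semicontinuity from below, and [- f] the other half. *)
Let coord_lower f (e : R) : Ch h f -> 0 < e ->
  \forall n \near \oo, pairing f mu - e <= pairing f (u n).
Proof.
move=> [Bf cf] e0; have [M M0 fM] := Bh_bound h_gt0 Bf.
pose G x := f x / h x + M.
have G0 x : 0 <= G x.
  have := fM x; rewrite ler_norml => /andP[+ _].
  by rewrite -mulNr -ler_pdivlMr// /G => H; lra.
have cG : continuous G.
  move=> x; apply: cvgD; last exact: cvg_cst.
  apply: cvgM; first exact: cf.
  by apply: cvgV; [rewrite gt_eqF|exact: h_cont].
have [kap [k1 k2 k3]] := tent_fun_approx psiP (continuous_lsc cG) G0.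
have hG x : h x * G x = f x + M * h x.
  by rewrite /G mulrDr mulrCA divff ?gt_eqF// mulr1 [h x * M]mulrC.
have BMh : Bh h (fun x => M * h x) by exact: BhZ (Bh_weight h_gt0 h_cont).1.
have pG nu : pairing (fun x => h x * G x) nu = pairing f nu + M * pairing h nu.
  rewrite (_ : (fun x => _) = f \+ (fun x => M * h x)); last exact/funext.
  rewrite (pairingD h_gt0 h_cont)// (pairingZ h_gt0 h_cont)//.
  exact: (Bh_weight h_gt0 h_cont).1.
have kG N nu : pairing (Mh_coord (kap N).+1) nu <= pairing (fun x => h x * G x) nu.
  apply: (le_pairing h_gt0 h_cont); first by have [] := Mh_coord_Ch (kap N).+1.
    rewrite (_ : (fun x => _) = f \+ (fun x => M * h x)); last exact/funext.
    exact: BhD.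
  by move=> x; rewrite ler_wpM2l.
have cvgN : pairing (Mh_coord (kap N).+1) mu @[N --> \oo] -->
    pairing (fun x => h x * G x) mu.
  apply: (@cvg_pairing _ _ _ h_gt0 h_cont _ _ _ (M + M)).
  - by move=> N; have [[]] := Mh_coord_Ch (kap N).+1.
  - move=> N x; rewrite ger0_norm ?Mh_coord_ge0//= mulrC ler_wpM2r//.
    apply: le_trans (k1 _ _) _; rewrite /G lerD2r ler_pdivrMr//.
    by apply: le_trans (fM x); exact: ler_norm.
  - by move=> x; apply: cvgM; [exact: cvg_cst|exact: k3].
have e3 : 0 < e / 4 by rewrite divr_gt0.
have [N _ HN] : \forall N \near \oo, `|pairing (fun x => h x * G x) mu -
    pairing (Mh_coord (kap N).+1) mu| < e / 4.
  by move/cvgrPdist_lt : cvgN => /(_ _ e3).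
have {}HN := HN N (leqnn N).
have ck := @u_cvg (kap N).+1.
have c0 : M * pairing h (u n) @[n --> \oo] --> M * pairing h mu.
  by apply: cvgM; [exact: cvg_cst|exact: (@u_cvg 0)].
near=> n.
have Hn : `|pairing (Mh_coord (kap N).+1) mu - pairing (Mh_coord (kap N).+1) (u n)| < e / 4.
  by near: n; move/cvgrPdist_lt : ck => /(_ _ e3).
have Hh : `|M * pairing h mu - M * pairing h (u n)| < e / 4.
  by near: n; move/cvgrPdist_lt : c0 => /(_ _ e3).
have := kG N (u n); rewrite !pG in HN *.
by move: HN Hn Hh; rewrite !ltr_norml => /andP[? ?] /andP[? ?] /andP[? ?] ?; lra.
Unshelve. all: by end_near. Qed.

Lemma Mh_coord_cvg f : Ch h f -> pairing f (u n) @[n --> \oo] --> pairing f mu.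
Proof.
move=> Cf; apply/cvgrPdist_le => e e0.
have Cnf : Ch h (fun x => (-1) * f x).
  split; first by apply: BhZ => //; case: Cf.
  by move=> x; apply: cvgM; [exact: cvg_cst|case: Cf => _; exact].
have pZ nu : pairing (fun x => -1 * f x) nu = -1 * pairing f nu.
  by apply: (pairingZ h_gt0 h_cont); exact: Cf.1.
near=> n.
have H1 : pairing f mu - e <= pairing f (u n).
  by near: n; exact: coord_lower.
have : pairing (fun x => -1 * f x) mu - e <= pairing (fun x => -1 * f x) (u n).
  by near: n; exact: coord_lower.
by rewrite !pZ ler_norml => H2; apply/andP; split; lra.
Unshelve. all: by end_near. Qed.

End coord_cvg.

(** Each term of the minimum is positive when one coordinate, brought into [0, 1]
    by [expR (- _)], is within a rational distance of a rational. *)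
Definition Mh_tent (l : seq (nat * rat * rat)) (nu : Mh h) : R :=
  foldr (fun p m => Num.min (Num.max 0
    (ratr p.2 - `|expR (- pairing (Mh_coord p.1.1) nu) - ratr p.1.2|)) m) 1 l.

Definition Mh_tents (n : nat) (nu : Mh h) : R :=
  if unpickle n is Some l then Mh_tent l nu else 0.

Let Mh_tent_ge0 l nu : 0 <= Mh_tent l nu.
Proof. by elim: l => //= p l ih; rewrite le_min ih le_max lexx. Qed.

Let Mh_tent_cont l : continuous (Mh_tent l).
Proof.
elim: l => [|p l ih]; first exact: (@cst_continuous (Mh h) R 1).
apply: continuous_minr => //; apply: continuous_tent.
by apply: continuous_pairing; exact: Mh_coord_Ch.
Qed.

Let Mh_tent_gt0 l nu : (0 < Mh_tent l nu) = all (fun p : nat * rat * rat =>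
  `|expR (- pairing (Mh_coord p.1.1) nu) - ratr p.1.2| < ratr p.2) l.
Proof.
by elim: l => /= [|p l ih]; rewrite ?ltr01// lt_min ih lt_max ltxx/= subr_gt0.
Qed.

(** The topology of [Mh h] is sequentially described by the countably many
    coordinates. If no finite number of them with rational tolerances isolated a
    point inside an open set, a sequence outside the set would converge to it. *)
Lemma Mh_tent_base : tent_base Mh_tents.
Proof.
split.
- by move=> n nu; rewrite /Mh_tents; case: unpickle.
- move=> n; rewrite /Mh_tents; case: unpickle => [l|]; first exact: Mh_tent_cont.
  exact: (@cst_continuous (Mh h) R 0).
move=> W mu oW Wmu.
pose U N := [set nu : Mh h | forall k, (k <= N)%N ->
  `|expR (- pairing (Mh_coord k) nu) - expR (- pairing (Mh_coord k) mu)| < N.+1%:R^-1].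
have [N UW] : exists N, U N `<=` W.
  apply: contrapT => /forallNP H.
  have u_ex N : exists nu, U N nu /\ ~ W nu.
    by have /existsNP[nu /not_implyP] := H N; exists nu.
  pose u N := projT1 (cid (u_ex N)).
  have uP N : U N (u N) /\ ~ W (u N) by exact: (projT2 (cid (u_ex N))).
  have ucvg : u n @[n --> \oo] --> mu.
    apply/Mh_cvgP; apply: Mh_coord_cvg => k.
    have ecvg : expR (- pairing (Mh_coord k) (u n)) @[n --> \oo] -->
        expR (- pairing (Mh_coord k) mu).
      apply/cvgrPdist_lt => e e0.
      have [m] := ltr_add_invr e0; rewrite add0r => me.
      exists (maxn k m) => // n /=; rewrite geq_max => /andP[kn mn].
      have [/(_ k kn) + _] := uP n; rewrite distrC => /lt_trans; apply.
      by apply: le_lt_trans me; rewrite lef_pV2 ?posrE// ler_nat.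
    rewrite -[X in _ --> X]opprK -[X in _ --> - X]expRK.
    rewrite (_ : (fun n => _) = fun n => - ln (expR (- pairing (Mh_coord k) (u n)))).
      by apply: cvgN; exact: (cvg_comp _ _ ecvg (continuous_ln (expR_gt0 _))).
    by apply/funext => n; rewrite expRK opprK.
  have [n _ Hn] := ucvg W (open_nbhs_nbhs (conj oW Wmu)).
  exact: (uP n).2 (Hn n (leqnn n)).
pose e : R := N.+1%:R^-1 / 2.
have e0 : 0 < e by rewrite divr_gt0.
have [r r1] : exists r : rat, ratr r = e.
  by exists (N.+1%:R^-1 / 2); rewrite fmorph_div/= fmorphV/= !ratr_nat.
have q_ex k : exists q : rat, `|expR (- pairing (Mh_coord k) mu) - ratr q| < e.
  have [q] := @rat_in_itvoo R (expR (- pairing (Mh_coord k) mu))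
    (expR (- pairing (Mh_coord k) mu) + e) (ltac:(by rewrite ltrDl)).
  by rewrite in_itv/= => /andP[q1 q2]; exists q; rewrite ltr_norml; apply/andP; split; lra.
pose q k := projT1 (cid (q_ex k)).
have qP k : `|expR (- pairing (Mh_coord k) mu) - ratr (q k)| < e.
  exact: (projT2 (cid (q_ex k))).
exists (pickle [seq (k, q k, r) | k <- iota 0 N.+1]); rewrite /Mh_tents pickleK.
  by rewrite Mh_tent_gt0 all_map; apply/allP => k _ /=; rewrite r1.
move=> nu; rewrite /mkset Mh_tent_gt0 all_map => /allP H; apply: UW => k kN.
have /H : k \in iota 0 N.+1 by rewrite mem_iota.
rewrite /= r1 => H1; have H2 := qP k.
have -> : N.+1%:R^-1 = e + e :> R by rewrite -splitr.
by move: H1 H2; rewrite !ltr_norml => /andP[? ?] /andP[? ?]; apply/andP; split; lra.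
Qed.

End Mh_borel.

(** * Laplace functionals determine weak limits *)

Section Laplace_weak.
Context (R : realType) (E : ptopologicalType) (h : E -> R).
Hypothesis h_gt0 : forall x, 0 < h x.
Hypothesis h_cont : continuous h.
Variable psi : nat -> E -> R.
Hypothesis psiP : tent_base psi.
Implicit Types (f g : E -> R) (nu : Mh h) (G : Mh h -> R).

(** Closed under products because exponentials multiply, hence an algebra; its
    uniform closure is a lattice and contains the tents of [Mh h]. Every continuous
    function is thus reached from below, which replaces an approximation in
    uniform norm as on compact spaces. *)
Inductive exp_algebra : (Mh h -> R) -> Prop :=
| exp_algebra_gen f : Ch h f -> (forall x, 0 <= f x) ->
    exp_algebra (fun nu => expR (- pairing f nu))
| exp_algebra_lin (a : R) G1 G2 : exp_algebra G1 -> exp_algebra G2 ->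
    exp_algebra (fun nu => a * G1 nu + G2 nu).

Lemma exp_algebra1 : exp_algebra (cst 1).
Proof.
rewrite (_ : cst 1 = fun nu : Mh h => expR (- pairing (cst 0) nu)).
  apply: exp_algebra_gen => //; split; last by move=> x; exact: cvg_cst.
  exact: (Bh_pos0 h_gt0).1.
by apply/funext => nu; rewrite pairing0 oppr0 expR0.
Qed.

Lemma exp_algebra_scale (a : R) G : exp_algebra G -> exp_algebra (fun nu => a * G nu).
Proof.
move=> HG; rewrite (_ : (fun nu => _) = fun nu => (a + 1) * G nu + (-1 * G nu + (-1 * G nu + G nu))).
  by do 3 apply: exp_algebra_lin => //.
by apply/funext => nu; ring.
Qed.

Lemma exp_algebraM G1 G2 : exp_algebra G1 -> exp_algebra G2 ->
  exp_algebra (fun nu => G1 nu * G2 nu).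
Proof.
move=> H1; elim: H1 G2 => [f Cf f0|a F1 F2 _ ih1 _ ih2] G2 H2; last first.
  rewrite (_ : (fun nu => _) = fun nu => a * (F1 nu * G2 nu) + F2 nu * G2 nu).
    by apply: exp_algebra_lin; [exact: ih1|exact: ih2].
  by apply/funext => nu; ring.
elim: H2 => [g Cg g0|a F1 F2 _ ih1 _ ih2]; last first.
  rewrite (_ : (fun nu => _) = fun nu => a * (expR (- pairing f nu) * F1 nu) +
     expR (- pairing f nu) * F2 nu).
    exact: exp_algebra_lin.
  by apply/funext => nu; ring.
rewrite (_ : (fun nu => _) = fun nu => expR (- pairing (f \+ g) nu)).
  apply: exp_algebra_gen; last by move=> x; rewrite /= addr_ge0.
  split; first exact: BhD h_gt0 _ _ Cf.1 Cg.1.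
  by move=> x; apply: cvgD; [exact: Cf.2|exact: Cg.2].
apply/funext => nu; rewrite (pairingD h_gt0 h_cont _ Cf.1 Cg.1) opprD expRD//.
Qed.

Lemma exp_algebra_bounded G : exp_algebra G -> exists M : R, forall nu, `|G nu| <= M.
Proof.
elim=> [f _ f0|a F1 F2 _ [M1 H1] _ [M2 H2]].
  exists 1 => nu; rewrite ger0_norm ?expR_ge0// -expR0 ler_expR oppr_le0.
  exact: pairing_ge0.
exists (`|a| * M1 + M2) => nu; apply: le_trans (ler_normD _ _) _.
by rewrite lerD// normrM ler_wpM2l.
Qed.

Lemma exp_algebra_measurable G : exp_algebra G -> measurable_fun [set: Mh h] G.
Proof.
elim=> [f Cf f0|a F1 F2 _ H1 _ H2].
  apply: measurableT_comp => //; apply: measurable_funN.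
  by apply: (measurable_pairing h_gt0 h_cont psiP); split => //; exact: Cf.1.
by apply: measurable_funD => //; exact: measurable_funM.
Qed.

Definition exp_closure G : Prop := forall e : R, 0 < e ->
  exists2 G', exp_algebra G' & forall nu, `|G nu - G' nu| <= e.

Lemma exp_algebra_closure G : exp_algebra G -> exp_closure G.
Proof. by move=> HG e e0; exists G => // nu; rewrite subrr normr0 ltW. Qed.

Lemma exp_closure_cst (a : R) : exp_closure (cst a).
Proof.
apply: exp_algebra_closure.
rewrite (_ : cst a = fun nu : Mh h => a * cst 1 nu).
  exact: exp_algebra_scale exp_algebra1.
by apply/funext => nu; rewrite mulr1.
Qed.

Lemma exp_closure_unif G :
  (forall e : R, 0 < e -> exists2 G', exp_closure G' & forall nu, `|G nu - G' nu| <= e) ->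
  exp_closure G.
Proof.
move=> H e e0; have e2 : 0 < e / 2 by rewrite divr_gt0.
have [G' /(_ _ e2)[G'' aG'' H2] H1] := H _ e2.
exists G'' => // nu; rewrite (splitr e) -(subrKA (G' nu)).
by apply: le_trans (ler_normD _ _) _; rewrite lerD.
Qed.

Lemma exp_closureD G1 G2 : exp_closure G1 -> exp_closure G2 ->
  exp_closure (fun nu => G1 nu + G2 nu).
Proof.
move=> H1 H2 e e0; have e2 : 0 < e / 2 by rewrite divr_gt0.
have [F1 A1 HF1] := H1 _ e2; have [F2 A2 HF2] := H2 _ e2.
exists (fun nu => 1 * F1 nu + F2 nu); first exact: exp_algebra_lin.
move=> nu; rewrite mul1r (splitr e).
rewrite (_ : _ - _ = (G1 nu - F1 nu) + (G2 nu - F2 nu)); last by ring.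
by apply: le_trans (ler_normD _ _) _; rewrite lerD.
Qed.

Lemma exp_closure_bounded G : exp_closure G -> exists M : R, forall nu, `|G nu| <= M.
Proof.
move=> /(_ 1 ltr01)[F /exp_algebra_bounded[M HM] HF]; exists (1 + M) => nu.
by rewrite -(subrK (F nu) (G nu)); apply: le_trans (ler_normD _ _) _; rewrite lerD.
Qed.

Lemma exp_closureM G1 G2 : exp_closure G1 -> exp_closure G2 ->
  exp_closure (fun nu => G1 nu * G2 nu).
Proof.
move=> H1 H2; have [M1 HM1] := exp_closure_bounded H1.
apply: exp_closure_unif => e e0.
have M10 : 0 <= M1 by apply: le_trans (HM1 point).
have e1 : 0 < e / 2 / (M1 + 1) by rewrite !divr_gt0// ltr_wpDl.
have [F2 A2 HF2] := H2 _ e1.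
have [M2 HM2] := exp_algebra_bounded A2.
have M20 : 0 <= M2 by apply: le_trans (HM2 point).
have e2 : 0 < e / 2 / (M2 + 1) by rewrite !divr_gt0// ltr_wpDl.
have [F1 A1 HF1] := H1 _ e2.
exists (fun nu => F1 nu * F2 nu).
  exact/exp_algebra_closure/exp_algebraM.
move=> nu; rewrite (_ : _ - _ = G1 nu * (G2 nu - F2 nu) + (G1 nu - F1 nu) * F2 nu); last by ring.
apply: le_trans (ler_normD _ _) _; rewrite (splitr e) !normrM; apply: lerD.
  apply: (@le_trans _ _ (M1 * (e / 2 / (M1 + 1)))); first exact: ler_pM.
  rewrite mulrCA -[leRHS]mulr1; apply: ler_wpM2l; first by rewrite divr_ge0// ltW.
  by rewrite ler_pdivrMr ?mul1r ?lerDl// ltr_wpDl.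
apply: (@le_trans _ _ ((e / 2 / (M2 + 1)) * M2)); first exact: ler_pM.
rewrite -mulrA -[leRHS]mulr1; apply: ler_wpM2l; first by rewrite divr_ge0// ltW.
by rewrite mulrC ler_pdivrMr ?mul1r ?lerDl// ltr_wpDl.
Qed.

Lemma exp_closure_scale (a : R) G : exp_closure G -> exp_closure (fun nu => a * G nu).
Proof. by move=> HG; apply: (exp_closureM (exp_closure_cst a)). Qed.

(** The classical polynomial iteration for the square root of [x ^+ 2], by which
    an algebra closed under uniform limits is stable under absolute values. *)
Fixpoint abs_iter (x : R) (n : nat) : R :=
  if n is n'.+1 then abs_iter x n' + (x ^+ 2 - abs_iter x n' ^+ 2) / 2 else 0.

(** The third bound gives the uniform rate [2 / n]. *)
Lemma abs_iter_bound (x : R) n : `|x| <= 1 ->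
  [/\ 0 <= abs_iter x n, abs_iter x n <= `|x| &
   (`|x| - abs_iter x n) * (1 + n%:R * `|x| / 2) <= `|x|].
Proof.
move=> x1; have -> : abs_iter x n = abs_iter `|x| n.
  by elim: n => //= n ->; rewrite real_normK// num_real.
move: (normr_ge0 x) x1; set a := `|x| => a0 a1.
have step (N p : R) : 0 <= N -> 0 <= p -> p <= a -> (a - p) * (1 + N * a / 2) <= a ->
    [/\ 0 <= p + (a ^+ 2 - p ^+ 2) / 2, p + (a ^+ 2 - p ^+ 2) / 2 <= a &
      (a - (p + (a ^+ 2 - p ^+ 2) / 2)) * (1 + (N + 1) * a / 2) <= a].
  move=> N0 p0 pa ih; have Na : 0 <= N * a by rewrite mulr_ge0.
  have -> : p + (a ^+ 2 - p ^+ 2) / 2 = a - (a - p) * (1 - (a + p) / 2) by field.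
  have f0 : 0 <= 1 - (a + p) / 2 by lra.
  have d0 : 0 <= a - p by lra.
  split.
  - by rewrite subr_ge0; apply: (@le_trans _ _ (a - p)); [apply: ler_piMr; lra|lra].
  - by rewrite gerBl mulr_ge0.
  rewrite opprB addrC subrK; apply: le_trans ih; rewrite -mulrA.
  apply: ler_wpM2l => //.
  apply: (@le_trans _ _ ((1 - a / 2) * (1 + (N + 1) * a / 2))).
    by apply: ler_wpM2r; [lra|lra].
  have Naa : 0 <= N * a * a by rewrite mulr_ge0.
  have aa : 0 <= a * a by rewrite mulr_ge0.
  by lra.
elim: n => [|n [p0 pa ih]]; first by rewrite /= subr0 mul0r mul0r addr0 mulr1.
by have := step n%:R _ (ler0n _ _) p0 pa ih; rewrite natr1.
Qed.

Lemma exp_closure_abs G : exp_closure G -> exp_closure (fun nu => `|G nu|).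
Proof.
move=> HG; have [M HM] := exp_closure_bounded HG.
have M0 : 0 <= M by apply: le_trans (HM point).
have M1 : 0 < M + 1 by rewrite ltr_wpDl.
pose F nu := (M + 1)^-1 * G nu.
have F1 nu : `|F nu| <= 1.
  rewrite normrM gtr0_norm ?invr_gt0// mulrC ler_pdivrMr// mul1r.
  by apply: le_trans (HM nu) _; rewrite lerDl.
rewrite (_ : (fun nu => _) = fun nu => (M + 1) * `|F nu|); last first.
  by apply/funext => nu; rewrite normrM gtr0_norm ?invr_gt0// mulVKf// gt_eqF.
apply: exp_closure_scale; apply: exp_closure_unif => e e0.
have it n : exp_closure (fun nu => abs_iter (F nu) n).
  elim: n => [|n ih]; first exact: exp_closure_cst.
  rewrite (_ : (fun nu => _) = fun nu => abs_iter (F nu) n +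
      2^-1 * (F nu * F nu + (-1) * (abs_iter (F nu) n * abs_iter (F nu) n))); last first.
    by apply/funext => nu /=; field.
  apply: exp_closureD => //; apply: exp_closure_scale; apply: exp_closureD.
    by apply: exp_closureM; exact: exp_closure_scale.
  by apply: exp_closure_scale; exact: exp_closureM.
pose n := Num.bound (2 / e).
have ne : 2 <= n%:R * e.
  by rewrite -ler_pdivrMr//; apply/ltW/archi_boundP; rewrite divr_ge0// ltW.
exists (fun nu => abs_iter (F nu) n) => // nu.
have [p0 pa H] := abs_iter_bound n (F1 nu).
rewrite ger0_norm ?subr_ge0//; have := normr_ge0 (F nu).
set a := `|F nu| in pa H *; set p := abs_iter _ _ in p0 pa H *.
rewrite le_eqVlt => /orP[/eqP a0|a0]; first by lra.
have d0 : 0 <= a - p by rewrite subr_ge0.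
have H1 : (a - p) * (n%:R / 2) <= 1.
  rewrite -(ler_pM2r a0) mul1r; apply: le_trans H.
  by lra.
rewrite -(ler_pM2r (_ : 0 < n%:R / 2)); last first.
  by rewrite divr_gt0//; case: (n) ne => // ; rewrite mul0r lern0.
by apply: le_trans H1 _; lra.
Qed.

Lemma exp_closure_max G1 G2 : exp_closure G1 -> exp_closure G2 ->
  exp_closure (fun nu => Num.max (G1 nu) (G2 nu)).
Proof.
move=> H1 H2; rewrite (_ : (fun nu => _) = fun nu =>
    2^-1 * ((G1 nu + G2 nu) + `|G1 nu + (-1) * G2 nu|)); last first.
  by apply/funext => nu; rewrite maxr_absE mulN1r mulrC.
apply: exp_closure_scale; apply: exp_closureD; first exact: exp_closureD.
by apply: exp_closure_abs; apply: exp_closureD => //; exact: exp_closure_scale.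
Qed.

Lemma exp_closure_min G1 G2 : exp_closure G1 -> exp_closure G2 ->
  exp_closure (fun nu => Num.min (G1 nu) (G2 nu)).
Proof.
move=> H1 H2; rewrite (_ : (fun nu => _) = fun nu =>
    2^-1 * ((G1 nu + G2 nu) + (-1) * `|G1 nu + (-1) * G2 nu|)); last first.
  by apply/funext => nu; rewrite minr_absE !mulN1r mulrC.
apply: exp_closure_scale; apply: exp_closureD; first exact: exp_closureD.
apply: exp_closure_scale.
by apply: exp_closure_abs; apply: exp_closureD => //; exact: exp_closure_scale.
Qed.

Let exp_closure_tents n : exp_closure (Mh_tents psi n).
Proof.
rewrite /Mh_tents; case: unpickle => [l|]; last exact: exp_closure_cst.
elim: l => [|p l ih]; first exact: exp_closure_cst.
apply: exp_closure_min => //; apply: exp_closure_max; first exact: exp_closure_cst.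
rewrite (_ : (fun nu => _) = fun nu => ratr p.2 +
  (-1) * `|expR (- pairing (Mh_coord h psi p.1.1) nu) + - ratr p.1.2|); last first.
  by apply/funext => nu; rewrite mulN1r.
apply: exp_closureD; first exact: exp_closure_cst.
apply: exp_closure_scale; apply: exp_closure_abs; apply: exp_closureD.
  apply: exp_algebra_closure; apply: exp_algebra_gen.
    exact: Mh_coord_Ch.
  exact: Mh_coord_ge0.
exact: exp_closure_cst.
Qed.

Let tentsP := Mh_tent_base h_gt0 h_cont psiP.

Lemma exp_closure_tent_fun n : exp_closure (tent_fun (@Mh_tents R E h psi) n).
Proof.
rewrite /tent_fun; case: unpickle => [l|]; last exact: exp_closure_cst.
elim: l => [|p l ih]; first exact: exp_closure_cst.
apply: exp_closure_max => //; apply: exp_closure_min; first exact: exp_closure_cst.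
exact: exp_closure_scale.
Qed.

Lemma exp_closure_measurable G : exp_closure G -> measurable_fun [set: Mh h] G.
Proof.
move=> HG; have G_ex n : exists G', exp_algebra G' /\ forall nu, `|G nu - G' nu| <= n.+1%:R^-1.
  by have [|G' aG' HG'] := HG n.+1%:R^-1; [by []|exists G'].
pose F n := projT1 (cid (G_ex n)).
have FP n : exp_algebra (F n) /\ forall nu, `|G nu - F n nu| <= n.+1%:R^-1.
  exact: projT2 (cid (G_ex n)).
apply: (@measurable_fun_cvg _ _ _ _ F) => [n|nu _].
  by apply: exp_algebra_measurable; case: (FP n).
apply/cvgrPdist_le => e e0.
have [m] := ltr_add_invr e0; rewrite add0r => me; exists m => // n /= mn.
apply: le_trans (_ : n.+1%:R^-1 <= _); first by have [_] := FP n.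
by apply/ltW; apply: le_lt_trans me; rewrite lef_pV2 ?posrE// ler_nat.
Qed.

Let integrable1 (Q : {measure set (Mh h) -> \bar R}) G (M : R) : Q setT = 1%E ->
  measurable_fun [set: Mh h] G -> (forall nu, `|G nu| <= M) ->
  Q.-integrable setT (EFin \o G).
Proof. by move=> Q1; apply: integrable_bounded; rewrite Q1 ltry. Qed.

(* Truncated tents are lattice expressions in elements of the closure, hence
   belong to it themselves. *)
Let lsc_approx G (M : R) : (forall q, open [set nu | q < G nu]) ->
  (forall nu, 0 <= G nu) -> (forall nu, G nu <= M) ->
  exists G_ : nat -> Mh h -> R, [/\ forall N, exp_closure (G_ N),
    forall N nu, `|G_ N nu| <= M, forall N nu, G_ N nu <= G nu &
    forall Q : {measure set (Mh h) -> \bar R}, Q setT = 1%E ->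
      \int[Q]_nu G_ N nu @[N --> \oo] --> \int[Q]_nu G nu].
Proof.
move=> oG G0 GM; have [kap [k1 _ k3]] := tent_fun_approx tentsP oG G0.
have G_M N nu : `|tent_fun (@Mh_tents R E h psi) (kap N) nu| <= M.
  by rewrite ger0_norm ?tent_fun_ge0// (le_trans (k1 _ _)).
exists (fun N => tent_fun (@Mh_tents R E h psi) (kap N)); split => // [N|Q Q1].
  exact: exp_closure_tent_fun.
apply: (Rintegral_bounded_cvg (M := M)) => //; first by rewrite Q1 ltry.
by move=> N; apply: exp_closure_measurable; exact: exp_closure_tent_fun.
Qed.

Section limit.
Context (I : Type) (F : set_system I) {FF : Filter F}.
Variables (Q : I -> {measure set (Mh h) -> \bar R}) (pi : {measure set (Mh h) -> \bar R}).
Hypothesis Q1 : forall i, Q i setT = 1%E.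
Hypothesis pi1 : pi setT = 1%E.
Hypothesis Laplace_cvg : forall f, Ch h f -> (forall x, 0 <= f x) ->
  \int[Q i]_nu expR (- pairing f nu) @[i --> F] --> \int[pi]_nu expR (- pairing f nu).

Let exp_algebra_cvg G : exp_algebra G ->
  \int[Q i]_nu G nu @[i --> F] --> \int[pi]_nu G nu.
Proof.
elim=> [f Cf f0|a G1 G2 A1 H1 A2 H2]; first exact: Laplace_cvg.
have [M1 B1] := exp_algebra_bounded A1; have [M2 B2] := exp_algebra_bounded A2.
have Elin (Q' : {measure set (Mh h) -> \bar R}) : Q' setT = 1%E ->
   \int[Q']_nu (a * G1 nu + G2 nu) = a * \int[Q']_nu G1 nu + \int[Q']_nu G2 nu.
  move=> Q'1.
  have i1 := integrable1 Q'1 (exp_algebra_measurable A1) B1.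
  have i2 := integrable1 Q'1 (exp_algebra_measurable A2) B2.
  have i1a : Q'.-integrable setT (EFin \o (fun nu => a * G1 nu)).
    by have := integrableZl measurableT a i1; apply: eq_integrable.
  by rewrite (RintegralD measurableT i1a i2) RintegralZl.
rewrite Elin//; under eq_fun do rewrite Elin//.
by apply: cvgD => //; apply: cvgM => //; exact: cvg_cst.
Qed.

Lemma exp_closure_cvg G : exp_closure G ->
  \int[Q i]_nu G nu @[i --> F] --> \int[pi]_nu G nu.
Proof.
move=> HG; apply/cvgrPdist_le => e e0.
have e3 : 0 < e / 3 by rewrite divr_gt0.
have [G' A' H'] := HG _ e3.
have d (Q' : {measure set (Mh h) -> \bar R}) : Q' setT = 1%E ->
    `|\int[Q']_nu G nu - \int[Q']_nu G' nu| <= e / 3.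
  move=> Q'1; apply: Rintegral_dist_le => //.
  - exact: exp_closure_measurable.
  - exact: exp_algebra_measurable.
  - exact: exp_closure_bounded.
  - exact: exp_algebra_bounded.
have c' := exp_algebra_cvg A'.
near=> i.
have H : `|\int[pi]_nu G' nu - \int[Q i]_nu G' nu| <= e / 3.
  by near: i; move/cvgrPdist_le : c' => /(_ _ e3).
have := d _ pi1; have := d _ (Q1 i).
by move: H; rewrite !ler_norml => /andP[? ?] /andP[? ?] /andP[? ?]; apply/andP; split; lra.
Unshelve. all: by end_near. Qed.

(* One half of the convergence, as in the portmanteau theorem: an approximation
   from below converges in integral and already exhausts the limit. *)
Let weak_lower G (M e : R) : continuous G -> (forall nu, 0 <= G nu) ->
  (forall nu, G nu <= M) -> 0 < e ->
  \forall i \near F, \int[pi]_nu G nu - e <= \int[Q i]_nu G nu.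
Proof.
move=> cG G0 GM e0; have [T [cT TM TG Tcvg]] := lsc_approx (continuous_lsc cG) G0 GM.
have mG : measurable_fun [set: Mh h] G by exact: continuous_measurable_Borel.
have Gb nu : `|G nu| <= M by rewrite ger0_norm.
have e2 : 0 < e / 2 by rewrite divr_gt0.
have [N HN] : exists N, \int[pi]_nu G nu - e / 2 <= \int[pi]_nu T N nu.
  have /cvgrPdist_le/(_ _ e2)[N _ /(_ N (leqnn N))] := Tcvg pi pi1.
  by rewrite ler_norml => /andP[_ H]; exists N; lra.
have c := exp_closure_cvg (cT N).
near=> i.
have : `|\int[pi]_nu T N nu - \int[Q i]_nu T N nu| <= e / 2.
  by near: i; move/cvgrPdist_le : c => /(_ _ e2).
have : \int[Q i]_nu T N nu <= \int[Q i]_nu G nu.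
  apply: le_Rintegral => //; [|exact: integrable1 Gb].
  by apply: integrable1 (TM N) => //; exact: exp_closure_measurable.
by rewrite ler_norml => ? /andP[? ?]; lra.
Unshelve. all: by end_near. Qed.

(** The lower bound applied to [M + G] and to [M - G]; that the limit has total
    mass 1 plays the part of tightness. *)
Lemma Laplace_weak_cvg G (M : R) : continuous G -> (forall nu, `|G nu| <= M) ->
  \int[Q i]_nu G nu @[i --> F] --> \int[pi]_nu G nu.
Proof.
move=> cG GM; apply/cvgrPdist_le => e e0.
have mG : measurable_fun [set: Mh h] G by exact: continuous_measurable_Borel.
have key (s : R) : (s == 1) || (s == -1) ->
    \forall i \near F, s * \int[pi]_nu G nu - e <= s * \int[Q i]_nu G nu.
  move=> s1; have sG nu : `|s * G nu| <= M.
    by rewrite normrM; case/orP: s1 => /eqP ->; rewrite ?normrN normr1 mul1r.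
  have cG' : continuous (fun nu => M + s * G nu) by exact: continuous_affine.
  have b1 nu : 0 <= M + s * G nu by have := sG nu; rewrite ler_norml => /andP[? ?]; lra.
  have b2 nu : M + s * G nu <= M + M by have := sG nu; rewrite ler_norml => /andP[? ?]; lra.
  have Elin (Q' : {measure set (Mh h) -> \bar R}) : Q' setT = 1%E ->
      \int[Q']_nu (M + s * G nu) = M + s * \int[Q']_nu G nu.
    move=> Q'1; have iG := integrable1 Q'1 mG GM.
    have isG : Q'.-integrable setT (EFin \o (fun nu => s * G nu)).
      by have := integrableZl measurableT s iG; apply: eq_integrable.
    have ic : Q'.-integrable setT (EFin \o cst M).
      by apply: (@integrable1 _ _ `|M|).
    rewrite (RintegralD measurableT ic isG) RintegralZl// Rintegral_cst//.
    by rewrite Q'1 mulr1.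
  have := weak_lower cG' b1 b2 e0; apply: filterS => i.
  by rewrite !Elin// => H; lra.
have k1 := key 1; have k2 := key (-1).
near=> i.
have : 1 * \int[pi]_nu G nu - e <= 1 * \int[Q i]_nu G nu by near: i; apply: k1; rewrite eqxx.
have : -1 * \int[pi]_nu G nu - e <= -1 * \int[Q i]_nu G nu.
  by near: i; apply: k2; rewrite eqxx orbT.
by rewrite ler_norml => ? ?; apply/andP; split; lra.
Unshelve. all: by end_near. Qed.

End limit.

(** Equality on the closure of the exponential algebra passes to indicators of
    open sets, which are lower semicontinuous, and from these to Borel sets. *)
Lemma Laplace_unique (Q pi : {measure set (Mh h) -> \bar R}) :
  Q setT = 1%E -> pi setT = 1%E ->
  (forall f, Ch h f -> (forall x, 0 <= f x) ->
    \int[Q]_nu expR (- pairing f nu) = \int[pi]_nu expR (- pairing f nu)) ->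
  forall A : set (Mh h), measurable A -> Q A = pi A.
Proof.
move=> Q1 pi1 H.
have eqG G : exp_closure G -> \int[Q]_nu G nu = \int[pi]_nu G nu.
  move=> HG.
  have c : \int[Q]_nu G nu @[n --> \oo] --> \int[pi]_nu G nu.
    apply: (@exp_closure_cvg _ _ _ (fun _ : nat => Q)) => // f Cf f0.
    by rewrite H//; exact: cvg_cst.
  have c' : \int[Q]_nu G nu @[n --> \oo] --> \int[Q]_nu G nu by exact: cvg_cst.
  exact: cvg_unique c' c.
apply: (measure_unique (@open (Mh h)) (fun _ => setT)) => //.
- by move=> A B; exact: openI.
- by move=> _; exact: openT.
- by rewrite bigcup_const.
- move=> W oW; have mW : measurable W by exact: sub_sigma_algebra.
  have I01 nu : 0 <= (\1_W nu : R) <= 1 by rewrite indicE; case: (_ \in _); rewrite ?lexx ?ler01.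
  have [G_ [cG_ _ _ G_cvg]] := lsc_approx (indic_lsc oW)
    (fun nu => (andP (I01 nu)).1) (fun nu => (andP (I01 nu)).2).
  have QW (Q' : {measure set (Mh h) -> \bar R}) : Q' setT = 1%E ->
      (\int[Q']_nu \1_W nu)%:E = Q' W.
    move=> Q'1; rewrite /Rintegral integral_indic// setIT fineK// ge0_fin_numE//.
    apply: (@le_lt_trans _ _ (Q' setT)); last by rewrite Q'1 ltry.
    by apply: le_measure; rewrite ?inE.
  change (Q W = pi W); rewrite -(QW Q)// -(QW pi)//; congr EFin.
  have := G_cvg Q Q1; under eq_fun do rewrite (eqG _ (cG_ _)).
  by move=> cQ; exact: cvg_unique cQ (G_cvg pi pi1).
- by move=> _; rewrite Q1 ltry.
Qed.

End Laplace_weak.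

(** * Measures on infinite binary sequences *)

Fixpoint rprefix (y : nat -> bool) (n : nat) : seq bool :=
  if n is n'.+1 then y n' :: rprefix y n' else [::].

Lemma size_rprefix y n : size (rprefix y n) = n.
Proof. by elim: n => //= n ->. Qed.

(** The bits are listed from the last one back, so that extending a word by one
    bit is a [cons]. *)
Definition cyl (r : seq bool) : set (nat -> bool) := [set y | rprefix y (size r) = r].

Notation binseq := (g_sigma_algebraType (range cyl)).

Lemma measurable_cyl (r : seq bool) : measurable (cyl r : set binseq).
Proof. by apply: sub_sigma_algebra; exists r. Qed.

Lemma cyl_nil : cyl [::] = setT.
Proof. by apply/seteqP; split. Qed.

Lemma cyl_cons b r : cyl (b :: r) = cyl r `&` [set y | y (size r) = b].
Proof.
apply/seteqP; split => y; rewrite /cyl/=; first by case=> -> ->.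
by move=> [-> ->].
Qed.

Lemma cyl_split r : cyl r = cyl (false :: r) `|` cyl (true :: r).
Proof.
rewrite !cyl_cons -setIUr; apply/esym/setIidl => y _ /=.
by case: (y (size r)); [right|left].
Qed.

Lemma cyl_disj r : [disjoint cyl (false :: r) & cyl (true :: r)].
Proof.
by apply/disj_setPS => y; rewrite !cyl_cons => -[[_ /= ->] []].
Qed.

Lemma measurable_to_binseq d (T : measurableType d) (f : T -> nat -> bool) :
  (forall n, measurable_fun [set: T] (f ^~ n)) ->
  measurable_fun [set: T] (f : T -> binseq).
Proof.
move=> mf; apply: (@measurability _ _ T binseq setT f (range cyl)) => //.
move=> _ [_ [r _ <-] <-]; rewrite setTI.
elim: r => [|b r ih]; first by rewrite cyl_nil preimage_setT.
rewrite cyl_cons preimage_setI; apply: measurableI => //.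
by have := mf (size r) measurableT [set b] Logic.I; rewrite setTI.
Qed.

Lemma measurable_bit n : measurable_fun [set: binseq] (fun y : binseq => y n).
Proof.
move=> _ B _; rewrite setTI.
have bitT b : measurable ([set y | y n = b] : set binseq).
  rewrite (_ : [set y | _] = \bigcup_(t : n.-tuple bool) (cyl (b :: t) : set binseq)).
    by apply: fin_bigcup_measurable => // t _; exact: measurable_cyl.
  apply/seteqP; split => [y /= yn|y [t _]]; last first.
    by rewrite cyl_cons size_tuple => -[].
  exists (Tuple (introT eqP (size_rprefix y n))) => //.
  by rewrite cyl_cons /cyl/= size_rprefix.
rewrite (_ : _ @^-1` B = \bigcup_(b in B) [set y : binseq | y n = b]).
  by apply: fin_bigcup_measurable => [|b _]; [exact: finite_finset|exact: bitT].
by apply/seteqP; split => [y By|y [b Bb /= yb]]; [exists (y n)|rewrite /preimage/= yb].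
Qed.

(** A consistent family of weights on finite words is the family of the cylinder
    masses of a measure: nested intervals of these lengths map a segment with
    Lebesgue measure to binary sequences, which replaces an extension theorem
    and depends measurably on the weights. *)
Section tree_measure.
Context (R : realType).
Variable w : seq bool -> R.

(** The left end of the interval of [r], which has length [w r]; the interval of
    the child [true] starts where that of the child [false] ends. *)
Fixpoint tree_lo (r : seq bool) : R :=
  if r is b :: r' then tree_lo r' + (if b then w (false :: r') else 0) else 0.

Fixpoint tree_node (u : R) (n : nat) : seq bool :=
  if n is n'.+1 then
    let r := tree_node u n' in (tree_lo r + w (false :: r) <= u) :: r
  else [::].

Definition tree_path (u : R) (n : nat) : bool := head false (tree_node u n.+1).

Lemma rprefix_tree_path u n : rprefix (tree_path u) n = tree_node u n.
Proof. by elim: n => //= n ->. Qed.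

Let size_node u n : size (tree_node u n) = n.
Proof. by rewrite -rprefix_tree_path size_rprefix. Qed.

Lemma measurable_tree_node (r : seq bool) :
  measurable ([set u | tree_node u (size r) = r] : set (measurableTypeR R)).
Proof.
elim: r => [|b r ih] /=.
  by rewrite (_ : [set u | _] = setT)//; apply/seteqP; split.
rewrite (_ : [set u | _] = [set u | tree_node u (size r) = r] `&`
    [set u | (tree_lo r + w (false :: r) <= u) = b]).
  apply: measurableI => //; case: b.
    rewrite (_ : [set u | _] = `[tree_lo r + w (false :: r), +oo[%classic)//.
    by apply/seteqP; split => u /=; rewrite in_itv/= andbT.
  rewrite (_ : [set u | _] = `]-oo, tree_lo r + w (false :: r)[%classic)//.
  apply/seteqP; split => u /=; rewrite in_itv/=; first by move=> /negbT; rewrite -ltNge.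
  by rewrite ltNge => /negbTE.
apply/seteqP; split => u /= [].
  by move=> + e; rewrite e.
by move=> e <-; rewrite e.
Qed.

Lemma measurable_tree_path : measurable_fun [set: measurableTypeR R] (tree_path : measurableTypeR R -> binseq).
Proof.
apply: (@measurability _ _ (measurableTypeR R) binseq setT tree_path (range cyl)) => //.
move=> _ [_ [r _ <-] <-]; rewrite setTI.
rewrite (_ : _ @^-1` _ = [set u | tree_node u (size r) = r]); first exact: measurable_tree_node.
by apply/seteqP; split => u; rewrite /preimage /cyl/= rprefix_tree_path.
Qed.

Definition tree_measure : {measure set binseq -> \bar R} :=
  image_measure (mrestr lebesgue_measure (measurable_itv `[0, w [::][))
    measurable_tree_path.

Hypothesis w_ge0 : forall r, 0 <= w r.
Hypothesis w_split : forall r, w r = w (false :: r) + w (true :: r).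

Let tree_lo_bound r : 0 <= tree_lo r /\ tree_lo r + w r <= w [::].
Proof.
elim: r => [|b r [ih1 ih2]] /=; first by rewrite add0r.
have := w_split r; have := w_ge0 (false :: r); have := w_ge0 (true :: r).
by case: b => ? ? ?; split; lra.
Qed.

Let tree_nodeP u r : 0 <= u < w [::] ->
  (tree_node u (size r) = r) <-> (tree_lo r <= u < tree_lo r + w r).
Proof.
move=> u01; elim: r => [|b r ih] /=; first by rewrite add0r u01.
have := w_split r; have w0 := w_ge0 (false :: r); have w1 := w_ge0 (true :: r) => wr.
split.
  move=> [eb er]; move: eb; rewrite er => <-; move: er => /ih /andP[? ?].
  by case: (leP (tree_lo r + w (false :: r)) u) => h; apply/andP; split; lra.
move=> /andP[l1 l2]; have -> : tree_node u (size r) = r.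
  by apply/ih; move: l1 l2; case: (b) => ? ?; apply/andP; split; lra.
congr (_ :: _); move: l1 l2; case: (b); first by move=> -> _.
by rewrite addr0 => ? h; apply/negbTE; rewrite -ltNge.
Qed.

Lemma tree_measure_cyl r : tree_measure (cyl r) = (w r)%:E.
Proof.
rewrite -[LHS]/(lebesgue_measure ((tree_path @^-1` cyl r) `&` `[0, w [::][)).
rewrite (_ : _ `&` _ = `[tree_lo r, tree_lo r + w r[%classic).
  rewrite lebesgue_measure_itv/= lte_fin; case: ifPn => [_|].
    by rewrite -EFinB addrAC subrr add0r.
  by rewrite -leNgt gerDl => wr; congr EFin; apply/eqP; rewrite eq_le wr w_ge0.
have [lo0 lo1] := tree_lo_bound r.
apply/seteqP; split => u /=; rewrite /preimage /cyl /mkset rprefix_tree_path !in_itv/=.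
  by move=> [+ u01] => /tree_nodeP; apply.
move=> lu; have u01 : 0 <= u < w [::].
  by move: lu => /andP[? ?]; apply/andP; split; lra.
by split => //; apply/tree_nodeP.
Qed.

Lemma tree_measureT : tree_measure setT = (w [::])%:E.
Proof. by rewrite -cyl_nil tree_measure_cyl. Qed.

End tree_measure.

Definition bits_ext (r : seq bool) (i : nat) : bool := nth false (rev r) i.

Lemma bits_ext_rprefix y M i : (i < M)%N -> bits_ext (rprefix y M) i = y i.
Proof.
rewrite /bits_ext; elim: M => //= M ih; rewrite ltnS leq_eqVlt => /orP[/eqP ->|iM].
  by rewrite rev_cons nth_rcons size_rev size_rprefix ltnn eqxx.
by rewrite rev_cons nth_rcons size_rev size_rprefix iM ih.
Qed.

Section cylinder_integral.
Context (R : realType) (M : nat) (Psi : (nat -> bool) -> R).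
Hypothesis Psi_dep : forall y y', (forall i, (i < M)%N -> y i = y' i) -> Psi y = Psi y'.

Let PsiE y : Psi y = \sum_(r : M.-tuple bool) Psi (bits_ext r) * \1_(cyl r) y.
Proof.
rewrite (bigD1 (Tuple (introT eqP (size_rprefix y M))))//= big1 => [|t].
  rewrite addr0 indicE mem_set ?mulr1; last by rewrite /cyl/= size_rprefix.
  by apply: Psi_dep => i iM; rewrite bits_ext_rprefix.
rewrite -val_eqE/= => ty; rewrite indicE memNset ?mulr0//.
by rewrite /cyl/= size_tuple => /esym/eqP; rewrite (negbTE ty).
Qed.

Lemma measurable_cylinder_fun : measurable_fun [set: binseq] (Psi : binseq -> R).
Proof.
rewrite (_ : Psi = fun y => \sum_(r : M.-tuple bool) Psi (bits_ext r) * \1_(cyl r) y); last first.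
  by apply/funext => y; exact: PsiE.
apply: measurable_sum => r; apply: measurable_funM => //.
by apply: measurable_indic; exact: measurable_cyl.
Qed.

Lemma integral_cylinder_fun (m : {measure set binseq -> \bar R}) : (forall y, 0 <= Psi y) ->
  (\int[m]_y (Psi y)%:E = \sum_(r : M.-tuple bool) (Psi (bits_ext r))%:E * m (cyl r))%E.
Proof.
move=> P0; transitivity (\int[m]_y (\sum_(r : M.-tuple bool) (Psi (bits_ext r))%:E * (\1_(cyl r) y)%:E))%E.
  by apply: eq_integral => y _; rewrite [in LHS]PsiE -sumEFin.
have mi (r : seq bool) : measurable_fun [set: binseq] (fun y : binseq => (\1_(cyl r) y : R)%:E).
  by apply/measurable_EFinP; apply: measurable_indic; exact: measurable_cyl.
rewrite ge0_integral_sum//; last 2 first.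
- by move=> r; apply: emeasurable_funM => //; exact: mi.
- by move=> r y _; rewrite mule_ge0 ?lee_fin.
apply: eq_bigr => r _; rewrite ge0_integralZl => //; do ?[exact: mi|by rewrite lee_fin].
by rewrite integral_indic ?setIT//; exact: measurable_cyl.
Qed.

End cylinder_integral.

(** * Limit laws of bounded random variables *)

Section digits.
Context (R : realType).

Fixpoint digit_approx (x : R) (n : nat) : R :=
  if n is n'.+1 then
    let q := digit_approx x n' in
    q + (if q + 2^-1 ^+ n <= x then 2^-1 ^+ n else 0)
  else 0.

Definition digit (x : R) (n : nat) : bool := digit_approx x n + 2^-1 ^+ n.+1 <= x.

Definition digits_val (y : nat -> bool) (n : nat) : R :=
  \sum_(i < n) (if y i then 2^-1 ^+ i.+1 else 0).

Lemma digit_approxE x n : digit_approx x n = digits_val (digit x) n.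
Proof.
rewrite /digits_val; elim: n => [|n ih]; first by rewrite big_ord0.
by rewrite big_ord_recr/= -ih.
Qed.

Let pow_half n : 2^-1 ^+ n = 2^-1 ^+ n.+1 + 2^-1 ^+ n.+1 :> R.
Proof. by rewrite exprS; field. Qed.

Lemma digits_val_approx x n : 0 <= x <= 1 ->
  digits_val (digit x) n <= x <= digits_val (digit x) n + 2^-1 ^+ n.
Proof.
move=> x01; rewrite -digit_approxE; elim: n => [|n /andP[ih1 ih2]] /=.
  by rewrite add0r expr0.
move: ih2; rewrite (pow_half n).
by case: (leP (digit_approx x n + 2^-1 ^+ n.+1) x) => ? ?; apply/andP; split; lra.
Qed.

Lemma digits_val_mono y m n : (m <= n)%N -> digits_val y m <= digits_val y n.
Proof.
move=> mn; rewrite /digits_val (big_ord_widen n (fun i => if y i then 2^-1 ^+ i.+1 else 0) mn).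
rewrite [leRHS](bigID (fun i : 'I_n => (i < m)%N))/= lerDl sumr_ge0// => i _.
by case: ifP => // _; rewrite exprn_ge0// invr_ge0.
Qed.

Lemma digits_val_diff y m n : (m <= n)%N -> digits_val y n <= digits_val y m + 2^-1 ^+ m.
Proof.
move=> mn; suff : digits_val y n + 2^-1 ^+ n <= digits_val y m + 2^-1 ^+ m.
  by apply: le_trans; rewrite lerDl exprn_ge0// invr_ge0.
rewrite -(subnK mn); elim: (n - m)%N => [|k ih]; first by rewrite add0n.
apply: le_trans ih; rewrite addSn /digits_val big_ord_recr/= -addrA lerD2l.
rewrite [leRHS]pow_half lerD2r; case: ifP => // _; by rewrite exprn_ge0// invr_ge0.
Qed.

Definition binval (y : nat -> bool) : R := limn (digits_val y).

Let digits_val_cvg y : cvgn (digits_val y).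
Proof.
apply: nondecreasing_is_cvgn; first by move=> m n; exact: digits_val_mono.
exists (digits_val y 0 + 2^-1 ^+ 0) => _ [n _ <-]; exact: digits_val_diff.
Qed.

Lemma binval_approx y n : digits_val y n <= binval y <= digits_val y n + 2^-1 ^+ n.
Proof.
apply/andP; split.
  apply: limr_ge => //; exists n => // m /= nm; exact: digits_val_mono.
apply: limr_le => //; exists n => // m /= nm; exact: digits_val_diff.
Qed.

Lemma binval01 y : 0 <= binval y <= 1.
Proof. by have := binval_approx y 0; rewrite /digits_val big_ord0 expr0 add0r. Qed.

Lemma digits_val_ge0 y n : 0 <= digits_val y n.
Proof. by have := digits_val_mono y (leq0n n); rewrite {1}/digits_val big_ord0. Qed.

Lemma measurable_digits_val d (T : measurableType d) (f : T -> nat -> bool) n :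
  (forall n, measurable_fun [set: T] (f ^~ n)) ->
  measurable_fun [set: T] (fun t => digits_val (f t) n).
Proof.
move=> mf; apply: measurable_sum => i; apply: measurable_fun_ifT => //.
Qed.

Lemma measurable_binval d (T : measurableType d) (f : T -> nat -> bool) :
  (forall n, measurable_fun [set: T] (f ^~ n)) ->
  measurable_fun [set: T] (fun t => binval (f t)).
Proof.
move=> mf; apply: (@measurable_fun_cvg _ _ _ _ (fun n t => digits_val (f t) n)).
  by move=> n; exact: measurable_digits_val.
by move=> t _; exact: digits_val_cvg.
Qed.

Lemma measurable_digit d (T : measurableType d) (a : T -> R) n :
  measurable_fun [set: T] a -> measurable_fun [set: T] (fun t => digit (a t) n).
Proof.
move=> ma; have mapx k : measurable_fun [set: T] (fun t => digit_approx (a t) k).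
  elim: k => [|k ih] //=; apply: measurable_funD => //.
  apply: measurable_fun_ifT => //; apply: measurable_fun_ler => //.
  exact: measurable_funD.
apply: measurable_fun_ler => //; exact: measurable_funD.
Qed.

End digits.

Lemma ultra_real_cvg (R : realType) (I : Type) (U : set_system I) (x : I -> R) :
  UltraFilter U -> (forall i, 0 <= x i <= 1) -> exists l : R, x @ U --> l.
Proof.
move=> UU x01.
have [l [_ lcl]] : `[0, 1]%classic `&` cluster (x @ U) !=set0.
  apply: (@segment_compact R 0 1 (x @ U)).
  by apply: nearW => i; rewrite /= in_itv/= x01.
exists l => A nA.
have [//|UA] := in_ultra_setVsetC (x @^-1` A) UU.
by have [z [/= nAz Az]] := lcl (~` A) A UA nA.
Qed.

Section limit_law.
Context d (T : measurableType d) (R : realType).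
Variables (Q : nat -> {measure set T -> \bar R}) (a : nat -> T -> R).
Hypothesis Q1 : forall n, Q n setT = 1%E.
Hypothesis ma : forall k, measurable_fun [set: T] (a k).
Hypothesis a01 : forall k t, 0 <= a k t <= 1.
Variable Lambda : seq nat -> R.
Hypothesis Lambda_cvg : forall l : seq nat,
  \int[Q n]_t (\prod_(k <- l) a k t) @[n --> \oo] --> Lambda l.

(* All the binary digits of all the coordinates, in one sequence. *)
Let bits (t : T) (m : nat) : bool :=
  if unpickle m is Some p then digit (a p.1 t) p.2 else false.

Let mbits n : measurable_fun [set: T] (bits ^~ n).
Proof.
rewrite /bits; case: unpickle => [p|]; last exact: measurable_cst.
exact: measurable_digit.
Qed.

Let mbitsT : measurable_fun [set: T] (bits : T -> binseq).
Proof. exact: measurable_to_binseq. Qed.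

Let Qb n : {measure set binseq -> \bar R} := image_measure (Q n) mbitsT.

Definition coord_val (k : nat) (y : nat -> bool) : R := binval R (fun i => y (pickle (k, i))).

Lemma measurable_coord_val k : measurable_fun [set: binseq] (coord_val k : binseq -> R).
Proof. by apply: measurable_binval => n; exact: measurable_bit. Qed.

Lemma coord_val01 k y : 0 <= coord_val k y <= 1.
Proof. exact: binval01. Qed.

Let QbT n : Qb n setT = 1%E.
Proof. by rewrite /Qb image_measureE preimage_setT Q1. Qed.

Let Qb_fin n (A : set binseq) : measurable A -> (0 <= Qb n A <= 1)%E.
Proof.
move=> mA; rewrite measure_ge0 -(QbT n) andTb.
by apply: le_measure; rewrite ?inE.
Qed.

Let Qb_fin_num n (A : set binseq) : measurable A -> Qb n A \is a fin_num.
Proof.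
move=> /(Qb_fin n) /andP[q0 q1]; rewrite ge0_fin_numE//.
by apply: le_lt_trans q1 (ltry _).
Qed.

(* The products of coordinates, truncated to [N] digits: they see finitely many
   bits and are uniformly close to the products. *)
Let Psi (l : seq nat) (N : nat) (y : nat -> bool) : R :=
  \prod_(k <- l) digits_val R (fun i => y (pickle (k, i))) N.

Let half_pow N : 0 <= 2^-1 ^+ N :> R. Proof. by rewrite exprn_ge0// invr_ge0. Qed.

Let digits_val_le1 y n : digits_val R y n <= 1.
Proof.
by have /andP[h _] := binval_approx R y n; have /andP[_ h'] := binval01 R y; exact: le_trans h h'.
Qed.

Let Psi_dep l N : exists M, forall y y' : nat -> bool,
  (forall i, (i < M)%N -> y i = y' i) -> Psi l N y = Psi l N y'.
Proof.
exists (\sum_(k <- l) \sum_(i < N) (pickle (k, (i : nat))).+1)%N => y y' yy'.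
apply: eq_big_seq => k kl; apply: eq_bigr => i _; rewrite yy'//.
by rewrite (big_rem k kl)/= (bigD1 i)//= -addnA addSn ltnS leq_addr.
Qed.

Let Psi01 l N y : 0 <= Psi l N y <= 1.
Proof.
rewrite /Psi; elim: l => [|k l /andP[ih1 ih2]]; first by rewrite big_nil ler01 lexx.
rewrite big_cons mulr_ge0//=; last exact: digits_val_ge0.
by apply: mulr_ile1 => //; exact: digits_val_ge0.
Qed.

Let prod_approx (l : seq nat) (u v : nat -> R) (e : R) :
  (forall k, 0 <= u k <= 1) -> (forall k, 0 <= v k <= 1) -> (forall k, `|u k - v k| <= e) ->
  `|\prod_(k <- l) u k - \prod_(k <- l) v k| <= (size l)%:R * e.
Proof.
move=> u01 v01 uv; elim: l => [|k l ih].
  by rewrite !big_nil subrr normr0 mul0r.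
have p01 (w : nat -> R) : (forall k, 0 <= w k <= 1) -> `|\prod_(k <- l) w k| <= 1.
  move=> w01; rewrite ger0_norm; first by apply: prodr_ile1 => i _; exact: w01.
  by apply: prodr_ge0 => i _; case/andP: (w01 i).
rewrite !big_cons (_ : _ - _ = (u k - v k) * \prod_(j <- l) u j +
   v k * (\prod_(j <- l) u j - \prod_(j <- l) v j)); last by ring.
have -> : (size (k :: l))%:R * e = e + (size l)%:R * e.
  by rewrite /= -natr1 mulrDl mul1r addrC.
apply: le_trans (ler_normD _ _) _.
rewrite !normrM; apply: lerD.
  by rewrite -[leRHS]mulr1; apply: ler_pM => //; exact: p01.
rewrite -[leRHS]mul1r; apply: ler_pM => //.
by have /andP[? ?] := v01 k; rewrite ger0_norm.
Qed.

Let Psi_coord l N y : `|\prod_(k <- l) coord_val k y - Psi l N y| <= (size l)%:R * 2^-1 ^+ N.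
Proof.
apply: prod_approx => k; first exact: coord_val01.
  by rewrite digits_val_ge0 digits_val_le1.
have /andP[? ?] := binval_approx R (fun i => y (pickle (k, i))) N.
by rewrite ler_norml /coord_val; apply/andP; split; have := half_pow N; lra.
Qed.

Let Psi_bits l N t : `|\prod_(k <- l) a k t - Psi l N (bits t)| <= (size l)%:R * 2^-1 ^+ N.
Proof.
apply: prod_approx => k; first exact: a01.
  by rewrite digits_val_ge0 digits_val_le1.
have -> : (fun i => bits t (pickle (k, i))) = digit (a k t).
  by apply/funext => i; rewrite /bits pickleK.
have /andP[? ?] := digits_val_approx N (a01 k t).
by rewrite ler_norml; apply/andP; split; have := half_pow N; lra.
Qed.

Let norm01 (x : R) : 0 <= x <= 1 -> `|x| <= 1.
Proof. by move=> /andP[? ?]; rewrite ger0_norm. Qed.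

(** Countably many random variables with values in [0, 1] have a limit law as
    soon as their mixed moments converge: along an ultrafilter the probabilities
    of all the finite patterns of binary digits converge, and the limits are the
    weights of the cylinders for a measure on binary sequences. *)
Theorem limit_law : exists rho : {measure set binseq -> \bar R},
  rho setT = 1%E /\
  forall l : seq nat, \int[rho]_y (\prod_(k <- l) coord_val k y) = Lambda l.
Proof.
have [U [UU oU]] := ultraFilterLemma eventually_filter.
have w_ex r : exists l : R, fine (Qb n (cyl r)) @[n --> U] --> l.
  apply: ultra_real_cvg => n; have := Qb_fin n (measurable_cyl r).
  by rewrite -{1 2}(fineK (Qb_fin_num n (measurable_cyl r))) !lee_fin.
pose w r := projT1 (cid (w_ex r)).
have wP r : fine (Qb n (cyl r)) @[n --> U] --> w r by exact: (projT2 (cid (w_ex r))).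
have w0 r : 0 <= w r.
  by apply: (cvgr_to_ge (wP r)); apply: nearW => n; exact/fine_ge0/measure_ge0.
have ws r : w r = w (false :: r) + w (true :: r).
  apply: (cvg_unique _ (wP r)) => //.
  rewrite (_ : (fun n => _) = fun n => fine (Qb n (cyl (false :: r))) + fine (Qb n (cyl (true :: r)))).
    by apply: cvgD; exact: wP.
  apply/funext => n; rewrite cyl_split measureU ?fineD//; do ?[exact: Qb_fin_num|exact: measurable_cyl].
  - by apply: Qb_fin_num; exact: measurable_cyl.
  - by apply: Qb_fin_num; exact: measurable_cyl.
  - by apply/disj_set2P; rewrite disj_set2E; apply/disj_setPS; have /disj_setPS := cyl_disj r.
have rhoT : tree_measure w setT = 1%E.
  rewrite tree_measureT//; congr EFin; apply: (cvg_unique _ (wP [::])) => //.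
  have -> : (fun n => fine (Qb n (cyl [::]))) = cst 1.
    by apply/funext => n; rewrite cyl_nil QbT.
  exact: cvg_cst.
exists (tree_measure w); split => // l.
apply/eqP; rewrite -subr_eq0 -normr_le0; apply/ler_addgt0Pr => e e0; rewrite add0r.
have [N Ne] : exists N, (size l)%:R * 2^-1 ^+ N <= e / 4.
  have e4 : 0 < e / 4 by rewrite divr_gt0.
  have : geometric (size l)%:R (2^-1 : R) @ \oo --> 0.
    by apply: cvg_geometric; rewrite ger0_norm ?invr_ge0// invf_lt1// ltr1n.
  move/cvgrPdist_le => /(_ _ e4)[N _ /(_ N (leqnn N))]; rewrite sub0r normrN /= => H.
  by exists N; apply: le_trans H; exact: ler_norm.
have [M HM] := Psi_dep l N.
have mPsi : measurable_fun [set: binseq] (Psi l N : binseq -> R).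
  exact: (measurable_cylinder_fun HM).
have E (m : {measure set binseq -> \bar R}) : m setT = 1%E ->
    \int[m]_y Psi l N y = \sum_(r : M.-tuple bool) Psi l N (bits_ext r) * fine (m (cyl r)).
  move=> m1; rewrite /Rintegral (integral_cylinder_fun HM); last by move=> y; case/andP: (Psi01 l N y).
  have fm (r : seq bool) : m (cyl r) \is a fin_num.
    rewrite ge0_fin_numE//; apply: (@le_lt_trans _ _ (m setT)); last by rewrite m1 ltry.
    by apply: le_measure; rewrite ?inE//; exact: measurable_cyl.
  rewrite (eq_bigr (fun r : M.-tuple bool => (Psi l N (bits_ext r) * fine (m (cyl r)))%:E)).
    by rewrite sumEFin.
  by move=> r _; rewrite EFinM fineK.
have cP : \int[Qb n]_y Psi l N y @[n --> U] --> \int[tree_measure w]_y Psi l N y.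
  rewrite E//; under eq_fun do rewrite E ?QbT//.
  apply: cvg_big => [|r _]; first exact: add_continuous.
  by apply: cvgM; [exact: cvg_cst|rewrite tree_measure_cyl//; exact: wP].
have cL : \int[Q n]_t (\prod_(k <- l) a k t) @[n --> U] --> Lambda l.
  by have Ll := @Lambda_cvg l; move=> A /Ll; exact: oU.
have [n [n1 n2]] : exists n, `|\int[tree_measure w]_y Psi l N y - \int[Qb n]_y Psi l N y| <= e / 4 /\
    `|Lambda l - \int[Q n]_t (\prod_(k <- l) a k t)| <= e / 4.
  have e4 : 0 < e / 4 by rewrite divr_gt0.
  apply: (@filter_ex _ U); near=> n; split; near: n.
    by move/cvgrPdist_le : cP => /(_ _ e4).
  by move/cvgrPdist_le : cL => /(_ _ e4).
have d1 : `|\int[tree_measure w]_y (\prod_(k <- l) coord_val k y) - \int[tree_measure w]_y Psi l N y| <= e / 4.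
  apply: le_trans Ne; apply: Rintegral_dist_le => //.
  - by apply: measurable_prod => k _; exact: measurable_coord_val.
  - exists 1 => y; apply: norm01; rewrite prodr_ge0 ?prodr_ile1// => k _; first exact: coord_val01.
    by case/andP: (coord_val01 k y).
  - by exists 1 => y; apply: norm01.
have QbE : \int[Qb n]_y Psi l N y = \int[Q n]_t Psi l N (bits t).
  rewrite /Rintegral ge0_integral_image//.
    exact/measurable_EFinP.
  by move=> y; rewrite lee_fin; case/andP: (Psi01 l N y).
have d2 : `|\int[Q n]_t (\prod_(k <- l) a k t) - \int[Q n]_t Psi l N (bits t)| <= e / 4.
  apply: le_trans Ne; apply: Rintegral_dist_le => //.
  - by apply: measurable_prod => k _.
  - exact: (measurableT_comp mPsi mbitsT).
  - by exists 1 => y; apply: norm01; rewrite prodr_ge0 ?prodr_ile1// => k _; case/andP: (a01 k y).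
  - by exists 1 => y; apply: norm01.
move: n1 n2 d1 d2; rewrite QbE !ler_norml.
by move=> /andP[? ?] /andP[? ?] /andP[? ?] /andP[? ?]; apply/andP; split; lra.
Unshelve. all: by end_near. Qed.

End limit_law.

(** * Lusin spaces are Borel retracts of the space of binary sequences *)

(** The algebra generated by the cylinders. *)
Definition fin_bits (S : set (nat -> bool)) : Prop := exists M, forall y y',
  (forall i, (i < M)%N -> y i = y' i) -> S y -> S y'.

Lemma fin_bitsE S : fin_bits S -> exists M, S =
  \bigcup_(r in [set r : M.-tuple bool | S (bits_ext r)]) cyl r.
Proof.
move=> [M HM]; exists M; apply/seteqP; split => y.
  move=> Sy; exists (Tuple (introT eqP (size_rprefix y M))).
    by apply: HM Sy => i iM; rewrite /= bits_ext_rprefix.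
  by rewrite /cyl/= size_rprefix.
move=> [r /= Sr]; rewrite /cyl/= size_tuple => yr; apply: HM Sr => i iM.
by rewrite -yr bits_ext_rprefix.
Qed.

Lemma measurable_fin_bits S : fin_bits S -> measurable (S : set binseq).
Proof.
move=> /fin_bitsE[M ->]; apply: fin_bigcup_measurable; first exact: finite_finset.
by move=> r _; exact: measurable_cyl.
Qed.

Lemma fin_bitsI S S' : fin_bits S -> fin_bits S' -> fin_bits (S `&` S').
Proof.
move=> [M HM] [M' HM']; exists (maxn M M') => y y' yy' [Sy S'y]; split.
  by apply: HM Sy => i iM; apply: yy'; rewrite leq_max iM.
by apply: HM' S'y => i iM; apply: yy'; rewrite leq_max iM orbT.
Qed.

Lemma fin_bitsC S : fin_bits S -> fin_bits (~` S).
Proof. by move=> [M HM]; exists M => y y' yy' nS Sy'; apply: nS; apply: HM Sy' => i /yy'. Qed.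

Lemma fin_bits0 : fin_bits set0.
Proof. by exists 0%N. Qed.

Lemma fin_bitsT : fin_bits setT.
Proof. by exists 0%N. Qed.

Lemma fin_bits_cyl r : fin_bits (cyl r).
Proof.
exists (size r) => y y' yy'; rewrite /cyl/= => yr; rewrite -[RHS]yr.
have prefixE n : (forall i, (i < n)%N -> y i = y' i) -> rprefix y' n = rprefix y n.
  elim: n => //= n ih H; rewrite H// ih// => i im; apply: H.
  exact: ltn_trans im (ltnSn n).
exact: prefixE.
Qed.

Lemma setring_fin_bits : setring fin_bits.
Proof.
have fU : setU_closed fin_bits.
  move=> A B fA fB; rewrite -(setCK (A `|` B)) setCU.
  by apply: fin_bitsC; apply: fin_bitsI; exact: fin_bitsC.
split; [exact: fin_bits0|exact: fU|].
by move=> A B fA fB; rewrite setDE; apply: fin_bitsI => //; exact: fin_bitsC.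
Qed.

Lemma measurable_fin_bitsE : (@measurable _ binseq) = <<s fin_bits >>.
Proof.
apply/seteqP; split.
  apply: sub_smallest2r; first exact: smallest_sigma_algebra.
  by move=> _ [r _ <-]; exact: fin_bits_cyl.
apply: smallest_sub; first exact: sigma_algebra_measurable.
by move=> S; exact: measurable_fin_bits.
Qed.

(** Meant for identities between Laplace transforms, which are not linear in the
    indicator of a set: they pass to monotone limits, but not to proper differences
    as a Dynkin argument requires. *)
Lemma fin_bits_monotone_class (G : set (set (nat -> bool))) :
  fin_bits `<=` G -> monotone G -> forall S : set binseq, measurable S -> G S.
Proof.
move=> fG mG S; rewrite measurable_fin_bitsE.
suff : <<s fin_bits >> `<=` G by exact.
have -> : <<s fin_bits >> = <<sr fin_bits >>.
  apply/seteqP; split.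
    apply: smallest_sub; last exact: sub_g_sigma_ring.
    have [r0 rD rU] := smallest_sigma_ring fin_bits; split => // A sA.
    by apply: rD => //; apply: sub_g_sigma_ring; exact: fin_bitsT.
  apply: smallest_sub; last exact: sub_sigma_algebra.
  have [s0 sC sU] := smallest_sigma_algebra (setT : set (nat -> bool)) fin_bits.
  split => // A B sA sB; rewrite setDE -(setCK A) -setCU -setTD; apply: (@sC _).
  by rewrite -bigcup2E; apply: sU => -[|[|n]]//=; rewrite -setTD; exact: (@sC _).
rewrite -g_monotone_g_sigma_ring; last exact: setring_fin_bits.
by apply: smallest_sub.
Qed.

(** A point is coded by the balls of a countable family that contain its image in
    the compact space. *)
Section lusin_coding.
Context (R : realType) (E : ptopologicalType).
Variables (K : metricType R) (i : E -> K).
Hypothesis cK : compact [set: K].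
Hypothesis i_inj : injective i.
Hypothesis i_open : forall U : set E, open U <-> exists2 O : set K, open O & i @^-1` O = U.
Hypothesis i_range : <<s @open K >> (range i).
Variable c : nat -> K.
Hypothesis cP : forall x (e : R), 0 < e -> exists n, mdist (c n) x < e.

Let par (m : nat) : nat * nat := odflt (0%N, 0%N) (unpickle m).
Let rad (m : nat) : R := (par m).1.+1%:R^-1.
Let cen (m : nat) : K := c (par m).2.

(* What a bit says about the decoded point; the strict inequality of [code] is
   weakened so that the constraints are closed and compactness applies. *)
Let constr (b : bool) (m : nat) : set K :=
  if b then [set z | mdist (cen m) z <= rad m] else [set z | rad m <= mdist (cen m) z].

Let decoded (y : nat -> bool) : set K := [set z | forall m, constr (y m) m z].

Let code (x : E) (m : nat) : bool := mdist (cen m) (i x) < rad m.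

Let decoded_code x : decoded (code x) (i x).
Proof. by move=> m; rewrite /constr /code; case: ltP => // /ltW. Qed.

Let decoded_unique y z z' : decoded y z -> decoded y z' -> z = z'.
Proof.
move=> yz yz'; apply/eqP; rewrite -[_ == _]negbK -mdist_gt0; apply/negP => d0.
have d3 : 0 < mdist z z' / 2 by rewrite divr_gt0.
have [n] := ltr_add_invr d3; rewrite add0r => nd.
have n0 : 0 < n.+1%:R^-1 :> R by [].
have [k kz] := cP z n0.
have pE : par (pickle (n, k)) = (n, k) by rewrite /par pickleK.
have := yz (pickle (n, k)); have := yz' (pickle (n, k)).
rewrite /constr /rad /cen pE/=; case: (y _) => /= h1 h2; last by move: h2; rewrite leNgt kz.
have := metric_triangle z (c k) z'; rewrite leNgt => /negP; apply.
rewrite (splitr (mdist z z')); apply: ltrD; first by rewrite metric_sym (lt_trans kz).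
exact: le_lt_trans h1 nd.
Qed.

Let closed_constr b m : closed (constr b m).
Proof.
have cm := @continuous_mdist R K (cen m).
rewrite /constr; case: b.
  by apply: (@closed_comp _ _ (fun z => mdist (cen m) z : R) [set x | x <= rad m]);
    [move=> ? _; exact: cm|exact: closed_le].
by apply: (@closed_comp _ _ (fun z => mdist (cen m) z : R) [set x | rad m <= x]);
    [move=> ? _; exact: cm|exact: closed_ge].
Qed.

(* For closed [A], compactness reduces membership to the satisfiability in [A] of
   every finite part of the constraints; uniqueness of decoding then gives
   complements, hence all Borel sets. *)
Let dset (A : set K) : set (nat -> bool) := [set y | exists2 z, decoded y z & A z].

Let dset_closed (A : set K) : closed A -> measurable (dset A : set binseq).
Proof.
move=> cA; pose D N : set (nat -> bool) :=
  [set y | exists2 z, (forall m, (m < N)%N -> constr (y m) m z) & A z].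
rewrite (_ : dset A = \bigcap_N D N).
  apply: bigcapT_measurable => N; apply: measurable_fin_bits; exists N => y y' yy'.
  by move=> [z yz Az]; exists z => // m mN; rewrite -yy'//; exact: yz.
apply/seteqP; split => y; first by move=> [z yz Az] N _; exists z.
move=> H; have z_ex N : exists z, (forall m, (m < N)%N -> constr (y m) m z) /\ A z.
  by have [z] := H N Logic.I; exists z.
pose z N := projT1 (cid (z_ex N)).
have zP N : (forall m, (m < N)%N -> constr (y m) m (z N)) /\ A (z N).
  exact: (projT2 (cid (z_ex N))).
have [p [_ pcl]] := cK (F := z @ \oo) _ filterT.
have cl (C : set K) : closed C -> (\forall n \near \oo, C (z n)) -> C p.
  move=> cC HC; apply: cC => B nB; exact: pcl.
exists p; last by apply: cl => //; apply: nearW => n; case: (zP n).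
by move=> m; apply: cl => //; exists m.+1 => // n /= mn; case: (zP n) => + _; exact.
Qed.

Let dset_measurable (A : set K) : <<s @open K >> A -> measurable (dset A : set binseq).
Proof.
have dT : measurable (dset setT : set binseq) by apply: dset_closed; exact: closedT.
have dC B : measurable (dset B : set binseq) -> measurable (dset (~` B) : set binseq).
  move=> mB; rewrite (_ : dset (~` B) = dset setT `\` dset B); first exact: measurableD.
  apply/seteqP; split => y.
    move=> [z yz nB]; split; first by exists z.
    by move=> [z' yz' Bz']; apply: nB; rewrite (decoded_unique yz yz').
  by move=> [[z yz _] nB]; exists z => // Bz; apply: nB; exists z.
move: A; apply: smallest_sub.
  split.
  - by rewrite (_ : dset set0 = set0)//; apply/seteqP; split => // y [].
  - by move=> B mB; rewrite setTD; exact: dC.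
  - move=> F mF; rewrite /= (_ : dset _ = \bigcup_n dset (F n)); first exact: bigcupT_measurable.
    apply/seteqP; split => y; first by move=> [z yz [n _ Fz]]; exists n => //; exists z.
    by move=> [n _ [z yz Fz]]; exists z => //; exists n.
move=> O oO; rewrite /= -(setCK O); apply: dC; apply: dset_closed.
exact: open_closedC.
Qed.

Let decode (y : nat -> bool) : E :=
  if pselect (exists x, decoded y (i x)) is left e then projT1 (cid e) else point.

Let decodeK : cancel code decode.
Proof.
move=> x; rewrite /decode; case: pselect => [e|]; last by case; exists x.
apply: i_inj; apply: (decoded_unique (y := code x)); last exact: decoded_code.
exact: (projT2 (cid e)).
Qed.

Let borel_preimage (B : set (Borel E)) : measurable B ->
  exists2 B' : set K, <<s @open K >> B' & B = i @^-1` B'.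
Proof.
have [s0 sC sU] := smallest_sigma_algebra (setT : set K) (@open K).
move: B; apply: smallest_sub.
  split.
  - by exists set0 => //; rewrite preimage_set0.
  - move=> _ [B' sB' ->]; exists (setT `\` B'); first exact: (@sC _).
    by rewrite !setTD preimage_setC.
  - move=> F HF; pose G n := projT1 (cid2 (HF n)).
    have GP n : <<s @open K >> (G n) by rewrite /G; case: cid2.
    have GE n : F n = i @^-1` (G n) by rewrite /G; case: cid2.
    exists (\bigcup_n G n); first exact: sU.
    by rewrite preimage_bigcup; apply: eq_bigcupr => n _; exact: GE.
by move=> U /i_open [U0 oU0 <-]; exists U0 => //; exact: sub_sigma_algebra.
Qed.

Let measurable_decode : measurable_fun [set: binseq] (decode : binseq -> Borel E).
Proof.
move=> _ B mB; rewrite setTI; have [B' sB' BE] := borel_preimage mB.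
have [s0 sC sU] := smallest_sigma_algebra (setT : set K) (@open K).
have sI : <<s @open K >> (B' `&` range i).
  rewrite -(setCK (B' `&` range i)) setCI -setTD; apply: (@sC _).
  by rewrite -bigcup2E; apply: sU => -[|[|n]]//=; rewrite -setTD; exact: (@sC _).
have H (y : nat -> bool) : (exists x, decoded y (i x)) -> dset (B' `&` range i) y <-> B (decode y).
  move=> ex; rewrite /decode; case: pselect => // e.
  set x := projT1 (cid e); have yx : decoded y (i x) by exact: (projT2 (cid e)).
  rewrite BE; split.
    by move=> [z yz [Bz _]]; rewrite /preimage/= (decoded_unique yx yz).
  by move=> Bx; exists (i x) => //; split => //; exists x.
have nH (y : nat -> bool) : dset (range i) y <-> exists x, decoded y (i x).
  by split => [[z yz [x _ xz]]|[x yx]]; [exists x; rewrite xz|exists (i x) => //; exists x].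
rewrite (_ : _ @^-1` B = dset (B' `&` range i) `|`
   ((~` dset (range i)) `&` [set y | B point])).
  apply: measurableU; first exact: dset_measurable.
  apply: measurableI; first by apply: measurableC; exact: dset_measurable.
  by have [Bp|nBp] := pselect (B point); [rewrite (_ : [set _ | _] = setT)|
    rewrite (_ : [set _ | _] = set0)] => //; apply/seteqP; split.
apply/seteqP; split => y.
  rewrite /preimage/= => By; have [ex|nex] := pselect (exists x, decoded y (i x)).
    by left; apply/(H _ ex).
  right; split; first by move=> /nH.
  by move: By; rewrite /decode; case: pselect.
move=> [dy|[ny Bp]]; rewrite /preimage/=.
  by apply/H => //; apply/nH; case: dy => z yz [_ xz]; exists z.
by rewrite /decode; case: pselect => // e; case: ny; apply/nH.
Qed.

Let measurable_code : measurable_fun [set: Borel E] (code : Borel E -> binseq).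
Proof.
apply: measurable_to_binseq => m; apply: measurable_fun_ltr => //.
apply: continuous_measurable_Borel => x.
apply: (@continuous_comp _ _ _ i (fun z => mdist (cen m) z : R)); last exact: continuous_mdist.
by move: x; apply/continuousP => A oA; apply/i_open; exists A.
Qed.

Lemma lusin_retract_of_embedding : exists (j : E -> nat -> bool) (tau : (nat -> bool) -> E),
  [/\ measurable_fun [set: Borel E] (j : Borel E -> binseq),
      measurable_fun [set: binseq] (tau : binseq -> Borel E) & cancel j tau].
Proof. by exists code, decode; split. Qed.

End lusin_coding.

(** Measures on a Lusin space can thus be constructed on binary sequences and
    pushed forward. *)
Lemma lusin_retract (R : realType) (E : ptopologicalType) : lusin_space R E ->
  exists (j : E -> nat -> bool) (tau : (nat -> bool) -> E),
  [/\ measurable_fun [set: Borel E] (j : Borel E -> binseq),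
      measurable_fun [set: binseq] (tau : binseq -> Borel E) & cancel j tau].
Proof.
move=> [K [i [cK i_inj i_open i_range]]].
have [c cP] := compact_dense_sequence (i point) cK.
by apply: (lusin_retract_of_embedding cK i_inj i_open i_range (c := c)); exact: cP.
Qed.

(** * Random measures with a prescribed Laplace functional *)

Lemma fin_bits_words (S : set (nat -> bool)) : fin_bits S -> exists rs : seq (seq bool),
  forall (R : realType) (m : {measure set binseq -> \bar R}),
  m S = (\sum_(r <- rs) m (cyl r))%E.
Proof.
move=> fS; have [M HM] := fS.
exists [seq val r | r <- enum {: M.-tuple bool} & `[< S (bits_ext (val r)) >]] => R m.
have dep y y' : (forall i, (i < M)%N -> y i = y' i) -> \1_S y = \1_S y' :> R.
  move=> yy'; rewrite !indicE; congr (nat_of_bool _)%:R.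
  apply/idP/idP; rewrite !inE; apply: HM => // i iM.
  by rewrite yy'.
transitivity (\int[m]_y (\1_S y)%:E)%E.
  by rewrite integral_indic ?setIT//; exact: measurable_fin_bits.
rewrite (integral_cylinder_fun dep) => [|y]; last by rewrite indicE.
rewrite big_map big_filter enumT [in RHS]big_mkcond/=.
apply: eq_bigr => r _; rewrite indicE; case: asboolP => Sr.
  by rewrite mem_set ?mul1e.
by rewrite memNset ?mul0e.
Qed.

(** The integer part as a count of thresholds. *)
Lemma sum_threshold (R : realType) (n : nat) (x : R) : 0 <= x <= n%:R ->
  \sum_(i < n) (i.+1%:R <= x)%R%:R <= x <= \sum_(i < n) (i.+1%:R <= x)%R%:R + 1.
Proof.
elim: n => [|n ih]; first by rewrite big_ord0; lra.
move=> /andP[x0 xn]; rewrite big_ord_recr/=; case: (leP x n%:R) => xn'.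
  have := ih _; rewrite x0 xn' => /(_ isT) /andP[ih1 ih2].
  have [nx|nx] := leP n.+1%:R x; last by rewrite addr0 ih1 ih2.
  have : n%:R < n.+1%:R :> R by rewrite ltr_nat.
  by lra.
rewrite (eq_bigr (fun=> 1)) => [|i _]; last first.
  by rewrite (le_trans _ (ltW xn'))// ler_nat.
rewrite sumr_const card_ord; move: xn; rewrite -[in n.+1%:R]addn1 natrD.
by case: (leP (n%:R + 1) x) => ? ? /=; apply/andP; split; lra.
Qed.

Lemma ae_forall_countable d (T : measurableType d) (R : realType)
    (m : {measure set T -> \bar R}) (I : countType) (P : I -> T -> Prop) :
  (forall i, {ae m, forall t, P i t}) -> {ae m, forall t i, P i t}.
Proof.
move=> H; have : {ae m, forall t n, forall i, unpickle n = Some i -> P i t}.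
  apply: ae_foralln => n; case: (unpickle n) => [i|]; last exact: nearW.
  by apply: filterS (H i) => t Pt _ [<-].
by apply: filterS => t Pt i; apply: (Pt (pickle i)); exact: pickleK.
Qed.

(** The coordinates [A r N] stand for [exp (- m (cyl r) / (N + 1))], where [m] is
    the random measure to be found; only their joint moments are given, in the
    form of a functional [Lam]. The factor [1 / (N + 1)] tells finite masses from
    infinite ones: the roots [A r N] of [A r 0] tend to 1 exactly when [A r 0] is
    positive. *)
Section random_tree_measure.
Context d (T : measurableType d) (R : realType).
Variable rho : {measure set T -> \bar R}.
Hypothesis rho1 : rho setT = 1%E.
Variable A : seq bool -> nat -> T -> R.
Hypothesis mA : forall r N, measurable_fun [set: T] (A r N).
Hypothesis A01 : forall r N u, 0 <= A r N u <= 1.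

Definition step_fun (l : seq (seq bool * nat)) (y : nat -> bool) : R :=
  \sum_(p <- l) \1_(cyl p.1) y / p.2.+1%:R.

Variable Lam : ((nat -> bool) -> R) -> R.
Hypothesis A_law : forall l,
  \int[rho]_u (\prod_(p <- l) A p.1 p.2 u) = Lam (step_fun l).
Hypothesis Lam_cont : forall (C : R) (g_ : nat -> binseq -> R) (g : binseq -> R),
  (forall n, measurable_fun [set: binseq] (g_ n)) ->
  (forall n y, 0 <= g_ n y <= C) -> (forall y, g_ n y @[n --> \oo] --> g y) ->
  Lam (g_ n) @[n --> \oo] --> Lam g.

Let rho_fin : (rho setT < +oo)%E. Proof. by rewrite rho1 ltry. Qed.

Let X (l : seq (seq bool * nat)) (u : T) : R := \prod_(p <- l) A p.1 p.2 u.

Let mX l : measurable_fun [set: T] (X l).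
Proof. by apply: measurable_prod => p _; exact: mA. Qed.

Let X01 l u : 0 <= X l u <= 1.
Proof. by rewrite /X prodr_ge0 ?prodr_ile1// => p _; rewrite ?A01//; case/andP: (A01 p.1 p.2 u). Qed.

Let X_cat l l' u : X (l ++ l') u = X l u * X l' u.
Proof. by rewrite /X big_cat. Qed.

Let iX l : rho.-integrable setT (EFin \o X l).
Proof.
apply: (integrable_bounded (M := 1)) => // u.
by have /andP[? ?] := X01 l u; rewrite ger0_norm.
Qed.

(** Two products of coordinates whose step functions agree are equal in square
    mean, since all three terms of the expanded square have the same integral. *)
Lemma ae_step_fun l l' : step_fun l = step_fun l' ->
  {ae rho, forall u, \prod_(p <- l) A p.1 p.2 u = \prod_(p <- l') A p.1 p.2 u}.
Proof.
move=> ll'; have s_cat k k' : step_fun (k ++ k') = step_fun k \+ step_fun k'.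
  by apply/funext => y; rewrite /step_fun big_cat.
have E : \int[rho]_u ((X l u - X l' u) ^+ 2) = 0.
  rewrite (_ : (fun u => _) = fun u => X (l ++ l) u - X (l ++ l') u + (X (l' ++ l') u - X (l ++ l') u)).
    rewrite RintegralD//=; last 2 first.
    - by apply: (integrableB measurableT (iX _) (iX _)).
    - by apply: (integrableB measurableT (iX _) (iX _)).
    rewrite !RintegralB//; try exact: iX.
    by rewrite !A_law !s_cat ll'; lra.
  by apply/funext => u; rewrite !X_cat; ring.
have mD : measurable_fun [set: T] (fun u => (X l u - X l' u) ^+ 2).
  by apply: measurable_funX; apply: measurable_funB; exact: mX.
have iD : rho.-integrable setT (EFin \o (fun u => (X l u - X l' u) ^+ 2)).
  apply: (integrable_bounded (M := 1)) => //= u.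
  have /andP[? ?] := X01 l u; have /andP[? ?] := X01 l' u.
  by rewrite ger0_norm ?sqr_ge0//; nra.
have E0 : (\int[rho]_(u in setT) `|((X l u - X l' u) ^+ 2)%:E| = 0)%E.
  under eq_integral do rewrite gee0_abs ?lee_fin ?sqr_ge0//.
  by rewrite -[LHS]fineK ?[fine _]E//; exact: integrable_fin_num.
have : ae_eq rho setT (fun u => ((X l u - X l' u) ^+ 2)%:E) (cst 0%E).
  by apply/(ae_eq_integral_abs _ measurableT) => //; exact/measurable_EFinP.
apply: filterS => u /(_ Logic.I) /= [] /eqP; rewrite sqrf_eq0 subr_eq0 => /eqP; exact.
Qed.

(* Where the logarithms of the coordinates are finite and form consistent
   cylinder masses. *)
Let good : set T := [set u | 0 < A [::] 0 u] `&`
  \bigcap_r ([set u | A r 0 u = A (false :: r) 0 u * A (true :: r) 0 u] `&`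
    \bigcap_N [set u | A r N u ^+ N.+1 = A r 0 u]).

Let meq (f g : T -> R) : measurable_fun [set: T] f -> measurable_fun [set: T] g ->
  measurable [set u | f u = g u].
Proof.
move=> mf mg; rewrite (_ : [set u | _] = (fun u => f u == g u) @^-1` [set true]).
  by rewrite -[X in measurable X]setTI; exact: measurable_fun_eqr.
by apply/seteqP; split => u /eqP.
Qed.

Let mgood : measurable good.
Proof.
apply: measurableI.
  rewrite (_ : [set u | _] = (fun u => 0 < A [::] 0 u) @^-1` [set true])//.
  by rewrite -[X in measurable X]setTI; exact: measurable_fun_ltr.
rewrite -[X in measurable X]setCK setC_bigcap; apply: measurableC.
apply: countable_bigcupT_measurable => [|r]; first exact: countableP.
apply: measurableC.
apply: measurableI; first by apply: meq => //; exact: measurable_funM.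
apply: bigcapT_measurable => N; apply: meq => //; exact: measurable_funX.
Qed.

Let ae_pow r N : {ae rho, forall u, A r N u ^+ N.+1 = A r 0 u}.
Proof.
have : step_fun (nseq N.+1 (r, N)) = step_fun [:: (r, 0)].
  apply/funext => y; rewrite /step_fun big_nseq big_seq1/= iter_addr_0 divr1.
  by rewrite -mulrS -[LHS]mulr_natr divfK// pnatr_eq0.
move=> /ae_step_fun; apply: filterS => u.
by rewrite big_nseq iter_mulr_1 big_seq1.
Qed.

(* Where [A [::] 0] vanishes so do all its roots [A [::] N]; but the mean of
   these tends to 1, because [Lam] is continuous at 0. *)
Let root_pos : {ae rho, forall u, 0 < A [::] 0 u}.
Proof.
pose Z : set T := [set u | A [::] 0 u = 0].
have mZ : measurable Z by apply: meq => //; exact: measurable_cst.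
have rhoZ : rho Z \is a fin_num.
  by rewrite ge0_fin_numE//; apply: le_lt_trans rho_fin; apply: le_measure; rewrite ?inE.
have EZ : rho (~` Z) = (1 - rho Z)%E.
  by rewrite -rho1 -setTD measureD//= setTI.
have le N : Lam (step_fun [:: ([::], N)]) <= 1 - fine (rho Z).
  rewrite -A_law -lee_fin (_ : (1 - _)%:E = rho (~` Z)); last by rewrite EZ EFinB fineK.
  under eq_Rintegral do rewrite big_seq1/=.
  rewrite /Rintegral fineK; last first.
    apply: integrable_fin_num => //; apply: (integrable_bounded (M := 1)) => // u.
    by have /andP[? ?] := A01 [::] N u; rewrite ger0_norm.
  have -> : rho (~` Z) = (\int[rho]_u (\1_(~` Z) u)%:E)%E.
    by rewrite integral_indic ?setIT//; exact: measurableC.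
  apply: ae_ge0_le_integral => //.
  - by move=> u _; rewrite lee_fin; case/andP: (A01 [::] N u).
  - exact/measurable_EFinP.
  - apply/measurable_EFinP; apply: measurable_indic; exact: measurableC.
  - apply: filterS (ae_pow [::] N) => u uN _; rewrite lee_fin indicE.
    have [Zu|nZu] := pselect (Z u); last by rewrite mem_set//; case/andP: (A01 [::] N u).
    rewrite memNset//; move: uN; rewrite (Zu : A _ _ _ = _) => /eqP.
    by rewrite expf_eq0/= => /eqP ->.
have /cvgr_to_le : Lam (step_fun [:: ([::], N)]) @[N --> \oo] --> Lam (step_fun [::]).
  apply: (Lam_cont (C := 1)).
  - move=> N; apply: measurable_sum => p; apply: measurable_funM => //.
    by apply: measurable_indic; exact: measurable_cyl.
  - move=> N y; rewrite /step_fun big_seq1/= divr_ge0 ?indicE//= ler_pdivrMr// mul1r.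
    by apply: (@le_trans _ _ 1); rewrite ?ler1n//; case: (_ \in _).
  - move=> y; rewrite /step_fun big_nil.
    have c0 : \1_(cyl [::]) y / N.+1%:R @[N --> \oo] --> (0 : R).
      rewrite -[X in _ --> X](mulr0 (\1_(cyl [::]) y)).
      by apply: cvgM; [exact: cvg_cst|exact: cvg_harmonic].
    by under eq_fun do rewrite big_seq1/=.
move=> /(_ (1 - fine (rho Z)) (nearW _ le)).
rewrite -A_law; under eq_Rintegral do rewrite big_nil.
rewrite /Rintegral (@integral_cst _ T R rho setT measurableT 1%:E) rho1 mule1/=.
rewrite lerBrDl gerDr => Z0.
exists Z; split => //.
  by apply/eqP; rewrite eq_le measure_ge0 andbT -[rho Z]fineK// lee_fin.
move=> u /= /negP; rewrite -leNgt => u0; apply/eqP; rewrite eq_le u0.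
by case/andP: (A01 [::] 0 u).
Qed.

Let good_ae : {ae rho, forall u, good u}.
Proof.
have H1 : {ae rho, forall u, forall r, A r 0 u = A (false :: r) 0 u * A (true :: r) 0 u}.
  apply: ae_forall_countable => r.
  have : step_fun [:: (r, 0)] = step_fun [:: (false :: r, 0); (true :: r, 0)].
    apply/funext => y; rewrite /step_fun big_seq1 big_cons big_seq1/= !divr1 cyl_split.
    have /disj_setPS/(_ y) := cyl_disj r; rewrite !indicE in_setU.
    case: (boolP (y \in cyl (false :: r))) => [/set_mem y0|_ _]; last by rewrite add0r.
    case: (boolP (y \in cyl (true :: r))) => [/set_mem y1|_ _]; last by rewrite addr0.
    by case; split.
  move=> /ae_step_fun; apply: filterS => u.
  by rewrite big_seq1 big_cons big_seq1.
have H2 : {ae rho, forall u, forall p : seq bool * nat, A p.1 p.2 u ^+ p.2.+1 = A p.1 0 u}.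
  by apply: ae_forall_countable => -[r N]; exact: ae_pow.
apply: filterS3 H1 H2 root_pos => u h1 h2 h0; split => // r _; split => [|N _].
  exact: h1.
exact: (h2 (r, N)).
Qed.

Let w (u : T) (r : seq bool) : R := - ln (A r 0 u) * \1_good u.

Let goodP u : good u -> forall r, 0 < A r 0 u.
Proof.
move=> [h0 h1]; elim=> // b r; have [/= -> _] := h1 r Logic.I.
have a0 : 0 <= A (false :: r) 0 u by case/andP: (A01 (false :: r) 0 u).
have a1 : 0 <= A (true :: r) 0 u by case/andP: (A01 (true :: r) 0 u).
by case: b => H; rewrite lt_neqAle ?a0 ?a1 andbT; apply/eqP => e; move: H;
  rewrite -e ?mulr0 ?mul0r ltxx.
Qed.

Let w_ge0 u r : 0 <= w u r.
Proof.
by rewrite /w mulr_ge0 ?indicE// oppr_ge0 ln_le0//; case/andP: (A01 r 0 u).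
Qed.

Let w_split u r : w u r = w u (false :: r) + w u (true :: r).
Proof.
have [gu|ngu] := pselect (good u); last by rewrite /w indicE memNset// !mulr0 addr0.
have := gu => -[_ /(_ r Logic.I) [/= Ar _]].
by rewrite /w Ar lnM ?opprD ?mulrDl// posrE; exact: goodP.
Qed.

Let A_w u r N : good u -> A r N u = expR (- (w u r / N.+1%:R)).
Proof.
move=> gu; have Ar0 := goodP gu r; have [_ /(_ r Logic.I)[_ /(_ N Logic.I)/= AN]] := gu.
have AN0 : 0 < A r N u.
  rewrite lt_neqAle (andP (A01 r N u)).1 andbT; apply/eqP => e.
  by move: Ar0; rewrite -AN -e expr0n ltxx.
rewrite /w indicE mem_set// mulr1 -AN lnXn// -[ln _ *+ _]mulr_natr mulNr opprK.
by rewrite mulfK ?pnatr_eq0// lnK.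
Qed.

Let mw r : measurable_fun [set: T] (w ^~ r).
Proof.
apply: measurable_funM; last by apply: measurable_indic; exact: mgood.
by apply: measurableT_comp => //; apply: measurableT_comp => //; exact: measurable_ln.
Qed.

Definition random_measure (u : T) : {measure set binseq -> \bar R} := tree_measure (w u).

Let random_measure_cyl u r : random_measure u (cyl r) = (w u r)%:E.
Proof. by apply: tree_measure_cyl; [exact: w_ge0|exact: w_split]. Qed.

Lemma random_measure_fin u : (random_measure u setT < +oo)%E.
Proof. by rewrite -cyl_nil random_measure_cyl ltry. Qed.

Let mass_fin u S : measurable S -> random_measure u S \is a fin_num.
Proof.
move=> mS; rewrite ge0_fin_numE//; apply: le_lt_trans (random_measure_fin u).
by apply: le_measure => //; rewrite inE.
Qed.

Let mass (u : T) (S : set binseq) : R := fine (random_measure u S).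

Let mass_cvg u (F : nat -> set binseq) S : (forall n, measurable (F n)) -> measurable S ->
  (forall y, (\1_(F n) y : R) @[n --> \oo] --> (\1_S y : R)) ->
  mass u (F n) @[n --> \oo] --> mass u S.
Proof.
move=> mF mS FS; have massE S' : measurable S' -> mass u S' = \int[random_measure u]_y \1_S' y.
  by move=> mS'; rewrite /mass /Rintegral integral_indic ?setIT.
rewrite massE//; under eq_fun => n do rewrite massE//.
apply: (Rintegral_bounded_cvg (M := 1)) => //; first exact: random_measure_fin.
  by move=> n; exact: measurable_indic.
by move=> n y; rewrite /= indicE; case: (_ \in _); rewrite ?normr0 ?normr1.
Qed.

Let indic_nd (F : nat -> set binseq) : {homo F : n m / (n <= m)%N >-> n `<=` m} ->
  forall y, (\1_(F n) y : R) @[n --> \oo] --> (\1_(\bigcup_n F n) y : R).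
Proof.
move=> ndF y; apply: cvg_near_cst; rewrite indicE.
have [[n _ Fny]|nF] := pselect ((\bigcup_n F n) y).
  have UF : (\bigcup_n F n) y by exists n.
  exists n => // m /= nm; rewrite indicE !mem_set//; exact: ndF nm _ Fny.
apply: nearW => n; rewrite indicE !memNset// => Fny; apply: nF; by exists n.
Qed.

Let indic_ni (F : nat -> set binseq) : {homo F : n m / (n <= m)%N >-> m `<=` n} ->
  forall y, (\1_(F n) y : R) @[n --> \oo] --> (\1_(\bigcap_n F n) y : R).
Proof.
move=> niF y; apply: cvg_near_cst; rewrite indicE.
have [aF|nF] := pselect ((\bigcap_n F n) y).
  by apply: nearW => n; rewrite indicE !mem_set//; exact: aF.
have [n nFn] : exists n, ~ F n y.
  by apply: contra_notP nF => /forallNP H n _; apply: contrapT; exact: H.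
exists n => // m /= nm; rewrite indicE !memNset// => Fm; apply: nFn; exact: niF nm _ Fm.
Qed.

(* Both kinds of monotone limits of sets are limits of indicators. *)
Let monotone_of_cvg (G : set (set binseq)) : G `<=` measurable ->
  (forall F S, (forall n, G (F n)) -> measurable S ->
     (forall y, (\1_(F n) y : R) @[n --> \oo] --> (\1_S y : R)) -> G S) -> monotone G.
Proof.
move=> Gm H; split => F mF GF.
  apply: (H F) => //; last by apply: indic_nd => n m; move=> /mF/subsetPset.
  by apply: bigcupT_measurable => n; exact: Gm.
apply: (H F) => //; last by apply: indic_ni => n m; move=> /mF/subsetPset.
by apply: bigcapT_measurable => n; exact: Gm.
Qed.

Let measurable_mass (S : set binseq) : measurable S -> measurable_fun [set: T] (mass ^~ S).
Proof.
pose G : set (set binseq) := [set S | measurable S /\ measurable_fun [set: T] (mass ^~ S)].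
suff H S' : measurable S' -> G S' by move=> /H[].
apply: fin_bits_monotone_class.
  move=> B fB; split; first exact: measurable_fin_bits.
  have [rs rsE] := fin_bits_words fB.
  rewrite (_ : mass ^~ B = fun u => \sum_(r <- rs) w u r).
    by apply: measurable_sum => r; exact: mw.
  apply/funext => u; rewrite /mass rsE; under eq_bigr do rewrite random_measure_cyl.
  by rewrite sumEFin.
apply: monotone_of_cvg => [B []//|F B GF mB FB]; split => //.
apply: (@measurable_fun_cvg _ _ _ _ (fun n u => mass u (F n))).
  by move=> n; case: (GF n).
by move=> u _; apply: mass_cvg => // n; case: (GF n).
Qed.

Lemma measurable_random_measure (S : set binseq) : measurable S ->
  measurable_fun [set: T] (random_measure ^~ S).
Proof.
move=> mS; rewrite (_ : random_measure ^~ S = EFin \o (mass ^~ S)).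
  by apply/measurable_EFinP; exact: measurable_mass.
by apply/funext => u /=; rewrite /mass fineK// mass_fin.
Qed.

Section Laplace_indicators.
Variables (N : nat) (B : nat -> set binseq).
Hypothesis mB : forall i, measurable (B i).

Let Lsum n (S : set binseq) (rs : seq (seq bool)) u : R :=
  (\sum_(i < n) mass u (B i) + mass u S + \sum_(r <- rs) w u r) / N.+1%:R.

Let Rsum n (S : set binseq) (rs : seq (seq bool)) (y : binseq) : R :=
  (\sum_(i < n) \1_(B i) y + \1_S y + \sum_(r <- rs) \1_(cyl r) y) / N.+1%:R.

Let mass_ge0 u S : 0 <= mass u S. Proof. exact: fine_ge0. Qed.

Let Lsum_ge0 n S rs u : 0 <= Lsum n S rs u.
Proof. by rewrite divr_ge0// !addr_ge0// sumr_ge0. Qed.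

Let measurable_Lsum n S rs : measurable S -> measurable_fun [set: T] (Lsum n S rs).
Proof.
move=> mS; apply: measurable_funM => //; apply: measurable_funD.
  apply: measurable_funD; last exact: measurable_mass.
  by apply: measurable_sum => i; exact: measurable_mass.
by apply: measurable_sum => r; exact: mw.
Qed.

Let measurable_Rsum n S rs : measurable S -> measurable_fun [set: binseq] (Rsum n S rs).
Proof.
move=> mS; apply: measurable_funM => //; apply: measurable_funD.
  by apply: measurable_funD; [apply: measurable_sum => i|]; exact: measurable_indic.
by apply: measurable_sum => r; apply: measurable_indic; exact: measurable_cyl.
Qed.

Let Rsum_bound n S rs y : 0 <= Rsum n S rs y <= n%:R + 1 + (size rs)%:R.
Proof.
have i1 (A' : set binseq) : \1_A' y <= 1 :> R by rewrite indicE; case: (_ \in _).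
have i0 (A' : set binseq) : 0 <= \1_A' y :> R by rewrite indicE.
have k1 : \sum_(i < n) \1_(B i) y <= n%:R :> R.
  apply: (@le_trans _ _ (\sum_(i < n) 1)); first by apply: ler_sum => i _; exact: i1.
  by rewrite sumr_const card_ord.
have k2 : \sum_(r <- rs) \1_(cyl r) y <= (size rs)%:R :> R.
  apply: (@le_trans _ _ (\sum_(r <- rs) 1)); first by apply: ler_sum => r _; exact: i1.
  by rewrite big_const_seq count_predT iter_addr_0.
have s0 : 0 <= \sum_(i < n) \1_(B i) y + \1_S y + \sum_(r <- rs) \1_(cyl r) y :> R.
  by rewrite !addr_ge0// sumr_ge0.
rewrite divr_ge0//= ler_pdivrMr//; apply: le_trans (ler_peMr _ _) => //.
- by rewrite !lerD.
- by rewrite ler1n.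
Qed.

Let Laplace_words rs :
  \int[rho]_u expR (- ((\sum_(r <- rs) w u r) / N.+1%:R)) =
  Lam (fun y => (\sum_(r <- rs) \1_(cyl r) y) / N.+1%:R).
Proof.
transitivity (\int[rho]_u (\prod_(p <- [seq (r, N) | r <- rs]) A p.1 p.2 u)).
  rewrite /Rintegral; congr fine; apply: ae_eq_integral => //.
  - apply/measurable_EFinP; apply: measurableT_comp => //; apply: measurableT_comp => //.
    by apply: measurable_funM => //; apply: measurable_sum => r; exact: mw.
  - by apply/measurable_EFinP; exact: mX.
  - apply: filterS good_ae => u gu _; congr EFin; rewrite big_map.
    under [RHS]eq_bigr do rewrite /= A_w//.
    by rewrite mulr_suml -sumrN expR_sum.
rewrite A_law; congr Lam; apply/funext => y.
by rewrite /step_fun big_map/= mulr_suml.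
Qed.

(* One set after the other is freed from being a cylinder: the identity for
   [B n] is a monotone class in [B n], all the others being fixed. *)
Let Laplace_sets n rs :
  \int[rho]_u expR (- ((\sum_(i < n) mass u (B i) + \sum_(r <- rs) w u r) / N.+1%:R)) =
  Lam (fun y => (\sum_(i < n) \1_(B i) y + \sum_(r <- rs) \1_(cyl r) y) / N.+1%:R).
Proof.
elim: n rs => [|n ih] rs.
  under eq_Rintegral do rewrite big_ord0 add0r.
  by rewrite Laplace_words; congr Lam; apply/funext => y; rewrite big_ord0 add0r.
pose G : set (set binseq) := [set S | measurable S /\ forall rs,
  \int[rho]_u expR (- Lsum n S rs u) = Lam (Rsum n S rs)].
suff : G (B n).
  move=> [_ /(_ rs)]; rewrite /Lsum /Rsum => H.
  under eq_Rintegral do rewrite big_ord_recr/=.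
  by rewrite H; congr Lam; apply/funext => y; rewrite big_ord_recr/=.
move: (mB n); apply: fin_bits_monotone_class.
  move=> S fS; split => [|rs']; first exact: measurable_fin_bits.
  have [ws wsE] := fin_bits_words fS.
  have massE u : mass u S = \sum_(r <- ws) w u r.
    by rewrite /mass wsE; under eq_bigr do rewrite random_measure_cyl; rewrite sumEFin.
  have indE y : \1_S y = \sum_(r <- ws) \1_(cyl r) y :> R.
    by apply: EFin_inj; rewrite -sumEFin; exact: (wsE R (@dirac _ binseq y R)).
  rewrite /Lsum /Rsum; under eq_Rintegral do rewrite massE -addrA -big_cat/=.
  by rewrite ih; congr Lam; apply/funext => y; rewrite indE -addrA -big_cat.
apply: monotone_of_cvg => [S []//|F S GF mS FS]; split => // rs'.
have mF k : measurable (F k) by case: (GF k).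
have e1 : \int[rho]_u expR (- Lsum n (F k) rs' u) @[k --> \oo] -->
    \int[rho]_u expR (- Lsum n S rs' u).
  apply: (Rintegral_bounded_cvg (M := 1)) => //.
  - move=> k; apply: measurableT_comp => //; apply: measurableT_comp => //.
    exact: measurable_Lsum.
  - move=> k u; rewrite ger0_norm ?expR_ge0//.
    by rewrite -expR0 ler_expR oppr_le0.
  - move=> u; apply: continuous_cvg; first exact: continuous_expR.
    apply: cvgN; apply: cvgM; last exact: cvg_cst.
    apply: cvgD; last exact: cvg_cst.
    by apply: cvgD; [exact: cvg_cst|exact: mass_cvg].
have e2 : Lam (Rsum n (F k) rs') @[k --> \oo] --> Lam (Rsum n S rs').
  apply: (Lam_cont (C := n%:R + 1 + (size rs')%:R)).
  - by move=> k; exact: measurable_Rsum.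
  - by move=> k y; exact: Rsum_bound.
  - move=> y; apply: cvgM; last exact: cvg_cst.
    apply: cvgD; last exact: cvg_cst.
    by apply: cvgD; [exact: cvg_cst|exact: FS].
apply: (cvg_unique _ e1) => //.
rewrite (_ : (fun k : nat => _) = fun k => Lam (Rsum n (F k) rs')) //.
by apply/funext => k; case: (GF k).
Qed.

Lemma Laplace_indicators n :
  \int[rho]_u expR (- ((\sum_(i < n) mass u (B i)) / N.+1%:R)) =
  Lam (fun y => (\sum_(i < n) \1_(B i) y) / N.+1%:R).
Proof.
transitivity (Lam (fun y => (\sum_(i < n) \1_(B i) y + \sum_(r <- [::]) \1_(cyl r) y) / N.+1%:R)).
  by rewrite -Laplace_sets; under [RHS]eq_Rintegral do rewrite big_nil addr0.
by congr Lam; apply/funext => y; rewrite big_nil addr0.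
Qed.

End Laplace_indicators.

(** Indicators of arbitrary sets are reached one at a time by monotone classes;
    a bounded function is then squeezed between sums of indicators of its level
    sets with mesh [1 / (N + 1)]. *)
Lemma Laplace_random_measure (g : binseq -> R) (C : nat) :
  measurable_fun [set: binseq] g -> (forall y, 0 <= g y <= C%:R) ->
  \int[rho]_u expR (- \int[random_measure u]_y g y) = Lam g.
Proof.
move=> mg gC; pose B N i : set binseq := [set y | i.+1%:R <= g y * N.+1%:R].
have mB N i : measurable (B N i).
  rewrite (_ : B N i = (fun y => i.+1%:R <= g y * N.+1%:R) @^-1` [set true])//.
  rewrite -[X in measurable X]setTI; apply: measurable_fun_ler => //.
  exact: measurable_funM.
pose g_ N (y : binseq) := (\sum_(i < (C * N.+1)%N) \1_(B N i) y) / N.+1%:R : R.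
have g_g N y : g_ N y <= g y <= g_ N y + N.+1%:R^-1.
  have := @sum_threshold R (C * N.+1)%N (g y * N.+1%:R).
  have /andP[g0 g1] := gC y; rewrite mulr_ge0//= natrM ler_pM2r// g1 => /(_ isT).
  rewrite (eq_bigr (fun i : 'I__ => \1_(B N i) y)) => [/andP[l1 l2]|i _]; last first.
    rewrite indicE; congr (nat_of_bool _)%:R.
    by apply/idP/idP => [H|/set_mem//]; apply/mem_set.
  rewrite /g_ ler_pdivrMr// l1/= -[X in _ + X]div1r -mulrDl ler_pdivlMr//.
have mg_ N : measurable_fun [set: binseq] (g_ N).
  apply: measurable_funM => //; apply: measurable_sum => i; exact: measurable_indic.
have g0 N y : 0 <= g_ N y by rewrite divr_ge0// sumr_ge0// => i _; rewrite indicE.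
have gC_ N y : `|g_ N y| <= C%:R.
  by have /andP[+ _] := g_g N y; have /andP[_ ?] := gC y; rewrite ger0_norm//; lra.
have cg y : g_ N y @[N --> \oo] --> g y.
  apply: (squeeze_cvgr (f := fun N => g y - N.+1%:R^-1) (h := fun=> g y)).
  - by apply: nearW => N; have /andP[l1 l2] := g_g N y; rewrite lerBlDr l1 l2.
  - rewrite -[X in _ --> X](subr0 (g y)); apply: cvgB; [exact: cvg_cst|exact: cvg_harmonic].
  - exact: cvg_cst.
have intE N u : \int[random_measure u]_y g_ N y =
    (\sum_(i < (C * N.+1)%N) mass u (B N i)) / N.+1%:R.
  have iE (A' : set binseq) y : (0 <= (\1_A' y : R)%:E)%E by rewrite indicE lee_fin.
  have mE i : measurable_fun [set: binseq] (fun y => (\1_(B N i) y : R)%:E).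
    by apply/measurable_EFinP; exact: measurable_indic.
  apply: EFin_inj; rewrite /Rintegral.
  have -> : (\int[random_measure u]_y (g_ N y)%:E =
      \int[random_measure u]_y ((N.+1%:R^-1)%:E * \sum_(i < (C * N.+1)%N) (\1_(B N i) y)%:E))%E.
    by apply: eq_integral => y _; rewrite sumEFin -EFinM mulrC.
  rewrite ge0_integralZl//; last 2 first.
  - exact: emeasurable_sum.
  - by move=> y _; exact: sume_ge0.
  rewrite ge0_integral_sum// mulrC EFinM -sumEFin.
  rewrite (eq_bigr (fun i : 'I_(C * N.+1)%N => (mass u (B N i))%:E)) => [|i _]; last first.
    by rewrite integral_indic// setIT /mass fineK// mass_fin.
  by rewrite sumEFin -EFinM.
have e1 : \int[rho]_u expR (- \int[random_measure u]_y g_ N y) @[N --> \oo] -->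
    \int[rho]_u expR (- \int[random_measure u]_y g y).
  apply: (Rintegral_bounded_cvg (M := 1)) => //.
  - move=> N; apply: measurableT_comp => //; apply: measurableT_comp => //.
    rewrite (_ : (fun u => _) = fun u => (\sum_(i < (C * N.+1)%N) mass u (B N i)) / N.+1%:R).
      by apply: measurable_funM => //; apply: measurable_sum => i; exact: measurable_mass.
    by apply/funext => u; exact: intE.
  - move=> N u; rewrite ger0_norm ?expR_ge0// -expR0 ler_expR oppr_le0.
    by rewrite intE divr_ge0// sumr_ge0// => i _; exact: fine_ge0.
  - move=> u; apply: continuous_cvg; first exact: continuous_expR.
    by apply: cvgN; apply: (Rintegral_bounded_cvg (M := C%:R)) => //; exact: random_measure_fin.
have e2 : Lam (g_ N) @[N --> \oo] --> Lam g.
  apply: (Lam_cont (C := C%:R)) => // N y.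
  by rewrite g0/=; apply: le_trans (gC_ N y); exact: ler_norm.
have E : (fun N => \int[rho]_u expR (- \int[random_measure u]_y g_ N y)) = (fun N => Lam (g_ N)).
  apply/funext => N; under eq_Rintegral do rewrite intE.
  exact: (Laplace_indicators N (mB N)).
by move: e1; rewrite E => e1; exact: (cvg_unique _ e1 e2).
Qed.

End random_tree_measure.

(** * Limits of Laplace functionals *)

(** A pointwise limit of Laplace functionals that is continuous under bounded
    pointwise convergence is a Laplace functional. The continuity replaces
    tightness: it excludes that mass or points escape in the limit. *)
Section Laplace_limit.
Context (R : realType) (E : ptopologicalType) (h : E -> R).
Hypothesis lusinE : lusin_space R E.
Hypothesis h_gt0 : forall x, 0 < h x.
Hypothesis h_cont : continuous h.
Variables (Q : nat -> {measure set (Mh h) -> \bar R}) (L : (E -> R) -> R).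
Hypothesis Q1 : forall n, Q n setT = 1%E.
Hypothesis L_cvg : forall f, Bh_pos h f ->
  \int[Q n]_nu expR (- pairing f nu) @[n --> \oo] --> L f.
Hypothesis L_cont : forall (M : R) (f_ : nat -> E -> R) f,
  (forall n, Bh_pos h (f_ n)) -> Bh_pos h f -> (forall n x, f_ n x <= M * h x) ->
  (forall x, f_ n x @[n --> \oo] --> f x) -> L (f_ n) @[n --> \oo] --> L f.

Section coded.
Variables (j : E -> nat -> bool) (tau : (nat -> bool) -> E).
Hypothesis mj : measurable_fun [set: Borel E] (j : Borel E -> binseq).
Hypothesis mtau : measurable_fun [set: binseq] (tau : binseq -> Borel E).
Hypothesis jK : cancel j tau.

Let h_ge0 x : 0 <= h x. Proof. exact: ltW. Qed.

(* Measures enter through the finite measures [h nu] transported to binary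
   sequences. *)
Let pull (g : (nat -> bool) -> R) (x : E) : R := h x * g (j x).

Let pull_Bh (g : binseq -> R) (C : R) : measurable_fun [set: binseq] g ->
  (forall y, 0 <= g y <= C) -> Bh_pos h (pull g).
Proof.
move=> mg gC; apply: (Bh_weightM h_gt0 h_cont (g := g \o j) (M := C)).
- exact: measurableT_comp.
- by move=> x; case/andP: (gC (j x)).
- by move=> x; case/andP: (gC (j x)).
Qed.

Let dec (k : nat) : seq bool * nat := odflt ([::], 0)%N (unpickle k).

Let coord (p : seq bool * nat) : E -> R := pull (step_fun R [:: p]).

Let mstep l : measurable_fun [set: binseq] (step_fun R l : binseq -> R).
Proof.
apply: measurable_sum => p; apply: measurable_funM => //.
by apply: measurable_indic; exact: measurable_cyl.
Qed.

Let step_bound l y : 0 <= step_fun R l y <= (size l)%:R.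
Proof.
rewrite /step_fun sumr_ge0/= => [|p _]; last by rewrite divr_ge0// indicE.
apply: (@le_trans _ _ (\sum_(p <- l) 1)); last by rewrite big_const_seq count_predT iter_addr_0.
apply: ler_sum => p _; rewrite ler_pdivrMr// mul1r indicE.
by apply: (@le_trans _ _ 1); [case: (_ \in _)|rewrite ler1n].
Qed.

Let pull_step l : Bh_pos h (pull (step_fun R l)).
Proof. by apply: pull_Bh => // y; exact: step_bound. Qed.

Let a (k : nat) (nu : Mh h) : R := expR (- pairing (coord (dec k)) nu).

Let prod_a (l : seq nat) nu :
  \prod_(k <- l) a k nu = expR (- pairing (pull (step_fun R (map dec l))) nu).
Proof.
elim: l => [|k l ih].
  rewrite big_nil (_ : pull _ = cst 0) ?pairing0 ?oppr0 ?expR0//.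
  by apply/funext => x; rewrite /pull /step_fun big_nil mulr0.
rewrite big_cons ih -expRD -opprD -(pairingD h_gt0 h_cont) ?[RHS]/=.
- congr (expR (- pairing _ nu)); apply/funext => x.
  by rewrite /coord /pull/= /step_fun big_seq1 big_cons mulrDr.
- exact: (pull_step [:: dec k]).1.
- exact: (pull_step _).1.
Qed.

Let limit_coords : exists rho : {measure set binseq -> \bar R}, rho setT = 1%E /\
  forall l, \int[rho]_y (\prod_(p <- l) coord_val R (pickle p) y) = L (pull (step_fun R l)).
Proof.
have [psi psiP] := lusin_tent_base lusinE.
have [|||rho [rho1 H]] := @limit_law _ (Mh h) R Q a Q1 _ _ (fun l => L (pull (step_fun R (map dec l)))).
- by move=> k; apply: measurableT_comp => //; apply: measurableT_comp => //;
    apply: (measurable_pairing h_gt0 h_cont psiP); exact: (pull_step [:: dec k]).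
- move=> k nu; rewrite expR_ge0/= -expR0 ler_expR oppr_le0; apply: pairing_ge0.
  by case: (pull_step [:: dec k]).
- move=> l; under eq_fun do under eq_Rintegral do rewrite prod_a.
  exact: L_cvg.
exists rho; split => // l.
have -> : l = map dec (map pickle l).
  by rewrite -map_comp -[LHS]map_id; apply: eq_map => p; rewrite /= /dec pickleK.
by rewrite -H; congr Rintegral; apply/funext => y; rewrite !big_map;
  apply: eq_bigr => p _; rewrite /dec pickleK.
Qed.

Lemma coded_Laplace_limit : exists pi : {measure set (Mh h) -> \bar R},
  pi setT = 1%E /\ forall f, Bh_pos h f -> \int[pi]_nu expR (- pairing f nu) = L f.
Proof.
have [psi psiP] := lusin_tent_base lusinE.
have [rho [rho1 rhoE]] := limit_coords.
pose A (r : seq bool) (N : nat) : binseq -> R := coord_val R (pickle (r, N)).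
have mA r N : measurable_fun [set: binseq] (A r N) by exact: measurable_coord_val.
have A01 r N u : 0 <= A r N u <= 1 by exact: coord_val01.
have A_law l : \int[rho]_u (\prod_(p <- l) A p.1 p.2 u) = L (pull (step_fun R l)).
  by rewrite -rhoE; apply: eq_Rintegral => u _; apply: eq_bigr => -[].
have Lam_cont (C : R) (g_ : nat -> binseq -> R) (g : binseq -> R) :
    (forall n, measurable_fun [set: binseq] (g_ n)) ->
    (forall n y, 0 <= g_ n y <= C) -> (forall y, g_ n y @[n --> \oo] --> g y) ->
    L (pull (g_ n)) @[n --> \oo] --> L (pull g).
  move=> mg_ gC cg; apply: (L_cont (M := C)).
  - by move=> n; exact: (pull_Bh (mg_ n) (gC n)).
  - apply: (pull_Bh (C := C)); first by apply: (@measurable_fun_cvg _ _ _ _ g_) => // y _; exact: cg.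
    move=> y; apply/andP; split.
      by apply: (cvgr_to_ge (cg y)); apply: nearW => n; case/andP: (gC n y).
    by apply: (cvgr_to_le (cg y)); apply: nearW => n; case/andP: (gC n y).
  - by move=> n x; rewrite /pull mulrC ler_wpM2r//; case/andP: (gC n (j x)).
  - by move=> x; apply: cvgM; [exact: cvg_cst|exact: cg].
pose m u := random_measure A u.
have mfin u : (m u setT < +oo)%E by exact: random_measure_fin.
have mm S : measurable S -> measurable_fun [set: binseq] (m ^~ S).
  exact: (measurable_random_measure mA A01).
have mE := @Laplace_random_measure _ binseq R rho rho1 A mA A01 (L \o pull) A_law Lam_cont.
have mhV : measurable_fun [set: Borel E] (fun x : Borel E => (h x)^-1).
  by apply: continuous_measurable_Borel => x; apply: cvgV; [rewrite gt_eqF|exact: h_cont].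
have hV0 x : 0 <= (h x)^-1 by rewrite invr_ge0.
pose dm u := density (image_measure (m u) mtau) mhV hV0.
have dmE u (f : E -> R) : measurable_fun [set: Borel E] (f : Borel E -> R) -> (forall x, 0 <= f x) ->
    (\int[dm u]_x (f x)%:E = \int[m u]_y (f (tau y) / h (tau y))%:E)%E.
  move=> mf f0; rewrite ge0_integral_density//; last exact/measurable_EFinP.
  rewrite ge0_integral_image//.
    apply/measurable_EFinP; exact: measurable_funM.
  by move=> x; rewrite -EFinM lee_fin mulr_ge0.
have Psi_fin u : (\int[dm u]_x (h x)%:E < +oo)%E.
  rewrite dmE//; last exact: measurable_h.
  under eq_integral do rewrite divff ?gt_eqF//.
  by rewrite integral_cst// mul1e.
pose Psi u : Mh h := Mh_of (Psi_fin u).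
have pE u f : Bh_pos h f -> pairing f (Psi u) = \int[m u]_y (f (tau y) / h (tau y)).
  by move=> [[mf _] f0]; rewrite Mh_ofE /Rintegral dmE.
have mq f : Bh_pos h f -> measurable_fun [set: binseq] (fun y : binseq => f (tau y) / h (tau y)).
  by move=> Bf; apply: (measurableT_comp (Bh_div h_gt0 h_cont Bf) mtau).
have mpE f : Bh_pos h f -> measurable_fun [set: binseq] (fun u => pairing f (Psi u)).
  move=> Bf; rewrite (_ : (fun u => _) = fun u => fine (\int[m u]_y (f (tau y) / h (tau y))%:E)).
    apply: measurableT_comp => //; apply: measurable_fun_integral_kernel => //.
      by move=> y; rewrite lee_fin divr_ge0//; case: Bf.
    by apply/measurable_EFinP; exact: mq.
  by apply/funext => u; rewrite pE.
have mPsi : measurable_fun [set: binseq] (Psi : binseq -> Mh h).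
  have [_ _ Wbase] := Mh_tent_base h_gt0 h_cont psiP.
  have mtent n : measurable_fun [set: binseq] (fun u => Mh_tents psi n (Psi u)).
    rewrite /Mh_tents; case: unpickle => [l|] //.
    elim: l => [|p l ih] //=; apply: measurable_minr => //; apply: measurable_maxr => //.
    apply: measurable_funB => //; apply: measurableT_comp => //.
    apply: measurable_funB => //; apply: measurableT_comp => //; apply: measurableT_comp => //.
    by apply: mpE; exact: Mh_coord_pos.
  apply: (@measurability _ _ binseq (Mh h) setT Psi (@open (Mh h))) => //.
  move=> _ [W oW <-]; rewrite setTI.
  rewrite (_ : _ @^-1` W = \bigcup_(n in [set n | [set nu | 0 < Mh_tents psi n nu] `<=` W])
      [set u | 0 < Mh_tents psi n (Psi u)]).
    apply: bigcup_measurable => n _.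
    rewrite (_ : [set u | _] = (fun u => 0 < Mh_tents psi n (Psi u)) @^-1` [set true])//.
    by rewrite -[X in measurable X]setTI; exact: measurable_fun_ltr.
  apply/seteqP; split => u; last by move=> [n /= nW nu]; exact: nW.
  by move=> Wu; have [n n0 nW] := Wbase _ _ oW Wu; exists n.
exists (image_measure rho mPsi); split; first by rewrite image_measureE preimage_setT.
move=> f Bf; have [M M0 fM] := Bh_bound h_gt0 Bf.1.
pose C := (Num.truncn M).+1.
have := mE (fun y => f (tau y) / h (tau y)) C (mq _ Bf).
have f0 := Bf.2.
move=> /(_ _)/wrap[y|H].
  rewrite divr_ge0//= ler_pdivrMr//; apply: le_trans (ler_norm _) _.
  apply: le_trans (fM _) _; rewrite ler_wpM2r//; apply: ltW; exact: Num.Theory.truncnS_gt.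
rewrite /Rintegral ge0_integral_image; last 2 first.
- apply/measurable_EFinP; apply: measurableT_comp => //; apply: measurableT_comp => //.
  exact: (measurable_pairing h_gt0 h_cont psiP).
- by move=> nu; rewrite lee_fin expR_ge0.
move: H; rewrite /Rintegral/= => H.
under eq_integral do rewrite pE// /Rintegral.
rewrite H; congr L; apply/funext => x.
by rewrite /pull jK mulrC divfK// gt_eqF.
Qed.

End coded.

(** The joint moments of the exponentials of the masses of cylinders, taken as
    coordinates, are values of the functionals; their limit law carries the random
    measure, which is brought back to [E] by the Borel left inverse of the coding. *)
Theorem Laplace_limit : exists pi : {measure set (Mh h) -> \bar R},
  pi setT = 1%E /\ forall f, Bh_pos h f -> \int[pi]_nu expR (- pairing f nu) = L f.
Proof.
have [j [tau [mj mtau jK]]] := lusin_retract lusinE.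
exact: (coded_Laplace_limit mj mtau jK).
Qed.

End Laplace_limit.

(** * Bounds on the branching mechanism *)

(** Singletons are closed because the embedding separates points. *)
Lemma lusin_measurable_set1 (R : realType) (E : ptopologicalType) (x : E) :
  lusin_space R E -> measurable ([set x] : set (Borel E)).
Proof.
move=> [K [i [_ i_inj i_open _]]].
rewrite -[[set x]]setCK; apply: measurableC; apply: sub_sigma_algebra.
apply/i_open; exists (~` [set i x]).
  by apply: closed_openC; apply: accessible_closed_set1; apply: hausdorff_accessible; exact: metric_hausdorff.
by apply/seteqP; split => y /=; [move=> h e; apply: h; rewrite e|move=> h e; apply: h; exact: i_inj].
Qed.

Section mechanism_bounds.
Context (R : realType) (E : ptopologicalType) (h : E -> R).
Hypothesis lusinE : lusin_space R E.
Hypothesis h_gt0 : forall x, 0 < h x.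
Hypothesis h_cont : continuous h.
Variables (b c : E -> R).
Variable eta : R.-sigmafker (Borel E) ~> (Borel E).
Variable H1 : R.-sigmafker (Borel E) ~> (Mh h).
Hypothesis A2 : assumption_A2 b c eta H1.

Let h_ge0 x : 0 <= h x. Proof. exact: ltW. Qed.
Let mh := measurable_h h_cont.
Let mpair f : Bh_pos h f -> measurable_fun [set: Mh h] (fun nu : Mh h => pairing f nu).
Proof.
by have [psi psiP] := lusin_tent_base lusinE; exact: (measurable_pairing h_gt0 h_cont psiP).
Qed.
Let mint (f : Borel E -> \bar R) :
  measurable_fun [set: Borel E] f -> (forall x, 0 <= f x)%E ->
  measurable_fun [set: Mh h] (fun nu : Mh h => \int[nu]_x f x)%E.
Proof.
by have [psi psiP] := lusin_tent_base lusinE; exact: (measurable_integral_Mh h_gt0 h_cont psiP).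
Qed.

Let mset1 (x : E) : measurable ([set x] : set (Borel E)).
Proof. exact: (lusin_measurable_set1 x lusinE). Qed.

Let Bh_pos_h := Bh_weight h_gt0 h_cont.

Lemma pairing_gt0 (nu : Mh h) : Mho h nu -> 0 < pairing h nu.
Proof.
move=> nu0; rewrite lt_neqAle pairing_ge0// andbT; apply: contra_notN nu0 => /eqP h0.
have h0E : (\int[nu]_x `|(h x)%:E| = 0)%E.
  rewrite (_ : (\int[_]_x _ = \int[nu]_x (h x)%:E)%E).
    by rewrite -(pairingE h_gt0 h_cont nu Bh_pos_h.1) -h0.
  by apply: eq_integral => x _; rewrite gee0_abs// lee_fin.
have : ae_eq nu setT (fun x : Borel E => (h x)%:E) (cst 0%E).
  by apply/(ae_eq_integral_abs _ measurableT) => //; exact/measurable_EFinP.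
move=> [N [mN N0 NT]]; apply: Mh_eq => A mA /=.
change (nu A = 0%E); apply/eqP; rewrite eq_le measure_ge0 andbT -N0; apply: le_measure; rewrite ?inE// => x _.
by apply: NT => /= /(_ Logic.I) [] hx; have := h_gt0 x; rewrite hx ltxx.
Qed.

Lemma measurable_Mho : measurable (Mho h : set (Mh h)).
Proof.
rewrite (_ : Mho h = (fun nu : Mh h => pairing h nu) @^-1` (~` [set 0])).
  by rewrite -[X in measurable X]setTI; apply: mpair => //; exact: measurableC.
apply/seteqP; split => nu; first by move=> /pairing_gt0 n0 /= e; move: n0; rewrite e ltxx.
by move=> n0 /= e; apply: n0; rewrite e pairing_zero.
Qed.

Section off_diagonal.
Variable x : E.

Let mC : measurable (~` [set x] : set (Borel E)). Proof. exact: measurableC. Qed.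

Lemma measurable_off f : measurable_fun [set: Borel E] f -> (forall y, 0 <= f y)%E ->
  measurable_fun [set: Mh h] (fun nu : Mh h => \int[nu]_(y in ~` [set x]) f y)%E.
Proof.
move=> mf f0; under eq_fun do rewrite integral_mkcond.
apply: mint; last by move=> y; exact: erestrict_ge0.
by apply/(measurable_restrictT _ mC); exact: measurable_funTS.
Qed.

(** Nonmeasurable sets cause no discrepancy, because points of [Mh h] vanish on
    them and singletons are measurable. *)
Lemma gamma_measure : exists2 G : {measure set (Borel E) -> \bar R}, gamma eta H1 x = G &
  forall f, measurable_fun [set: Borel E] f -> (forall y, 0 <= f y)%E ->
  (\int[G]_y f y = \int[eta x]_y f y +
    \int[H1 x]_(nu in Mho h) \int[nu]_(y in ~` [set x]) f y)%E.
Proof.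
pose off (nu : Mh h) : {measure set (Borel E) -> \bar R} := mrestr nu mC.
have moff A : measurable A -> measurable_fun [set: Mh h] (off ^~ A).
  move=> mA; have [psi psiP] := lusin_tent_base lusinE.
  by apply: (measurable_eval_Mh h_gt0 h_cont psiP); exact: measurableI.
exists (measure_add (eta x) (mixture (mrestr (H1 x) measurable_Mho) moff)) => [|f mf f0].
  apply/funext => A.
  rewrite -[RHS]/(measure_add (eta x) (mixture (mrestr (H1 x) measurable_Mho) moff) A).
  rewrite measure_addE mixtureE; congr (_ + _)%E.
  have [mA|nA] := pselect (measurable (A : set (Borel E))).
    by rewrite ge0_integral_mrestr//; exact: (moff _ mA).
  have nA' (nu : Mh h) : nu (A `\` [set x]) = 0%E.
    apply: Mh_nonmeasurable => mAx; apply: nA.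
    rewrite -(setDUK (@subIsetl _ A [set x])) setDIr setDv set0U.
    apply: measurableU => //; have [Ax|nAx] := pselect (A x).
      by rewrite (_ : A `&` _ = [set x])//; apply/seteqP; split => [y []//|y -> /=].
    by rewrite (_ : A `&` _ = set0)//; apply/seteqP; split => [y [Ay yx]|//]; apply: nAx; rewrite -yx.
  rewrite !integral0_eq// => nu _; rewrite ?nA'//.
  by rewrite -[LHS]/(nu (A `&` ~` [set x])) -setDE nA'.
have off_int (nu : Mh h) : (\int[off nu]_y f y = \int[nu]_(y in ~` [set x]) f y)%E.
  exact: ge0_integral_mrestr.
rewrite ge0_integral_measure_add// ge0_integral_mixture// ge0_integral_mrestr.
- apply: (f_equal (adde _)).
  apply: eq_integral => nu _.
  exact: off_int.
- exact: (measurable_fun_integral_kernel moff f0 mf).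
- by move=> nu; apply: integral_ge0.
Qed.

End off_diagonal.

Lemma mechanism_mass : exists C : R, 0 <= C /\ forall x,
  [/\ (\int[eta x]_y (h y)%:E <= (C * h x)%:E)%E,
      (\int[H1 x]_(nu in Mho h) ((Num.min (pairing h nu) (pairing h nu ^+ 2))%:E +
          \int[nu]_(y in ~` [set x]) (h y)%:E) <= (C * h x)%:E)%E
    & (\int[gamma eta H1 x]_y (h y)%:E <= (C * h x)%:E)%E].
Proof.
have [_ _ _ [C C0 H]] := A2; exists C; split; first exact: ltW.
have mh' : measurable_fun [set: Borel E] (fun y : Borel E => (h y)%:E) by exact/measurable_EFinP.
have h0' y : (0 <= (h y)%:E)%E by rewrite lee_fin.
have off0 x (nu : Mh h) : (0 <= \int[nu]_(y in ~` [set x]) (h y)%:E)%E by exact: integral_ge0.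
have min0 (nu : Mh h) : (0 <= (Num.min (pairing h nu) (pairing h nu ^+ 2))%:E)%E.
  by rewrite lee_fin le_min sqr_ge0 andbT pairing_ge0.
move=> x; have Hx := H x; split.
- by apply: le_trans Hx; rewrite leeDl//; apply: integral_ge0 => nu _; rewrite adde_ge0.
- by apply: le_trans Hx; rewrite leeDr//; exact: integral_ge0.
- have [G -> GE] := gamma_measure x; rewrite GE//; apply: le_trans Hx.
  by rewrite leeD2l//; apply: le_lower_integral => nu _ //; rewrite leeDr.
Qed.

Let bounds_bc : exists B : R, 0 <= B /\ forall x, `|b x| <= B /\ 0 <= c x * h x <= B.
Proof.
have [Bb [Bc c0] _ _] := A2.
have [B1 B10 H1'] := Bh_bound (fun=> ltr01) Bb; have [B2 B20 H2'] := Bh_bound (fun=> ltr01) Bc.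
exists (B1 + B2); split; first exact: addr_ge0.
move=> x; have := H1' x; have := H2' x; rewrite !mulr1 => k2 k1; split; first lra.
by rewrite c0/=; move: k2; rewrite ger0_norm//; lra.
Qed.

Let c_ge0 x : 0 <= c x.
Proof. by have [_ [_ c0] _ _] := A2; have := c0 x; rewrite pmulr_lge0. Qed.

(* The part of the integral away from [x]; [jump] differs from the compensated
   exponential by exactly this part. *)
Let off (x : E) (v : E -> R) (nu : Mh h) : R := fine (\int[nu]_(y in ~` [set x]) (v y)%:E)%E.

Let off_ge0 x v nu : (forall y, 0 <= v y) -> 0 <= off x v nu.
Proof. by move=> v0; apply/fine_ge0/integral_ge0 => y _; rewrite lee_fin. Qed.

Let offE x v nu : Bh_pos h v -> (off x v nu)%:E = (\int[nu]_(y in ~` [set x]) (v y)%:E)%E.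
Proof.
move=> [Bv v0]; rewrite /off fineK// ge0_fin_numE; last by apply: integral_ge0 => y _; rewrite lee_fin.
apply: (@le_lt_trans _ _ (\int[nu]_y (v y)%:E)%E); last by rewrite -(pairingE h_gt0 h_cont)// ltry.
apply: ge0_subset_integral => //; first exact: measurableC.
- by apply/measurable_EFinP; exact: Bh_measurable Bv.
- by move=> y _; rewrite lee_fin.
Qed.

Let pairing_split x v (nu : Mh h) : Bh_pos h v -> pairing v nu = v x * fine (nu [set x]) + off x v nu.
Proof.
move=> Bv; have [[mv _] v0] := Bv.
have mEv : measurable_fun [set: Borel E] (fun y : Borel E => (v y)%:E) by exact/measurable_EFinP.
have split_int w : measurable_fun [set: Borel E] (fun y : Borel E => (w y)%:E) -> (forall y, 0 <= w y) ->
    (\int[nu]_y (w y)%:E = (w x)%:E * nu [set x] + \int[nu]_(y in ~` [set x]) (w y)%:E)%E.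
  move=> mw w0; rewrite -(setUv [set x]) ge0_integral_setU//.
  - congr (_ + _)%E; rewrite -integral_cst//.
    by apply: eq_integral => y; rewrite inE => ->.
  - exact: measurableC.
  - by rewrite setUv.
  - by move=> y _; rewrite lee_fin.
  - by rewrite disj_set2E setICr.
have fx : nu [set x] \is a fin_num.
  rewrite ge0_fin_numE//; have := @Mh_finite _ _ _ nu; rewrite split_int//; last exact/measurable_EFinP.
  move=> H; have {H} : ((h x)%:E * nu [set x] < +oo)%E.
    by apply: le_lt_trans H; rewrite leeDl//; apply: integral_ge0 => y _; rewrite lee_fin.
  by case: (nu [set x]) (measure_ge0 nu [set x]) => // [r _|_]; rewrite ?ltry// gt0_muley// lte_fin.
apply: EFin_inj; rewrite (pairingE h_gt0 h_cont nu Bv.1) split_int//.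
by rewrite EFinD EFinM fineK// offE.
Qed.

Let jump (x : E) (v : E -> R) (nu : Mh h) : R :=
  expR (- pairing v nu) - 1 + v x * fine (nu [set x]).

Let jump_ge x v nu : Bh_pos h v -> - off x v nu <= jump x v nu.
Proof.
move=> Bv; have := pairing_split x nu Bv; have := expR_ge1Dx (- pairing v nu).
by rewrite /jump; lra.
Qed.

(* The elementary bound behind the moment condition on [H1]. *)
Let expR_quadratic (a : R) : 0 <= a -> expR (- a) - 1 + a <= Num.min a (a ^+ 2).
Proof.
move=> a0; rewrite le_min; apply/andP; split.
  have : expR (- a) <= 1 by rewrite -expR0 ler_expR oppr_le0.
  by lra.
have h1 := expR_ge1Dx a; have h2 : expR (- a) * expR a = 1 by rewrite -expRD addNr expR0.
have h3 := expR_gt0 (- a); nra.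
Qed.

Let dom (x : E) (nu : Mh h) : R := Num.min (pairing h nu) (pairing h nu ^+ 2) + off x h nu.

Let off_le x v nu (M : R) : 0 <= M -> Bh_pos h v -> (forall y, v y <= M * h y) ->
  off x v nu <= M * off x h nu.
Proof.
move=> M0 Bv vM; have v0 := Bv.2.
rewrite -lee_fin EFinM !offE// -ge0_integralZl//.
- by apply: le_lower_integral => y _; rewrite -?EFinM lee_fin.
- exact: measurableC.
- by apply/measurable_EFinP; exact: measurable_funTS.
- by move=> y _; rewrite lee_fin.
Qed.

Let jump_norm x v nu (M : R) : 0 <= M -> Bh_pos h v -> (forall y, v y <= M * h y) ->
  `|jump x v nu| <= (M + M ^+ 2) * dom x nu.
Proof.
move=> M0 Bv vM; have [Bv' v0] := Bv.
have p0 : 0 <= pairing v nu by exact: pairing_ge0.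
have z0 : 0 <= pairing h nu by exact: pairing_ge0.
have pM : pairing v nu <= M * pairing h nu.
  rewrite -(pairingZ h_gt0 h_cont nu M Bh_pos_h.1); apply: le_pairing => //.
  by apply: BhZ => //; case: Bh_pos_h.
have oM : off x v nu <= M * off x h nu by exact: off_le.
have q1 := jump_ge x nu Bv; have o0 := off_ge0 x nu h_ge0.
have m0 : 0 <= Num.min (pairing h nu) (pairing h nu ^+ 2) by rewrite le_min z0 sqr_ge0.
have q2 : jump x v nu <= (M + M ^+ 2) * Num.min (pairing h nu) (pairing h nu ^+ 2).
  have := expR_quadratic p0; have := pairing_split x nu Bv; have := off_ge0 x nu v0.
  rewrite le_min /jump => k1 k2 /andP[k3 k4].
  have M2 : 0 <= M ^+ 2 by exact: sqr_ge0.
  case: (leP (pairing h nu) (pairing h nu ^+ 2)) => zz; first nra.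
  have : pairing v nu ^+ 2 <= M ^+ 2 * pairing h nu ^+ 2.
    by rewrite -exprMn ler_sqr// nnegrE ?mulr_ge0.
  have := sqr_ge0 (pairing h nu); nra.
have M2 : 0 <= M ^+ 2 by exact: sqr_ge0.
rewrite /dom ler_norml; apply/andP; split; nra.
Qed.

Let dom_int x C : (\int[H1 x]_(nu in Mho h) ((Num.min (pairing h nu) (pairing h nu ^+ 2))%:E +
    \int[nu]_(y in ~` [set x]) (h y)%:E) <= (C * h x)%:E)%E ->
  forall M : R, 0 <= M ->
  (\int[H1 x]_(nu in Mho h) ((M * dom x nu)%:E) <= (M * (C * h x))%:E)%E.
Proof.
move=> H M M0; rewrite EFinM; apply: le_trans (lee_wpmul2l _ H); last by rewrite lee_fin.
rewrite le_eqVlt; apply/orP; left; apply/eqP.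
under eq_integral do rewrite EFinM /dom EFinD offE//.
rewrite ge0_integralZl//.
- exact: measurable_Mho.
- apply: emeasurable_funD.
    apply/measurable_EFinP; apply: measurable_minr; first by apply: measurable_funTS; exact: mpair.
    by apply: measurable_funX; apply: measurable_funTS; exact: mpair.
  apply: measurable_funTS; apply: measurable_off; last by move=> y; rewrite lee_fin.
  exact/measurable_EFinP.
- move=> nu _; apply: adde_ge0; last by apply: integral_ge0 => y _; rewrite lee_fin.
  by rewrite lee_fin le_min sqr_ge0 pairing_ge0.
Qed.

(** For a jump of mass [z], the compensated exponential is at most a multiple of
    [min z z^2] and the part away from [x] at most a multiple of that of [h]; both
    are integrable with respect to [H1 x]. *)
Lemma phi_bound (M : R) : 0 <= M -> exists K : R, 0 <= K /\ forall v, Bh_pos h v ->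
  (forall y, v y <= M * h y) -> forall x, `|phi b c eta H1 x v| <= K * h x.
Proof.
move=> M0; have [B [B0 HB]] := bounds_bc; have [C [C0 HC]] := mechanism_mass.
exists (M ^+ 2 * B + B * M + M * C + (M + M ^+ 2) * C).
split; first by rewrite !addr_ge0 ?mulr_ge0 ?addr_ge0 ?sqr_ge0.
move=> v Bv vM x; have [Bv' v0] := Bv; have [Heta Hdom _] := HC x.
have [bB /andP[ch0 chB]] := HB x; have hx := h_ge0 x; have vx0 := v0 x; have vxM := vM x.
have [m [etaE mC]] := Mh_represents h_gt0 h_cont Heta.
have etaM : 0 <= \int[eta x]_y v y <= M * (C * h x).
  rewrite etaE pairing_ge0//=; apply: le_trans (ler_wpM2l M0 mC).
  exact: pairing_leM.
have M2 : 0 <= M + M ^+ 2 by rewrite addr_ge0// sqr_ge0.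
have jumpM : `|\int[H1 x]_(nu in Mho h) jump x v nu| <= (M + M ^+ 2) * (C * h x).
  apply: Rintegral_le_norm (dom_int Hdom M2) => nu _.
  exact: jump_norm.
have cM : 0 <= c x * v x ^+ 2 <= M ^+ 2 * (B * h x).
  rewrite mulr_ge0 ?sqr_ge0//=; apply: (@le_trans _ _ (c x * (M * h x) ^+ 2)).
    by apply: ler_wpM2l => //; rewrite ler_sqr// nnegrE ?mulr_ge0.
  rewrite exprMn mulrCA; apply: ler_wpM2l; first exact: sqr_ge0.
  by rewrite expr2 mulrA; exact: ler_wpM2r.
have bM : `|b x * v x| <= B * (M * h x).
  by rewrite normrM (ger0_norm vx0); apply: ler_pM.
rewrite /phi -/(jump x v); move: jumpM bM etaM cM; rewrite !ler_norml /jump.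
by move=> /andP[? ?] /andP[? ?] /andP[? ?] /andP[? ?]; apply/andP; split; lra.
Qed.

(** The Laplace exponent lies above its linearization, because
    [exp (- a) - 1 >= - a] and the quadratic term is nonnegative. *)
Lemma phi_ge v x : Bh_pos h v -> - phi b c eta H1 x v <= Gamma eta H1 v x - b x * v x.
Proof.
move=> Bv; have [Bv' v0] := Bv; have [C [C0 HC]] := mechanism_mass.
have [Heta Hdom Hgamma] := HC x; have [M M0 vM'] := Bh_bound h_gt0 Bv'.
have vM y : v y <= M * h y by apply: le_trans (vM' y); exact: ler_norm.
have mEv : measurable_fun [set: Borel E] (fun y : Borel E => (v y)%:E) by apply/measurable_EFinP; exact: Bh_measurable Bv'.
have Ev0 y : (0 <= (v y)%:E)%E by rewrite lee_fin.
have M2 : 0 <= M + M ^+ 2 by rewrite addr_ge0// sqr_ge0.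
have domfin : (\int[H1 x]_(nu in Mho h) (((M + M ^+ 2) * dom x nu)%:E) < +oo)%E.
  exact: le_lt_trans (dom_int Hdom M2) (ltry _).
have Joff nu : `|off x v nu| <= (M + M ^+ 2) * dom x nu.
  rewrite ger0_norm ?off_ge0//.
  have oM : off x v nu <= M * off x h nu by exact: off_le.
  have : 0 <= Num.min (pairing h nu) (pairing h nu ^+ 2) by rewrite le_min sqr_ge0 andbT pairing_ge0.
  by have := off_ge0 x nu h_ge0; have := sqr_ge0 M; rewrite /dom; nra.
have GE : Gamma eta H1 v x = \int[eta x]_y v y + \int[H1 x]_(nu in Mho h) off x v nu.
  have [G GE GE'] := gamma_measure x; rewrite /Gamma GE GE'// fineD.
  - by congr (_ + fine _); apply: eq_integral => nu _; rewrite offE.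
  - rewrite ge0_fin_numE; last by apply: integral_ge0 => y _.
    apply: (@le_lt_trans _ _ (\int[eta x]_y (M%:E * (h y)%:E))%E).
      by apply: le_lower_integral => // y _; rewrite -EFinM lee_fin.
    rewrite ge0_integralZl//; last 2 first.
    - exact/measurable_EFinP.
    - by move=> y _; rewrite lee_fin.
    apply: lte_mul_pinfty; rewrite ?lee_fin//.
    by apply: le_lt_trans Heta (ltry _).
  - rewrite ge0_fin_numE; last by apply: integral_ge0 => nu _; exact: integral_ge0.
    apply: le_lt_trans domfin; apply: le_lower_integral => nu _; first exact: integral_ge0.
    by rewrite -offE// lee_fin; apply: le_trans (Joff nu); exact: ler_norm.
have : - (\int[H1 x]_(nu in Mho h) off x v nu) <= \int[H1 x]_(nu in Mho h) jump x v nu.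
  rewrite -(Rintegral_opp _ domfin) => [|nu _]; last exact: Joff.
  apply: (Rintegral_le measurable_Mho _ _ domfin) => nu _; last exact: jump_ge.
  - by rewrite normrN; exact: Joff.
  - exact: jump_norm.
have : 0 <= c x * v x ^+ 2 by rewrite mulr_ge0// sqr_ge0.
by rewrite GE /phi -/(jump x v) /jump; lra.
Qed.

Lemma Gamma_bound : exists C : R, 0 <= C /\ forall x,
  (forall u (M : R), 0 <= M -> Bh_pos h u -> (forall y, u y <= M * h y) ->
     0 <= Gamma eta H1 u x <= M * (C * h x)) /\
  (forall u v (a : R), 0 <= a -> Bh_pos h u -> Bh_pos h v -> (forall y, v y <= u y + a * h y) ->
     Gamma eta H1 v x <= Gamma eta H1 u x + a * (C * h x)).
Proof.
have [C [C0 HC]] := mechanism_mass; exists C; split => // x.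
have [G GE _] := gamma_measure x; have [_ _] := HC x; rewrite GE => HG.
have [m [mE mC]] := Mh_represents h_gt0 h_cont HG.
have GammaE u : Gamma eta H1 u x = pairing u m by rewrite -mE /Gamma GE.
split=> [u M M0 [Bu u0] uM|u v a a0 [Bu u0] [Bv v0] vu]; rewrite !GammaE.
  by rewrite pairing_ge0//=; apply: le_trans (ler_wpM2l M0 mC); exact: pairing_leM.
apply: le_trans (lerD (lexx _) (ler_wpM2l a0 mC)).
have Bah : Bh h (fun y => a * h y) by apply: BhZ => //; exact: Bh_pos_h.1.
rewrite -(pairingZ h_gt0 h_cont _ a Bh_pos_h.1) -(pairingD h_gt0 h_cont)//.
by apply: le_pairing => //; exact: BhD.
Qed.

End mechanism_bounds.

(** * Elementary estimates *)

Section truncated_geometric.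
Context (R : realType).
Variables (q a : R).
Hypothesis q0 : 0 < q.
Hypothesis q1 : q < 1.
Hypothesis a0 : 0 <= a.

Lemma geometric_sum_le N : \sum_(k < N) q ^+ k <= (1 - q)^-1.
Proof.
have d0 : 0 < 1 - q by rewrite subr_gt0.
rewrite -[leRHS]div1r ler_pdivlMr// mulrC -opprB mulNr -subrX1 opprB.
by rewrite gerBl exprn_ge0// ltW.
Qed.

Lemma truncated_sum_small z N : 0 <= z -> \sum_(n < N) Num.min 1 (a * q ^+ n * z) <= a * (1 - q)^-1 * z.
Proof.
move=> z0; apply: (@le_trans _ _ (\sum_(n < N) a * q ^+ n * z)).
  by apply: ler_sum => n _; rewrite ge_min lexx orbT.
rewrite -mulr_suml -mulr_sumr; apply: ler_wpM2r => //; apply: ler_wpM2l => //.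
exact: geometric_sum_le.
Qed.

Lemma truncated_sum_large z N m : 0 <= z -> z * q ^+ m <= 1 ->
  \sum_(n < N) Num.min 1 (a * q ^+ n * z) <= m%:R + a * (1 - q)^-1.
Proof.
move=> z0 zm; apply: (@le_trans _ _ ((minn N m)%:R + a * \sum_(k < N - m) q ^+ k)); last first.
  by apply: lerD; [rewrite ler_nat geq_minr|apply: ler_wpM2l => //; exact: geometric_sum_le].
elim: N => [|N ih]; first by rewrite big_ord0 min0n sub0n big_ord0 mulr0 addr0.
rewrite big_ord_recr/=; case: (ltnP N m) => Nm.
  move: ih; rewrite (minn_idPl (ltnW Nm)) (minn_idPl Nm) (eqP (ltnW Nm)) (eqP Nm) !big_ord0.
  rewrite mulr0 !addr0 -natr1 => ih; apply: lerD => //.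
  by rewrite ge_min lexx.
move: ih; rewrite (minn_idPr Nm) (minn_idPr (leq_trans Nm (leqnSn N))) subSn// big_ord_recr/=.
rewrite mulrDr addrA => ih; apply: lerD => //; rewrite ge_min; apply/orP; right.
rewrite -mulrA; apply: ler_wpM2l => //; rewrite -{1}(subnK Nm) exprD -mulrA.
by apply: ler_piMr; [rewrite exprn_ge0// ltW|rewrite mulrC].
Qed.

End truncated_geometric.

(** About [ln z / delta] terms are of order one before the geometric decay takes
    over: this is where the logarithmic moment comes from. *)
Lemma truncated_geometric_sum (R : realType) (a delta : R) : 0 <= a -> 0 < delta ->
  exists K : R, 0 <= K /\ forall (z : R) N, 0 <= z ->
  \sum_(n < N) Num.min 1 (a * expR (- delta) ^+ n * z) <=
  K * Num.min 1 z + delta^-1 * (if 1 < z then ln z else 0).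
Proof.
move=> a0 d0; pose q := expR (- delta); have q0 : 0 < q by exact: expR_gt0.
have q1 : q < 1 by rewrite -expR0 ltr_expR oppr_lt0.
have iq : 0 <= (1 - q)^-1 by rewrite invr_ge0 subr_ge0 ltW.
exists (a * (1 - q)^-1 + 1); split; first by rewrite addr_ge0// mulr_ge0.
move=> z N z0; case: (ltP 1 z) => z1; last first.
  rewrite mulr0 addr0; apply: le_trans (truncated_sum_small q0 q1 a0 N z0) _.
  by apply: ler_wpM2r => //; rewrite lerDl.
have ln0 : 0 <= ln z by rewrite ln_ge0// ltW.
have zd0 : 0 <= ln z / delta by rewrite divr_ge0// ltW.
pose m := (Num.truncn (ln z / delta)).+1.
have mz : ln z / delta <= m%:R by apply: ltW; exact: truncnS_gt.
have mz' : m%:R <= ln z / delta + 1.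
  by rewrite -natr1 lerD2r; have /andP[] := truncn_itv zd0.
apply: le_trans (truncated_sum_large q0 q1 a0 N (m := m) z0 _) _.
  rewrite -(lnK (lt_le_trans ltr01 (ltW z1))) -expRM_natl -expRD -[leRHS]expR0 ler_expR.
  by rewrite mulrN subr_le0 -ler_pdivrMr.
by rewrite mulr1 [delta^-1 * _]mulrC; lra.
Qed.

Lemma expR_lipschitz (R : realType) (a b : R) : 0 <= a -> 0 <= b -> `|expR (- a) - expR (- b)| <= `|a - b|.
Proof.
wlog ab : a b / a <= b => [H a0 b0|a0 b0].
  have [ab|/ltW ba] := leP a b; first exact: H.
  by rewrite distrC [leRHS]distrC; exact: H.
rewrite ger0_norm ?subr_ge0 ?ler_expR ?lerN2// [leRHS]distrC [leRHS]ger0_norm ?subr_ge0//.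
have h1 := expR_ge1Dx (- (b - a)).
have h2 : expR (- b) = expR (- a) * expR (- (b - a)) by rewrite -expRD; congr expR; ring.
have h3 : expR (- a) <= 1 by rewrite -expR0 ler_expR oppr_le0.
by have := expR_gt0 (- a); rewrite h2; nra.
Qed.

(** * Comparison of the cumulant semigroup with the first-moment semigroup *)

(* Linear arithmetic of the short-time estimate, with all the products named. *)
Lemma closeness_arith (R : realDomainType) (u v q a b s k d : R) :
  - (a * (d * k) * s) <= u - q -> u - q <= a * (d * k) * s ->
  - (b * (d * k) * s) <= v - q -> v - q <= b * (d * k) * s ->
  - (d * (b + a) * s * k) <= v - u <= d * (b + a) * s * k.
Proof. by move=> *; apply/andP; split; lra. Qed.

Lemma drift_arith (R : realDomainType) (f g g' b u v k l s e G B : R) :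
  g' <= g + k * s * (G * l) -> b * (u - v) <= B * (k * s * l) -> - f <= g' - b * v ->
  G * (k * s * l) <= G * (k * e * l) -> B * (k * s * l) <= B * (k * e * l) ->
  - (g - b * u) <= f + k * (G + B) * e * l.
Proof. by move=> *; lra. Qed.

Lemma drift_bound_arith (R : realDomainType) (g b u k N G B : R) :
  0 <= g -> g <= N * (G * k) -> 0 <= u -> u <= N * k -> - B <= b -> b <= B -> 0 <= B ->
  `|g - b * u| <= N * (G + B) * k.
Proof. by move=> *; rewrite ler_norml; apply/andP; split; nra. Qed.

Lemma short_time_arith (R : realDomainType) (v u q k d e l : R) :
  - (u - q) <= q - v + 2 * (2 * (k * e * (d * l)) * e) -> v <= u + 4 * (k * d) * e ^+ 2 * l.
Proof. by move=> *; lra. Qed.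

Section superprocess_limit.
Context (R : realType) (E : ptopologicalType) (h : E -> R).
Hypothesis lusinE : lusin_space R E.
Hypothesis h_gt0 : forall x, 0 < h x.
Hypothesis h_cont : continuous h.
Variable p : R -> R.-pker (Borel E) ~> (Borel E).
Variables (b c : E -> R).
Variable eta : R.-sigmafker (Borel E) ~> (Borel E).
Variable H1 : R.-sigmafker (Borel E) ~> (Mh h).
Variable beta : Mh h.
Variable H2 : {measure set (Mh h) -> \bar R}.
Variable V : R -> (E -> R) -> E -> R.
Variable P : R -> R.-pker (Mh h) ~> (Mh h).
Variable r : R -> R.-ker (Borel E) ~> (Borel E).
Hypothesis A1 : assumption_A1 (h := h) p.
Hypothesis A2 : assumption_A2 b c eta H1.
Hypothesis V_cumulant : cumulant_semigroup p b c eta H1 V.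
Hypothesis P_superprocess : superprocess_kernel beta H2 V P.
Hypothesis r_first_moment : first_moment_semigroup p b eta H1 r.
Hypothesis P_subcritical : subcritical (h := h) r.

Let h_ge0 x : 0 <= h x. Proof. exact: ltW. Qed.
Let mh := measurable_h h_cont.
Let mEh : measurable_fun [set: Borel E] (fun y : Borel E => (h y)%:E).
Proof. exact/measurable_EFinP. Qed.
Let Eh_ge0 y : (0 <= (h y)%:E)%E. Proof. by rewrite lee_fin. Qed.
Let mpair f : Bh_pos h f -> measurable_fun [set: Mh h] (fun nu : Mh h => pairing f nu).
Proof.
by have [psi psiP] := lusin_tent_base lusinE; exact: (measurable_pairing h_gt0 h_cont psiP).
Qed.

Let VB (t : R) f : 0 <= t -> Bh_pos h f -> Bh_pos h (V t f).
Proof. by move=> t0 /V_cumulant[_ H _ _]; exact: H. Qed.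

Definition immigration (t : R) (f : E -> R) : R := \int[lebesgue_measure]_(s in `[0, t]) psi beta H2 (V s f).

Lemma measurable_Laplace f : Bh_pos h f ->
  measurable_fun [set: Mh h] (fun nu : Mh h => expR (- pairing f nu)).
Proof. by move=> Bf; apply: measurableT_comp => //; apply: measurableT_comp => //; exact: mpair. Qed.

Lemma Laplace01 f (nu : Mh h) : Bh_pos h f -> 0 <= expR (- pairing f nu) <= 1.
Proof. by move=> [_ f0]; rewrite expR_ge0/= -expR0 ler_expR oppr_le0 pairing_ge0. Qed.

Lemma integrable_Laplace (Q : {measure set (Mh h) -> \bar R}) f : Q setT = 1%E -> Bh_pos h f ->
  Q.-integrable setT (fun nu : Mh h => (expR (- pairing f nu))%:E).
Proof.
move=> Q1 Bf; apply: (integrable_bounded (M := 1)) => //; first by rewrite Q1 ltry.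
  exact: measurable_Laplace.
by move=> nu; have /andP[? ?] := Laplace01 nu Bf; rewrite ger0_norm.
Qed.

Let LaplaceE (t : R) (mu : Mh h) f : 0 <= t -> Bh_pos h f ->
  (\int[P t mu]_nu (expR (- pairing f nu))%:E = (expR (- (pairing (V t f) mu + immigration t f)))%:E)%E.
Proof.
move=> t0 Bf; rewrite opprD -(superprocess_laplace P_superprocess)// /Rintegral fineK//.
by apply: integrable_fin_num => //; apply: integrable_Laplace => //; exact: prob_kernel.
Qed.

(* Chapman-Kolmogorov for the transition kernels, read on Laplace functionals;
   the zero measure isolates the immigration part. *)
Let flow_immigration (s t : R) (mu : Mh h) f : 0 <= s -> 0 <= t -> Bh_pos h f ->
  pairing (V (s + t) f) mu + immigration (s + t) f =
  pairing (V s (V t f)) mu + immigration s (V t f) + immigration t f.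
Proof.
move=> s0 t0 Bf; have st0 : 0 <= s + t by exact: addr_ge0.
have mPt A : measurable A -> measurable_fun [set: Mh h] (fun nu : Mh h => P t nu A).
  exact: measurable_kernel.
have PtE : (\int[P (s + t) mu]_nu (expR (- pairing f nu))%:E = (expR (- (pairing (V s (V t f)) mu +
    immigration s (V t f))) * expR (- immigration t f))%:E)%E.
  transitivity (\int[mixture (P s mu) mPt]_nu (expR (- pairing f nu))%:E)%E.
    apply: eq_measure_integral => A mA _.
    by rewrite (superprocess_chapman_kolmogorov P_superprocess).
  rewrite ge0_integral_mixture; last 2 first.
  - by apply/measurable_EFinP; exact: measurable_Laplace.
  - by move=> nu; rewrite lee_fin expR_ge0.
  under eq_integral do rewrite LaplaceE// opprD expRD EFinM.
  rewrite ge0_integralZr//; first by rewrite (LaplaceE mu s0 (VB t0 Bf)).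
  by apply/measurable_EFinP; apply: measurable_Laplace; exact: VB.
move: (etrans (esym (LaplaceE mu st0 Bf)) PtE); rewrite -expRD -opprD => -[/expR_inj/oppr_inj].
exact.
Qed.

Lemma immigrationD (s t : R) f : 0 <= s -> 0 <= t -> Bh_pos h f ->
  immigration (s + t) f = immigration s (V t f) + immigration t f.
Proof.
move=> s0 t0 Bf; move: (flow_immigration (Mh_zero h) s0 t0 Bf).
rewrite (pairing_zero h (V (s + t) f)) (pairing_zero h (V s (V t f))).
by move: (immigration (s + t) f) (immigration s (V t f)) (immigration t f) => i j k; lra.
Qed.

(** The semigroup property comes from the transition kernels, tested on Dirac
    masses, rather than from uniqueness for the integral equation. *)
Lemma cumulant_flow (s t : R) f : 0 <= s -> 0 <= t -> Bh_pos h f -> V (s + t) f = V s (V t f).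
Proof.
move=> s0 t0 Bf; apply/funext => x.
have [|m [mE _]] := @Mh_represents _ _ _ h_gt0 h_cont (@dirac _ (Borel E) x R) (h x).
  by rewrite integral_dirac// diracT mul1e.
have dE g : Bh_pos h g -> pairing g m = g x.
  move=> [[mg _] _]; rewrite -mE /Rintegral integral_dirac//; last exact/measurable_EFinP.
  by rewrite diracT mul1e.
have := flow_immigration m s0 t0 Bf; rewrite immigrationD// !dE//.
- by rewrite addrA => /addIr/addIr.
- by do 2 apply: VB => //.
- by apply: VB => //; exact: addr_ge0.
Qed.

(** [h] is excessive up to the factor [exp (alpha t)]. *)
Lemma motion_mass : exists D : R, 0 <= D /\ forall t x, 0 <= t -> t <= 1 ->
  (\int[p t x]_y (h y)%:E <= (D * h x)%:E)%E.
Proof.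
have [brs [alpha a0 H]] := A1; exists (expR alpha); split; first exact: expR_ge0.
move=> t x t0 t1; move: t0; rewrite le_eqVlt => /orP[/eqP <-|t0].
  rewrite (_ : (\int[p 0 x]_y _ = \int[@dirac _ (Borel E) x R]_y (h y)%:E)%E).
    rewrite integral_dirac// diracT mul1e lee_fin ler_peMl//.
    by rewrite -expR0 ler_expR.
  by apply: eq_measure_integral => A mA _; rewrite (brs_normal brs).
have [mono lim] := H x.
have le_h : ((expR (- (alpha * t)))%:E * \int[p t x]_y (h y)%:E <= (h x)%:E)%E.
  apply: (cvge_to_ge lim); near=> s; apply: mono; near: s; first exact: nbhs_right_gt.
  exact: nbhs_right_le.
have -> : (\int[p t x]_y (h y)%:E =
    (expR (alpha * t))%:E * ((expR (- (alpha * t)))%:E * \int[p t x]_y (h y)%:E))%E.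
  by rewrite muleA -EFinM -expRD subrr expR0 mul1e.
apply: (@le_trans _ _ ((expR (alpha * t))%:E * (h x)%:E)%E).
  by apply: lee_wpmul2l le_h; rewrite lee_fin expR_ge0.
by rewrite -EFinM lee_fin; apply: ler_wpM2r => //; rewrite ler_expR ler_piMr.
Unshelve. all: by end_near. Qed.

Let integral_itv_cst (K t : R) : 0 <= t ->
  (\int[lebesgue_measure]_(s in `[0%R, t]) K%:E = (K * t)%:E)%E.
Proof.
move=> t0; rewrite integral_cst//; rewrite [X in (_ * X)%E](_ : _ = t%:E) ?EFinM//.
rewrite [LHS]lebesgue_measure_itv/= lte_fin; case: ltP => [_|t0']; first by rewrite oppr0 adde0.
by congr EFin; apply/eqP; rewrite eq_le t0.
Qed.

Let itv_bound (F : R -> R) (K t : R) : 0 <= t ->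
  (forall s, 0 <= s -> s <= t -> `|F s| <= K) ->
  `|\int[lebesgue_measure]_(s in `[0, t]) F s| <= K * t.
Proof.
move=> t0 FK; apply: (@Rintegral_le_norm _ _ _ _ _ _ (cst K)).
  by move=> s /=; rewrite in_itv/= => /andP[]; exact: FK.
by rewrite integral_itv_cst.
Qed.

Lemma first_moment_Bh_pos (C delta : R) :
  (forall t x, 0 <= t -> (\int[r t x]_y (h y)%:E <= (C * h x * expR (- (delta * t)))%:E)%E) ->
  forall f (M : R), 0 <= M -> Bh_pos h f -> (forall y, f y <= M * h y) ->
  forall t : R, 0 <= t -> Bh_pos h (kernel_op r t f) /\
    forall x, kernel_op r t f x <= M * (C * h x * expR (- (delta * t))).
Proof.
move=> rC f M M0 [Bf f0] fM t t0.
have ub x : kernel_op r t f x <= M * (C * h x * expR (- (delta * t))).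
  have [m [mE mC]] := Mh_represents h_gt0 h_cont (rC t x t0).
  by rewrite /kernel_op mE; apply: le_trans (ler_wpM2l M0 mC); exact: pairing_leM.
have u0 x : 0 <= kernel_op r t f x by exact: Rintegral_ge0.
split=> //; split=> //.
apply: (Bh_intro h_gt0 (M := M * (C * expR (- (delta * t))))).
  apply: measurableT_comp => //; apply: measurable_fun_integral_kernel.
  - by move=> U mU; exact: measurable_kernel.
  - by move=> y; rewrite lee_fin.
  - by apply/measurable_EFinP; exact: Bh_measurable Bf.
by move=> x; rewrite ger0_norm//; apply: le_trans (ub x) _; rewrite -!mulrA (mulrC (h x)).
Qed.

(** Both semigroups stay within [O(s)] of the semigroup of the motion. Inserting
    this into the two equations and bounding [- phi] by its linearization
    [phi_ge], the integrands differ by [O(s)] up to a nonpositive term, hence the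
    integrals over [0, e] by [O(e ^+ 2)]. The comparison is one of lower
    integrals, as the integrands need not be measurable in time. *)
Lemma cumulant_short_time (M : R) : 0 <= M -> exists K : R, 0 <= K /\ forall f, Bh_pos h f ->
  (forall y, f y <= M * h y) ->
  (forall s y, 0 <= s -> s <= 1 -> V s f y <= M * h y) ->
  forall e x, 0 <= e -> e <= 1 -> V e f x <= kernel_op r e f x + K * e ^+ 2 * h x.
Proof.
move=> M0; have [D [D0 pD]] := motion_mass; have [C [delta [C0' delta0 rC]]] := P_subcritical.
have C0 := ltW C0'.
have [Kphi [Kphi0 HKphi]] := phi_bound lusinE h_gt0 h_cont A2 M0.
have [G [G0 HG]] := Gamma_bound lusinE h_gt0 h_cont A2.
have [Bb _ _ _] := A2; have [B B0 bB'] := Bh_bound (fun=> ltr01) Bb.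
have bB y : `|b y| <= B by have := bB' y; rewrite mulr1.
have [N NE] : exists N, N = C * M by eexists.
have N0 : 0 <= N by rewrite NE mulr_ge0.
have [Kw KwE] : exists Kw, Kw = N * (G + B) by eexists.
have Kw0 : 0 <= Kw by rewrite KwE mulr_ge0 ?addr_ge0.
have [K3 K3E] : exists K3, K3 = D * (Kphi + Kw) by eexists.
have K30 : 0 <= K3 by rewrite K3E mulr_ge0 ?addr_ge0.
have [K4 K4E] : exists K4, K4 = K3 * (G + B) by eexists.
have K40 : 0 <= K4 by rewrite K4E mulr_ge0 ?addr_ge0.
exists (4 * (K4 * D)); split; first by do 2 apply: mulr_ge0 => //.
move=> f Bf fM vM e x e0 e1.
pose u s := kernel_op r s f; pose v s := V s f.
have uB s : 0 <= s -> Bh_pos h (u s) /\ (forall y, u s y <= N * h y).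
  move=> s0; have [us uN] := first_moment_Bh_pos rC M0 Bf fM s0; split => // y.
  apply: le_trans (uN y) _; rewrite (_ : N * h y = M * (C * h y)); last by rewrite NE; ring.
  apply: ler_wpM2l => //.
  rewrite ler_piMr ?mulr_ge0//; rewrite -expR0 ler_expR oppr_le0 mulr_ge0//; exact: ltW.
have vB s : 0 <= s -> Bh_pos h (v s) by move=> s0; exact: VB.
pose w s y := Gamma eta H1 (u s) y - b y * u s y.
have wK s y : 0 <= s -> `|w s y| <= Kw * h y.
  move=> s0; have [us uN] := uB _ s0; have [HG1 _] := HG y.
  have /andP[g1 g2] := HG1 _ _ N0 us uN; have us0 := us.2 y; have := uN y; have := bB y.
  have hy := h_ge0 y; rewrite ler_norml => /andP[b1 b2] uNy.
  by rewrite /w KwE; exact: drift_bound_arith.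
have phiK s y : 0 <= s -> s <= 1 -> `|phi b c eta H1 y (v s)| <= Kphi * h y.
  by move=> s0 s1; apply: HKphi; [exact: vB|move=> z; exact: vM].
have Kh_int (K t : R) z : 0 <= K -> 0 <= t -> t <= 1 ->
    (\int[p t z]_y (K * h y)%:E <= (K * (D * h z))%:E)%E.
  move=> K0 t0 t1; under eq_integral do rewrite EFinM.
  rewrite ge0_integralZl//.
  by rewrite EFinM; apply: lee_wpmul2l; [rewrite lee_fin|exact: pD].
have intp (F : E -> R) (K t : R) z : 0 <= K -> 0 <= t -> t <= 1 -> (forall y, `|F y| <= K * h y) ->
    `|\int[p t z]_y F y| <= K * (D * h z).
  move=> K0 t0 t1 FK; apply: (@Rintegral_le_norm _ (Borel E) R (p t z) setT F (fun y => K * h y)).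
    by move=> y _; exact: FK.
  exact: Kh_int.
have vE s z : 0 <= s -> s <= 1 -> `|v s z - \int[p s z]_y f y| <= Kphi * (D * h z) * s.
  move=> s0 s1; have [_ _ _ eq] := V_cumulant Bf.
  rewrite /v eq// addrAC subrr add0r normrN; apply: itv_bound => // q q0 qs.
  apply: intp => //; first by rewrite subr_ge0.
    by apply: le_trans s1; rewrite gerBl.
  by move=> y; apply: phiK => //; exact: le_trans qs s1.
have uE s z : 0 <= s -> s <= 1 -> `|u s z - \int[p s z]_y f y| <= Kw * (D * h z) * s.
  move=> s0 s1; rewrite /u (first_moment_equation r_first_moment)//; last exact: Bf.1.
  rewrite addrAC subrr add0r; apply: itv_bound => // q q0 qs.
  apply: intp => //; first exact: le_trans qs s1.
  by move=> y; apply: wK; rewrite subr_ge0.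
have uv s z : 0 <= s -> s <= 1 -> `|v s z - u s z| <= K3 * s * h z.
  move=> s0 s1; have := vE s z s0 s1; have := uE s z s0 s1; rewrite !ler_norml K3E.
  move=> /andP[u1 u2] /andP[v1 v2]; exact: closeness_arith u1 u2 v1 v2.
have wphi s y : 0 <= s -> s <= e -> - w s y <= phi b c eta H1 y (v s) + K4 * e * h y.
  move=> s0 se; have s1 := le_trans se e1; have := phi_ge lusinE h_gt0 h_cont A2 y (vB _ s0).
  have [us uN] := uB _ s0; have [_ HG2] := HG y.
  have := HG2 (u s) (v s) (K3 * s); rewrite mulr_ge0// => /(_ isT us (vB _ s0)).
  move=> /(_ _)/wrap[z|Gv].
    by have := uv s z s0 s1; rewrite ler_norml lerBlDl => /andP[_].
  have := uv s y s0 s1; have := bB y; rewrite !ler_norml => /andP[b1 b2] /andP[d1 d2].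
  have hy := h_ge0 y; have Ks : K3 * s * h y <= K3 * e * h y.
    by apply: ler_wpM2r => //; apply: ler_wpM2l.
  have Ks0 : 0 <= K3 * s * h y by do 2 apply: mulr_ge0 => //.
  have bvu : b y * (u s y - v s y) <= B * (K3 * s * h y).
    apply: le_trans (ler_norm _) _; rewrite normrM; apply: ler_pM => //.
    by rewrite distrC; exact: uv.
  have l1 := ler_wpM2l G0 Ks; have l2 := ler_wpM2l B0 Ks.
  by rewrite /w K4E => H; exact: drift_arith Gv bvu H l1 l2.
pose A q := \int[p (e - q) x]_y phi b c eta H1 y (v q).
pose W q := \int[p (e - q) x]_y w q y.
have hx := h_ge0 x.
have inner q : 0 <= q -> q <= e -> - W q <= A q + 2 * (K4 * e * (D * h x)).
  move=> q0 qe; have eq0 : 0 <= e - q by rewrite subr_ge0.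
  have eq1 : e - q <= 1 by apply: le_trans e1; rewrite gerBl.
  have q1 := le_trans qe e1; have Kc0 : 0 <= Kphi + Kw by exact: addr_ge0.
  have cfin : (\int[p (e - q)%R x]_y ((Kphi + Kw) * h y)%:E < +oo)%E.
    by apply: le_lt_trans (Kh_int _ _ x Kc0 eq0 eq1) (ltry _).
  have wc y : `|w q y| <= (Kphi + Kw) * h y.
    by apply: le_trans (wK q y q0) _; apply: ler_wpM2r => //; rewrite lerDr.
  have phic y : `|phi b c eta H1 y (v q)| <= (Kphi + Kw) * h y.
    by apply: le_trans (phiK q y q0 q1) _; apply: ler_wpM2r => //; rewrite lerDl.
  have Ke0 : 0 <= K4 * e by rewrite mulr_ge0.
  rewrite /W -(@Rintegral_opp _ (Borel E) R (p (e - q) x) setT (w q) _ (fun y _ => wc y) cfin).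
  apply: (@Rintegral_leD2 _ (Borel E) R (p (e - q) x) setT _ _ (fun y => K4 * e * h y) _ _
    measurableT _ _ _ (fun y _ => phic y) cfin).
  - by apply: measurable_funM => //.
  - by move=> y _; rewrite mulr_ge0.
  - by move=> y _; rewrite normrN; exact: wc.
  - by move=> y _; exact: wphi.
  - exact: Kh_int.
have [_ _ _ veq] := V_cumulant Bf.
have ueq := first_moment_equation r_first_moment x e0 Bf.1.
have WE : \int[lebesgue_measure]_(q in `[0, e]) W q = u e x - \int[p e x]_y f y.
  rewrite /u ueq addrAC subrr add0r -Rintegral_reflect; apply: eq_Rintegral => q _.
  by rewrite /W subKr.
have AE : \int[lebesgue_measure]_(q in `[0, e]) A q = \int[p e x]_y f y - v e x.
  by rewrite /v veq// opprB addrCA subrr addr0.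
pose K6 := (Kphi + Kw) * (D * h x).
have K60 : 0 <= K6 by rewrite !mulr_ge0// addr_ge0.
have Kfin : (\int[lebesgue_measure]_(q in `[0%R, e]) K6%:E < +oo)%E.
  by rewrite integral_itv_cst// ltry.
have AK q : `[0, e]%classic q -> `|A q| <= K6.
  rewrite /= in_itv/= => /andP[q0 qe]; apply: (@le_trans _ _ (Kphi * (D * h x))).
    apply: intp; rewrite ?subr_ge0//; first by apply: le_trans e1; rewrite gerBl.
    by move=> y; apply: phiK => //; exact: le_trans qe e1.
  by apply: ler_wpM2r; rewrite ?mulr_ge0// lerDl.
have WK q : `[0, e]%classic q -> `|W q| <= K6.
  rewrite /= in_itv/= => /andP[q0 qe]; apply: (@le_trans _ _ (Kw * (D * h x))).
    apply: intp; rewrite ?subr_ge0//; first by apply: le_trans e1; rewrite gerBl.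
    by move=> y; exact: wK.
  by apply: ler_wpM2r; rewrite ?mulr_ge0// lerDr.
have : \int[lebesgue_measure]_(q in `[0, e]) (- W q) <=
    \int[lebesgue_measure]_(q in `[0, e]) A q + 2 * (2 * (K4 * e * (D * h x)) * e).
  apply: (@Rintegral_leD2 _ _ R lebesgue_measure `[0, e]%classic _ _
    (cst (2 * (K4 * e * (D * h x)))) (cst K6) _ _ _ _ _ AK Kfin).
  - exact: measurable_itv.
  - exact: measurable_cst.
  - by move=> q _; rewrite /cst; do ! apply: mulr_ge0 => //.
  - by move=> q /WK; rewrite normrN.
  - by move=> q /=; rewrite in_itv/= => /andP[? ?]; exact: inner.
  - by rewrite integral_itv_cst.
rewrite (@Rintegral_opp _ _ R lebesgue_measure `[0, e]%classic W (cst K6) WK Kfin) WE AE /v /u => H.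
exact: short_time_arith H.
Qed.

Let cumulant0 f : Bh_pos h f -> V 0 f = f.
Proof.
move=> Bf; have [_ _ _ eq] := V_cumulant Bf; have [brs _] := A1.
apply/funext => x; rewrite eq// set_itv1 Rintegral_set1 subr0 /Rintegral.
rewrite (_ : (\int[p 0 x]_y _ = \int[@dirac _ (Borel E) x R]_y (f y)%:E)%E).
  rewrite integral_dirac//; first by rewrite diracT mul1e.
  by apply/measurable_EFinP; exact: (Bh_measurable Bf.1).
by apply: eq_measure_integral => A mA _; rewrite (brs_normal brs).
Qed.

(** The operators [kernel_op r ((n - k) e) \o V (k e)], with [e = t / n],
    interpolate between [kernel_op r t] and [V t]; each of the [n] steps costs
    at most a multiple of [e ^+ 2]. *)
Theorem cumulant_le_first_moment t f x : 0 < t -> Bh_pos h f -> V t f x <= kernel_op r t f x.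
Proof.
move=> t0 Bf; have [C [delta [C0' delta0 rC]]] := P_subcritical.
have C0 := ltW C0'; have hx := h_ge0 x.
have [Mf Mf0 fMf] := Bh_bound h_gt0 Bf.1.
have [_ _ /(_ (t + 1))[M0 VM0] _] := V_cumulant Bf.
pose M := `|M0| + Mf; have M_ge0 : 0 <= M by rewrite addr_ge0.
have fM y : f y <= M * h y.
  apply: le_trans (le_trans (ler_norm _) (fMf y)) _.
  by apply: ler_wpM2r => //; rewrite lerDr.
have VM s y : 0 <= s -> s <= t + 1 -> V s f y <= M * h y.
  move=> s0 st; have /(hnorm_leP h_gt0)/(_ y) := VM0 s s0 st.
  move=> /(le_trans (ler_norm _))/le_trans; apply; apply: ler_wpM2r => //.
  by apply: le_trans (ler_norm _) _; rewrite lerDl.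
have [K [K0 HK]] := cumulant_short_time M_ge0.
pose L := K * C * h x; have L0 : 0 <= L by rewrite !mulr_ge0.
have op_le s u v (a : R) : 0 <= s -> 0 <= a -> Bh_pos h u -> Bh_pos h v ->
    (forall y, u y <= v y + a * h y) -> kernel_op r s u x <= kernel_op r s v x + a * (C * h x).
  move=> s0 a0 [Bu _] [Bv _] uv.
  have [m [mE mC]] := Mh_represents h_gt0 h_cont (rC s x s0).
  have Bah : Bh h (fun y => a * h y) by apply: BhZ => //; exact: (Bh_weight h_gt0 h_cont).1.
  rewrite /kernel_op !mE; apply: (@le_trans _ _ (pairing v m + a * pairing h m)).
    rewrite -(pairingZ h_gt0 h_cont _ a (Bh_weight h_gt0 h_cont).1) -(pairingD h_gt0 h_cont)//.
    by apply: le_pairing => //; exact: BhD.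
  rewrite lerD2l; apply: ler_wpM2l => //; apply: le_trans mC _.
  rewrite ler_piMr ?mulr_ge0//; rewrite -expR0 ler_expR oppr_le0 mulr_ge0//; exact: ltW.
have steps (n : nat) : t <= n.+1%:R -> V t f x <= kernel_op r t f x + L * t ^+ 2 / n.+1%:R.
  move=> tn; pose e := t / n.+1%:R; have e0 : 0 <= e by rewrite divr_ge0// ltW.
  have e1 : e <= 1 by rewrite ler_pdivrMr// mul1r.
  have en : n.+1%:R * e = t by rewrite mulrC divfK.
  have claim k : (k <= n.+1)%N ->
      kernel_op r ((n.+1 - k)%:R * e) (V (k%:R * e) f) x <=
      kernel_op r t f x + k%:R * (K * e ^+ 2 * (C * h x)).
    elim: k => [_|k ih kn]; first by rewrite subn0 !mul0r en cumulant0// addr0.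
    have ke0 : 0 <= k%:R * e by rewrite mulr_ge0.
    have BV := VB ke0 Bf.
    have ket : k%:R * e <= t by rewrite -en; apply: ler_wpM2r => //; rewrite ler_nat ltnW.
    have nke0 : 0 <= (n.+1 - k.+1)%:R * e by rewrite mulr_ge0.
    have -> : k.+1%:R * e = e + k%:R * e by rewrite -natr1; ring.
    rewrite cumulant_flow//.
    have -> : k.+1%:R * (K * e ^+ 2 * (C * h x)) =
      k%:R * (K * e ^+ 2 * (C * h x)) + K * e ^+ 2 * (C * h x) by rewrite -natr1; ring.
    rewrite addrA; apply: le_trans (lerD (ih (ltnW kn)) (lexx _)).
    have -> : (n.+1 - k)%:R * e = (n.+1 - k.+1)%:R * e + e.
      by rewrite -(subnSK kn) -natr1 mulrDl mul1r.
    rewrite (first_moment_add r_first_moment)//; last exact: BV.1.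
    have VkM y : V (k%:R * e) f y <= M * h y.
      by apply: VM => //; apply: le_trans ket _; rewrite lerDl.
    apply: op_le => //; first by rewrite mulr_ge0// sqr_ge0.
    - exact: VB.
    - by have [] := first_moment_Bh_pos rC M_ge0 BV VkM e0.
    - move=> y; apply: HK => // s z s0 s1; rewrite -cumulant_flow//; apply: VM.
        by rewrite addr_ge0.
      by rewrite addrC; exact: lerD.
  have := claim n.+1 (leqnn _); rewrite subnn mul0r en.
  rewrite (first_moment_zero r_first_moment); last by have [] := VB (ltW t0) Bf.
  move=> H; apply: le_trans H _; rewrite lerD2l le_eqVlt; apply/orP; left; apply/eqP.
  by rewrite /L /e; field.
apply/ler_addgt0Pr => d d0.
pose n := Num.truncn (t + L * t ^+ 2 / d).
have nP : t + L * t ^+ 2 / d < n.+1%:R by exact: truncnS_gt.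
have Ld : 0 <= L * t ^+ 2 / d by rewrite divr_ge0 ?mulr_ge0 ?sqr_ge0// ltW.
have tn : t <= n.+1%:R by lra.
apply: le_trans (steps n tn) _; rewrite lerD2l ler_pdivrMr// [d * _]mulrC -ler_pdivrMr//.
by lra.
Qed.

(** * Integrability of the immigration *)

Hypothesis A3 : assumption_A3 H2.
Hypothesis H2_log : (\int[H2]_(nu in Mho h `&` [set nu : Mh h | (1 < pairing h nu)%R])
                 (ln (pairing h nu))%:E < +oo)%E.

Let mMho : measurable (Mho h : set (Mh h)). Proof. exact: measurable_Mho. Qed.
Let mz : measurable_fun [set: Mh h] (fun nu : Mh h => pairing h nu).
Proof. by apply: mpair; exact: Bh_weight. Qed.
Let z_ge0 (nu : Mh h) : 0 <= pairing h nu. Proof. exact: pairing_ge0. Qed.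

(** Subcriticality, transferred to [V] by the comparison with the first moments;
    the constant [C + 1] also covers time 0, where [V] is the identity. *)
Lemma cumulant_decay : exists A delta : R, [/\ 0 <= A, 0 < delta &
  forall (M : R) f, 0 <= M -> Bh_pos h f -> (forall y, f y <= M * h y) ->
  forall (t : R) x, 0 <= t -> V t f x <= M * A * expR (- (delta * t)) * h x].
Proof.
have [C [delta [C0 d0 rC]]] := P_subcritical; exists (C + 1), delta.
split=> [||M f M0 Bf fM t x]; [exact: addr_ge0 (ltW C0) ler01|exact: d0|].
rewrite le_eqVlt => /orP[/eqP <-|t0].
  rewrite cumulant0// mulr0 oppr0 expR0 mulr1; apply: le_trans (fM x) _.
  by apply: ler_wpM2r => //; rewrite ler_peMr// lerDr ltW.
apply: le_trans (cumulant_le_first_moment x t0 Bf) _.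
have [_ /(_ x) H] := first_moment_Bh_pos rC M0 Bf fM (ltW t0).
apply: le_trans H _; rewrite -!mulrA; apply: ler_wpM2l => //.
rewrite (mulrC (h x)); apply: ler_wpM2r; first by rewrite mulr_ge0// expR_ge0.
by rewrite lerDl.
Qed.

Let jumps (a : R) : \bar R := (\int[H2]_(nu in Mho h) (Num.min 1 (a * pairing h nu))%:E)%E.

Let jumps_fin a : 0 <= a -> jumps a \is a fin_num.
Proof.
move=> a0; have [_ H] := A3; rewrite ge0_fin_numE; last first.
  by apply: integral_ge0 => nu _; rewrite lee_fin le_min ler01 mulr_ge0.
apply: (@le_lt_trans _ _ (\int[H2]_(nu in Mho h) ((1 + a)%:E * (Num.min 1 (pairing h nu))%:E))%E).
  apply: le_lower_integral => nu _; first by rewrite lee_fin le_min ler01 mulr_ge0.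
  rewrite -EFinM lee_fin; have z0 := z_ge0 nu.
  by case: (leP 1 (pairing h nu)) => ?; rewrite ge_min; apply/orP; [left|right]; nra.
rewrite ge0_integralZl//.
- by apply: lte_mul_pinfty H; rewrite ?lee_fin ?addr_ge0//.
- by apply/measurable_EFinP; apply: measurable_minr => //; exact: measurable_funTS.
- by move=> nu _; rewrite lee_fin le_min ler01 z_ge0.
- by rewrite lee_fin addr_ge0.
Qed.

(* Bounds [psi] on functions below [a * h]; the exponentials are replaced by
   [Num.min 1] so that truncated geometric sums appear. *)
Let rate (a : R) : R := a * pairing h beta + fine (jumps a).

Lemma psi_rate g (a : R) : 0 <= a -> Bh_pos h g -> (forall y, g y <= a * h y) ->
  0 <= psi beta H2 g <= rate a.
Proof.
move=> a0 [Bg g0] ga; have e0 (nu : Mh h) : 0 <= 1 - expR (- pairing g nu).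
  by rewrite subr_ge0 -expR0 ler_expR oppr_le0 pairing_ge0.
rewrite /psi addr_ge0 ?pairing_ge0//=; last by apply: Rintegral_ge0 => nu _.
apply: lerD; first exact: pairing_leM.
rewrite /Rintegral -lee_fin (fineK (jumps_fin a0)).
apply: (@le_trans _ _ (\int[H2]_(nu in Mho h) (1 - expR (- pairing g nu))%:E)%E).
  by case: (integral _ _ _) (@integral_ge0 _ (Mh h) R H2 (Mho h) (fun nu => (1 - expR (- pairing g nu))%:E)
    (fun nu _ => e0 nu)).
apply: le_lower_integral => nu _; first by rewrite lee_fin.
rewrite lee_fin le_min gerBl expR_ge0/=.
have ga' : pairing g nu <= a * pairing h nu by exact: pairing_leM.
by have := expR_ge1Dx (- pairing g nu); lra.
Qed.

Let rate_ge0 a : 0 <= a -> 0 <= rate a.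
Proof.
move=> a0; rewrite /rate addr_ge0 ?mulr_ge0 ?pairing_ge0//; apply/fine_ge0/integral_ge0 => nu _.
by rewrite lee_fin le_min ler01 mulr_ge0.
Qed.

(** The sum over [k] is taken under the integral, where it is a truncated geometric
    sum: bounded by a multiple of [min 1 z] plus the logarithm of the mass [z]. *)
Lemma rate_summable (a delta : R) : 0 <= a -> 0 < delta -> exists S : R, forall N,
  \sum_(k < N) rate (a * expR (- delta) ^+ k) <= S.
Proof.
move=> a0 d0; have [K [K0 HK]] := truncated_geometric_sum a0 d0.
have [_ Hmin] := A3.
pose lnp (nu : Mh h) : R := if 1 < pairing h nu then ln (pairing h nu) else 0.
have lnp0 nu : 0 <= lnp nu by rewrite /lnp; case: ifPn => // z1; rewrite ln_ge0// ltW.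
have mlnp : measurable_fun [set: Mh h] lnp.
  apply: measurable_fun_ifT => //; first exact: measurable_fun_ltr.
  by apply: measurableT_comp => //; exact: measurable_ln.
have lnp_fin : (\int[H2]_(nu in Mho h) (lnp nu)%:E < +oo)%E.
  move: H2_log; rewrite integral_mkcondr; apply: le_lt_trans.
  apply: le_lower_integral => nu _; first by rewrite lee_fin.
  rewrite /patch /lnp; case: ifPn => z1; first by rewrite mem_set.
  by rewrite memNset//; exact/negP.
have min0 (nu : Mh h) : 0 <= Num.min 1 (pairing h nu) by rewrite le_min ler01 z_ge0.
have mmin (g : Mh h -> R) : measurable_fun [set: Mh h] g ->
    measurable_fun (Mho h) (fun nu => (Num.min 1 (g nu))%:E).
  by move=> mg; apply/measurable_EFinP; apply: measurable_funTS; exact: measurable_minr.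
pose W := (\int[H2]_(nu in Mho h) (K * Num.min 1 (pairing h nu) + delta^-1 * lnp nu)%:E)%E.
have W_fin : (W < +oo)%E.
  rewrite /W; under eq_integral do rewrite EFinD !EFinM.
  have dV0 : 0 <= delta^-1 by rewrite invr_ge0 ltW.
  rewrite ge0_integralD//; last 4 first.
  - by move=> nu _; rewrite mule_ge0// lee_fin.
  - by apply: emeasurable_funM => //; exact: mmin.
  - by move=> nu _; rewrite mule_ge0// lee_fin.
  - by apply: emeasurable_funM => //; apply/measurable_EFinP; exact: measurable_funTS.
  rewrite ge0_integralZl; [|exact: mMho|exact: mmin|by move=> nu _; rewrite lee_fin|by rewrite lee_fin].
  rewrite ge0_integralZl; last 4 first.
  - exact: mMho.
  - by apply/measurable_EFinP; exact: measurable_funTS.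
  - by move=> nu _; rewrite lee_fin.
  - by rewrite lee_fin.
  by rewrite lte_add_pinfty// lte_mul_pinfty// lee_fin.
exists (a * (1 - expR (- delta))^-1 * pairing h beta + fine W) => N.
rewrite big_split/= -mulr_suml -mulr_sumr; apply: lerD.
  apply: ler_wpM2r; first exact: pairing_ge0.
  apply: ler_wpM2l => //; apply: geometric_sum_le; first exact: expR_gt0.
  by rewrite -expR0 ltr_expR oppr_lt0.
have aq k : 0 <= a * expR (- delta) ^+ k by rewrite mulr_ge0// exprn_ge0// expR_ge0.
rewrite -lee_fin -sumEFin fineK; last first.
  rewrite ge0_fin_numE//; apply: integral_ge0 => nu _.
  by rewrite lee_fin addr_ge0// mulr_ge0// invr_ge0 ltW.
under eq_bigr do rewrite (fineK (jumps_fin (aq _))).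
rewrite -ge0_integral_sum//; last 2 first.
- by move=> k; apply: mmin; exact: measurable_funM.
- by move=> k nu _; rewrite lee_fin le_min ler01 mulr_ge0.
apply: le_lower_integral => nu _.
  by apply: sume_ge0 => k _; rewrite lee_fin le_min ler01 mulr_ge0.
by rewrite sumEFin lee_fin; exact: HK.
Qed.

Lemma immigration_ge0 (t : R) f : Bh_pos h f -> 0 <= immigration t f.
Proof.
move=> Bf; apply: Rintegral_ge0 => s /=; rewrite in_itv/= => /andP[s0 _].
have BV := VB s0 Bf; have [M M0 VM] := Bh_bound h_gt0 BV.1.
by have /andP[] := psi_rate M0 BV (fun y => le_trans (ler_norm _) (VM y)).
Qed.

(** The bounds [rho] depend on [f] only through [M]. Increments over unit
    intervals are controlled through the cocycle identity [immigrationD]. *)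
Lemma immigration_rate (M : R) : 0 <= M -> exists rho : nat -> R,
  [/\ forall k, 0 <= rho k, (exists S : R, forall N, \sum_(k < N) rho k <= S)
    & forall f, Bh_pos h f -> (forall y, f y <= M * h y) ->
      (forall k s, k%:R <= s -> 0 <= psi beta H2 (V s f) <= rho k) /\
      (forall k, immigration k.+1%:R f <= immigration k%:R f + rho k)].
Proof.
move=> M0; have [A [delta [A0 d0 HV]]] := cumulant_decay.
pose a k := M * A * expR (- delta) ^+ k.
have a0 k : 0 <= a k by rewrite !mulr_ge0// exprn_ge0// expR_ge0.
exists (fun k => rate (a k)); split=> [k||f Bf fM].
- exact: rate_ge0.
- by apply: rate_summable => //; exact: mulr_ge0.
have rateP k s : k%:R <= s -> 0 <= psi beta H2 (V s f) <= rate (a k).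
  move=> ks; have s0 : 0 <= s by exact: le_trans ks.
  apply: psi_rate => //; first exact: VB.
  move=> y; apply: le_trans (HV M f M0 Bf fM s y s0) _; apply: ler_wpM2r => //.
  apply: ler_wpM2l; first exact: mulr_ge0.
  by rewrite -expRM_natl ler_expR mulrN lerN2 mulrC; apply: ler_wpM2l => //; exact: ltW.
split=> // k; have k0 : 0 <= k%:R :> R by [].
have BV := VB k0 Bf; have := immigrationD ler01 k0 Bf; rewrite addrC natr1 => ->.
have swap_le (x y z : R) : x <= z -> x + y <= y + z by move=> xz; rewrite addrC lerD2l.
apply: swap_le.
apply: le_trans (ler_norm _) _; rewrite -[rate (a k)]mulr1; apply: itv_bound => // s s0 st.
rewrite -cumulant_flow//; have /andP[p0 p1] : 0 <= psi beta H2 (V (s + k%:R) f) <= rate (a k).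
  by apply: rateP; rewrite lerDr.
by rewrite ger0_norm.
Qed.

Definition total_immigration (f : E -> R) : R := limn (fun n => immigration n%:R f).

Lemma le_immigration (s t : R) f : 0 <= s -> s <= t -> Bh_pos h f ->
  immigration s f <= immigration t f.
Proof.
move=> s0 st Bf; rewrite -[t in leRHS](subrK s) immigrationD ?subr_ge0//.
by rewrite lerDr; apply: immigration_ge0; exact: VB.
Qed.

(** The uniformity of the tails over [f <= M * h] gives the continuity of the
    limit functional later on. *)
Lemma total_immigrationP (M : R) : 0 <= M -> exists tail : nat -> R,
  tail n @[n --> \oo] --> (0 : R) /\
  forall f, Bh_pos h f -> (forall y, f y <= M * h y) ->
    immigration n%:R f @[n --> \oo] --> total_immigration f /\
    forall n (t : R), n%:R <= t ->
      immigration t f <= total_immigration f <= immigration t f + tail n.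
Proof.
move=> M0; have [rho [rho0 [S HS] Hrho]] := immigration_rate M0.
pose sr n := \sum_(k < n) rho k.
have sr_nd : nondecreasing_seq sr.
  by apply/nondecreasing_seqP => n; rewrite /sr big_ord_recr/= lerDl.
have sr_cvg : sr n @[n --> \oo] --> limn sr.
  by apply: nondecreasing_is_cvgn => //; exists S => _ [n _ <-]; exact: HS.
have sr_le n : sr n <= limn sr by exact: nondecreasing_cvgn_le sr_nd (cvgP _ sr_cvg) n.
exists (fun n => limn sr - sr n); split.
  by rewrite -[X in _ --> X](subrr (limn sr)); apply: cvgB; [exact: cvg_cst|exact: sr_cvg].
move=> f Bf fM; have [_ Hinc] := Hrho f Bf fM.
pose i n := immigration n%:R f.
have i_nd : nondecreasing_seq i.
  by apply/nondecreasing_seqP => n; apply: le_immigration => //; rewrite ler_nat.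
have i_sr n m : (n <= m)%N -> i m <= i n + (sr m - sr n).
  move=> nm; rewrite -(subnK nm); elim: (m - n)%N => [|k ih]; first by rewrite add0n subrr addr0.
  rewrite addSn; apply: le_trans (Hinc _) _; rewrite /sr big_ord_recr/= -/(sr _).
  by rewrite addrAC addrA lerD2r.
have i_ub n m : i m <= i n + (limn sr - sr n).
  have [nm|mn] := leqP n m; first by apply: le_trans (i_sr _ _ nm) _; rewrite lerD2l lerD2r.
  by apply: le_trans (i_nd _ _ (ltnW mn)) _; rewrite lerDl subr_ge0.
have i_cvg : i n @[n --> \oo] --> total_immigration f.
  by apply: nondecreasing_is_cvgn => //; exists (i 0 + (limn sr - sr 0)) => _ [n _ <-].
split=> // n t nt; have t0 : 0 <= t by exact: le_trans nt.
apply/andP; split.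
  have tm : t <= (Num.truncn t).+1%:R by apply: ltW; exact: truncnS_gt.
  apply: le_trans (le_immigration t0 tm Bf) _.
  exact: nondecreasing_cvgn_le i_nd (cvgP _ i_cvg) _.
apply: (@le_trans _ _ (i n + (limn sr - sr n))); last first.
  by rewrite lerD2r; exact: le_immigration.
by apply: (cvgr_to_le i_cvg); apply: nearW => m; exact: i_ub.
Qed.

(** The integrand is nonnegative, so the lower integral over the half-line is
    exhausted by those over [0, n]. *)
Lemma total_immigrationE f : Bh_pos h f ->
  (\int[lebesgue_measure]_(s in [set s : R | (0 <= s)%R]) (psi beta H2 (V s f))%:E =
   (total_immigration f)%:E)%E.
Proof.
move=> Bf; have [M M0 fM'] := Bh_bound h_gt0 Bf.1.
have fM y : f y <= M * h y by apply: le_trans (fM' y); exact: ler_norm.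
have [rho [rho0 _ /(_ f Bf fM)[Hpsi _]]] := immigration_rate M0.
have [tail [_ /(_ f Bf fM)[i_cvg Htail]]] := total_immigrationP M0.
have psi0 (s : R) : 0 <= s -> (0 <= (psi beta H2 (V s f))%:E)%E.
  by move=> s0; have /andP[] := Hpsi 0%N s s0.
pose D n : set R := `[0, n%:R]%classic.
have DE : [set s : R | 0 <= s] = \bigcup_n D n.
  apply/seteqP; split => s /=; last by move=> [n _]; rewrite /D/= in_itv/= => /andP[].
  move=> s0; exists (Num.truncn s).+1 => //; rewrite /D/= in_itv/= s0/=.
  by apply: ltW; exact: truncnS_gt.
have D0 n s : D n s -> (0 <= (psi beta H2 (V s f))%:E)%E.
  by rewrite /D/= in_itv/= => /andP[s0 _]; exact: psi0.
have iE n : (\int[lebesgue_measure]_(s in D n) (psi beta H2 (V s f))%:E = (immigration n%:R f)%:E)%E.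
  rewrite /immigration /Rintegral fineK// ge0_fin_numE; last by apply: integral_ge0 => s; exact: D0.
  apply: (@le_lt_trans _ _ (\int[lebesgue_measure]_(s in D n) (rho 0%N)%:E)%E).
    apply: le_lower_integral => s Ds; first exact: D0 Ds.
    move: Ds; rewrite /D/= in_itv/= => /andP[s0 _].
    by rewrite lee_fin; have /andP[] := Hpsi 0%N s s0.
  by rewrite integral_itv_cst// ltry.
apply/eqP; rewrite eq_le DE; apply/andP; split.
  apply: lower_integral_exhaust => [n|n m nm|n s|n].
  - exact: measurable_itv.
  - apply/subsetPset => s; rewrite /D/= !in_itv/= => /andP[-> sn]/=.
    by apply: le_trans sn _; rewrite ler_nat.
  - exact: D0.
  - by rewrite iE lee_fin; have /andP[] := Htail 0%N n%:R (ler0n _ _).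
apply: (cvge_to_le (cvg_EFin_seq i_cvg)); apply: nearW => n.
rewrite -iE; apply: lower_integral_subset => [s Ds|s [m _]]; first by exists n.
exact: D0.
Qed.

(** The invariance of the limit law, on the level of exponents. *)
Lemma total_immigrationD (t : R) f : 0 <= t -> Bh_pos h f ->
  total_immigration f = total_immigration (V t f) + immigration t f.
Proof.
move=> t0 Bf; have BV := VB t0 Bf.
have [M M0 fM'] := Bh_bound h_gt0 Bf.1; have [N N0 VN'] := Bh_bound h_gt0 BV.1.
have fM y : f y <= M * h y by apply: le_trans (fM' y); exact: ler_norm.
have VN y : V t f y <= N * h y by apply: le_trans (VN' y); exact: ler_norm.
have [tail [tail0 /(_ f Bf fM)[_ H]]] := total_immigrationP M0.
have [_ [_ /(_ _ BV VN)[c1 _]]] := total_immigrationP N0.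
have c2 : immigration n%:R (V t f) + immigration t f @[n --> \oo] --> total_immigration f.
  apply: (squeeze_cvgr (f := fun n => total_immigration f - tail n) (h := fun=> total_immigration f)).
  - apply: nearW => n; rewrite -immigrationD//.
    have /H/andP[h1 h2] : n%:R <= n%:R + t by rewrite lerDl.
    by rewrite h1 lerBlDr h2.
  - by rewrite -[X in _ --> X](subr0 (total_immigration f)); apply: cvgB; [exact: cvg_cst|].
  - exact: cvg_cst.
have c3 : immigration n%:R (V t f) + immigration t f @[n --> \oo] -->
    total_immigration (V t f) + immigration t f by apply: cvgD; [exact: c1|exact: cvg_cst].
exact: (cvg_unique _ c2 c3).
Qed.

(** * The limit law *)

Let limit_Laplace (f : E -> R) : R := expR (- total_immigration f).

Let total_ge0 f : Bh_pos h f -> 0 <= total_immigration f.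
Proof.
move=> Bf; rewrite -lee_fin -total_immigrationE//; apply: integral_ge0 => s /= s0.
have BV := VB s0 Bf; have [M M0 VM] := Bh_bound h_gt0 BV.1.
by rewrite lee_fin; have /andP[] := psi_rate M0 BV (fun y => le_trans (ler_norm _) (VM y)).
Qed.

Lemma Laplace_superprocess_cvg (mu : Mh h) f (e : R) : Bh_pos h f -> 0 < e ->
  exists2 T : R, 0 <= T & forall t, T <= t ->
    `|expR (- (pairing (V t f) mu + immigration t f)) - limit_Laplace f| <= e.
Proof.
move=> Bf e0; have [M M0 fM'] := Bh_bound h_gt0 Bf.1.
have fM y : f y <= M * h y by apply: le_trans (fM' y); exact: ler_norm.
have [A [delta [A0 d0 HV]]] := cumulant_decay.
have [tail [tail0 /(_ f Bf fM)[_ Htail]]] := total_immigrationP M0.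
have e2 : 0 < e / 2 by rewrite divr_gt0.
have /cvgrPdist_le/(_ _ e2)[n _ /(_ n (leqnn n))/= tn] := tail0.
pose C := M * A * pairing h mu; have C0 : 0 <= C by rewrite !mulr_ge0// pairing_ge0.
pose T := n%:R + C / (e / 2) / delta.
exists T; first by rewrite addr_ge0// !divr_ge0// ltW.
move=> t Tt; have nt : n%:R <= t.
  by apply: le_trans Tt; rewrite lerDl !divr_ge0// ltW.
have t0 : 0 <= t by exact: le_trans nt.
have BV := VB t0 Bf; have p0 : 0 <= pairing (V t f) mu by apply: pairing_ge0; case: BV.
have i0 := immigration_ge0 t Bf.
have pe : pairing (V t f) mu <= e / 2.
  apply: (@le_trans _ _ (M * A * expR (- (delta * t)) * pairing h mu)).
    by apply: pairing_leM => //; [case: BV|move=> y; exact: HV].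
  have -> : M * A * expR (- (delta * t)) * pairing h mu = C * expR (- (delta * t)) by rewrite /C; ring.
  rewrite expRN ler_pdivrMr ?expR_gt0// mulrC -ler_pdivrMr//.
  apply: le_trans (expR_ge1Dx _); apply: (@le_trans _ _ (delta * t)); last by rewrite lerDr.
  rewrite [delta * t]mulrC -ler_pdivrMr//; apply: le_trans Tt; by rewrite lerDr.
apply: le_trans (expR_lipschitz _ (total_ge0 Bf)) _; first exact: addr_ge0.
have /andP[h1 h2] := Htail n t nt.
move: tn; rewrite sub0r normrN ler_norml => /andP[_ tn].
move: (total_immigration f) (immigration t f) (pairing (V t f) mu) (tail n) h1 h2 tn p0 pe.
by move=> a b' c' d h1 h2 tn p0 pe; rewrite ler_norml; apply/andP; split; lra.
Qed.

(** For finite time the functional is the Laplace functional of the superprocess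
    started from 0, continuous by bounded convergence; the tails make the passage
    to infinite time uniform. *)
Lemma limit_Laplace_cont (M : R) (f_ : nat -> E -> R) f :
  (forall n, Bh_pos h (f_ n)) -> Bh_pos h f -> (forall n x, f_ n x <= M * h x) ->
  (forall x, f_ n x @[n --> \oo] --> f x) -> limit_Laplace (f_ n) @[n --> \oo] --> limit_Laplace f.
Proof.
move=> Bf_ Bf fM cf; have M0 : 0 <= M.
  by rewrite -(pmulr_lge0 _ (h_gt0 point)); apply: le_trans (fM 0%N point); case: (Bf_ 0%N).
have fM' x : f x <= M * h x by apply: (cvgr_to_le (cf x)); exact: nearW.
have [tail [tail0 Htail]] := total_immigrationP M0.
pose L_ k g := expR (- immigration k%:R g).
have close k g : Bh_pos h g -> (forall x, g x <= M * h x) -> `|limit_Laplace g - L_ k g| <= tail k.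
  move=> Bg gM; apply: le_trans (expR_lipschitz (total_ge0 Bg) (immigration_ge0 _ Bg)) _.
  have [_ /(_ k k%:R (lexx _))/andP[h1 h2]] := Htail g Bg gM.
  by rewrite ger0_norm ?subr_ge0// lerBlDl.
have L_E k g : Bh_pos h g -> L_ k g = \int[P k%:R (Mh_zero h)]_nu expR (- pairing g nu).
  move=> Bg; rewrite (superprocess_laplace P_superprocess)//.
  by rewrite (pairing_zero h (V k%:R g)) oppr0 sub0r.
have L_cvg k : L_ k (f_ n) @[n --> \oo] --> L_ k f.
  rewrite L_E//; under eq_fun do rewrite L_E//.
  apply: (Rintegral_bounded_cvg (M := 1)).
  - by rewrite prob_kernel ltry.
  - by move=> n; exact: measurable_Laplace.
  - by move=> n nu; have /andP[? ?] := Laplace01 nu (Bf_ n); rewrite ger0_norm.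
  - move=> nu; apply: continuous_cvg; first exact: continuous_expR.
    apply: cvgN; apply: (cvg_pairing h_gt0 h_cont (M := M)) => // [n|n x].
      exact: (Bh_measurable (Bf_ n).1).
    by rewrite ger0_norm//; case: (Bf_ n).
apply/cvgrPdist_le => e e0; have e3 : 0 < e / 3 by rewrite divr_gt0.
have /cvgrPdist_le/(_ _ e3)[k _ /(_ k (leqnn k))/= tk] := tail0.
have /cvgrPdist_le/(_ _ e3) := L_cvg k; apply: filterS => n Hn.
have c1 := close k f Bf fM'; have c2 := close k (f_ n) (Bf_ n) (fM n).
move: tk c1 c2 Hn; rewrite sub0r normrN => tk c1 c2 Hn.
have tk' := le_trans (ler_norm _) tk.
move: (limit_Laplace f) (limit_Laplace (f_ n)) (L_ k f) (L_ k (f_ n)) (tail k) c1 c2 Hn tk'.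
move=> l l' x y d; rewrite !ler_norml => /andP[? ?] /andP[? ?] /andP[? ?] ?.
by apply/andP; split; lra.
Qed.

Let limit_law_exists : exists pi : {measure set (Mh h) -> \bar R}, pi setT = 1%E /\
  forall f, Bh_pos h f -> \int[pi]_nu expR (- pairing f nu) = limit_Laplace f.
Proof.
apply: (@Laplace_limit R E h lusinE h_gt0 h_cont (fun n => P n%:R (Mh_zero h)) limit_Laplace).
- by move=> n; exact: prob_kernel.
- move=> f Bf; apply/cvgrPdist_le => e e0.
  have [T T0 HT] := Laplace_superprocess_cvg (Mh_zero h) Bf e0.
  exists (Num.truncn T).+1 => // n /= Tn.
  rewrite distrC (superprocess_laplace P_superprocess)// -opprD; apply: HT.
  by apply: ltW; apply: lt_le_trans (truncnS_gt T) _; rewrite ler_nat.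
- exact: limit_Laplace_cont.
Qed.

Let mixture_Laplace (Q : {measure set (Mh h) -> \bar R}) (t : R) f : 0 <= t -> Bh_pos h f ->
  (\int[mixture Q (fun A mA => measurable_kernel (P t) A mA)]_nu (expR (- pairing f nu))%:E =
   \int[Q]_mu (expR (- (pairing (V t f) mu + immigration t f)))%:E)%E.
Proof.
move=> t0 Bf; rewrite ge0_integral_mixture.
- by apply: eq_integral => mu _; exact: LaplaceE.
- by apply/measurable_EFinP; exact: measurable_Laplace.
- by move=> nu; rewrite lee_fin expR_ge0.
Qed.

Let mixture_mass (Q : {measure set (Mh h) -> \bar R}) (t : R) : Q setT = 1%E ->
  mixture Q (fun A mA => measurable_kernel (P t) A mA) setT = 1%E.
Proof.
move=> Q1; rewrite mixtureE; under eq_integral do rewrite prob_kernel.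
by rewrite integral_cst// mul1e.
Qed.

(** Under any invariant law the Laplace functional at time [n] is constant in [n]
    and tends to that of the limit law, by bounded convergence in the initial
    state; hence uniqueness. *)
Theorem superprocess_limit_law : exists pi : probability (Mh h) R,
    [/\ invariant_measure P pi,
        forall pi' : probability (Mh h) R, invariant_measure P pi' ->
          forall A : set (Mh h), measurable A -> pi' A = pi A,
        forall mu : Mh h, weak_cvg_pinfty (fun t => P t mu) pi
      & forall f, Bh_pos h f ->
          (\int[pi]_nu (expR (- pairing f nu))%:E =
           expeR (- \int[lebesgue_measure]_(s in [set s : R | (0 <= s)%R])
                      (psi beta H2 (V s f))%:E))%E].
Proof.
have [psi_ psiP] := lusin_tent_base lusinE.
have [pi0 [pi1 piE]] := limit_law_exists.
pose pi := to_probability pi1.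
have piE' f : Bh_pos h f -> \int[pi]_nu expR (- pairing f nu) = limit_Laplace f by exact: piE.
have piEE f : Bh_pos h f -> (\int[pi]_nu (expR (- pairing f nu))%:E = (limit_Laplace f)%:E)%E.
  move=> Bf; rewrite -piE' // /Rintegral fineK//; apply: integrable_fin_num => //.
  exact: integrable_Laplace.
have Ch_pos f : Ch h f -> (forall x, 0 <= f x) -> Bh_pos h f by move=> [Bf _] f0.
exists pi; split.
- move=> t A t0 mA.
  apply: (@Laplace_unique R E h h_gt0 h_cont psi_ psiP (mixture pi (fun A mA => measurable_kernel (P t) A mA)) pi) => //.
    exact: mixture_mass.
  move=> f Cf f0; have Bf := Ch_pos f Cf f0.
  rewrite /Rintegral mixture_Laplace//; congr fine.
  transitivity (\int[pi]_mu ((expR (- pairing (V t f) mu))%:E * (expR (- immigration t f))%:E))%E.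
    by apply: eq_integral => mu _; rewrite opprD expRD EFinM.
  rewrite ge0_integralZr//.
  + rewrite (piEE _ (VB t0 Bf)) (piEE _ Bf) /limit_Laplace (total_immigrationD t0 Bf).
    by rewrite opprD expRD.
  + by apply/measurable_EFinP; apply: measurable_Laplace; exact: VB.
- move=> pi' inv A mA; apply: (@Laplace_unique R E h h_gt0 h_cont psi_ psiP pi' pi) => //.
    exact: probability_setT.
  have pi'1 : pi' setT = 1%E by exact: probability_setT.
  have pi'fin : (pi' setT < +oo)%E by rewrite pi'1 ltry.
  move=> f Cf f0; have Bf := Ch_pos f Cf f0; rewrite piE'//.
  have stat n : \int[pi']_nu expR (- pairing f nu) =
      \int[pi']_mu expR (- (pairing (V n%:R f) mu + immigration n%:R f)).
    apply: (f_equal fine); rewrite -(mixture_Laplace pi' (ler0n R n) Bf).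
    by apply: eq_measure_integral => B mB _; rewrite mixtureE inv.
  have cL : \int[pi']_mu expR (- (pairing (V n%:R f) mu + immigration n%:R f)) @[n --> \oo] -->
      \int[pi']_mu limit_Laplace f.
    apply: (Rintegral_bounded_cvg (M := 1)).
    + exact: pi'fin.
    + move=> n; under eq_fun do rewrite opprD expRD.
      by apply: measurable_funM => //; apply: measurable_Laplace; exact: VB.
    + move=> n mu; rewrite ger0_norm ?expR_ge0// -[leRHS]expR0 ler_expR oppr_le0 addr_ge0//.
        by apply: pairing_ge0; case: (VB (ler0n R n) Bf).
      exact: immigration_ge0.
    + move=> mu; apply/cvgrPdist_le => e e0.
      have [T T0 HT] := Laplace_superprocess_cvg mu Bf e0.
      exists (Num.truncn T).+1 => // n /= Tn; rewrite distrC; apply: HT.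
      by apply: ltW; apply: lt_le_trans (truncnS_gt T) _; rewrite ler_nat.
  have cpi : \int[pi']_mu expR (- (pairing (V n%:R f) mu + immigration n%:R f)) @[n --> \oo] -->
      \int[pi']_nu expR (- pairing f nu).
    by under eq_fun do rewrite -stat; exact: cvg_cst.
  rewrite (cvg_unique _ cpi cL)// /Rintegral.
  have intc := etrans (@integral_cst _ (Mh h) R pi' setT measurableT (limit_Laplace f)%:E)
    (f_equal (fun z => (_ * z)%E) pi'1).
  by rewrite mule1 in intc; exact: (f_equal fine intc).
- move=> mu F cF [M FM].
  apply: (@Laplace_weak_cvg R E h h_gt0 h_cont psi_ psiP R (pinfty_nbhs R) _
    (fun t => P t mu) pi _ _ _ F M) => //.
    by move=> t; exact: prob_kernel.
  move=> f Cf f0; have Bf := Ch_pos f Cf f0; rewrite piE'//; apply/cvgrPdist_le => e e0.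
  have [T T0 HT] := Laplace_superprocess_cvg mu Bf e0.
  near=> t; rewrite distrC (superprocess_laplace P_superprocess)//.
  by rewrite -opprD; apply: HT; near: t; apply: nbhs_pinfty_ge; exact: num_real.
- by move=> f Bf; rewrite piEE// total_immigrationE.
Unshelve. all: by end_near. Qed.

End superprocess_limit.

Theorem theorem3p1 (R : realType) (E : ptopologicalType) (h : E -> R)
    (p : R -> R.-pker (Borel E) ~> (Borel E))
    (b c : E -> R)
    (eta : R.-sigmafker (Borel E) ~> (Borel E))
    (H1 : R.-sigmafker (Borel E) ~> (Mh h))
    (beta : Mh h) (H2 : {measure set (Mh h) -> \bar R})
    (V : R -> (E -> R) -> E -> R)
    (P : R -> R.-pker (Mh h) ~> (Mh h))
    (r : R -> R.-ker (Borel E) ~> (Borel E))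
    (lusinE : lusin_space R E)
    (h_gt0 : forall x, 0 < h x) (h_continuous : continuous h)
    (A1 : assumption_A1 (h := h) p)
    (A2 : assumption_A2 b c eta H1)
    (A3 : assumption_A3 H2)
    (V_cumulant : cumulant_semigroup p b c eta H1 V)
    (P_superprocess : superprocess_kernel beta H2 V P)
    (r_first_moment : first_moment_semigroup p b eta H1 r)
    (P_subcritical : subcritical (h := h) r)
    (H2_log : (\int[H2]_(nu in Mho h `&` [set nu : Mh h | (1 < pairing h nu)%R])
                 (ln (pairing h nu))%:E < +oo)%E) :
  exists pi : probability (Mh h) R,
    [/\ invariant_measure P pi,
        forall pi' : probability (Mh h) R, invariant_measure P pi' ->
          forall A : set (Mh h), measurable A -> pi' A = pi A,
        forall mu : Mh h, weak_cvg_pinfty (fun t => P t mu) pi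
      & forall f, Bh_pos h f ->
          (\int[pi]_nu (expR (- pairing f nu))%:E =
           expeR (- \int[lebesgue_measure]_(s in [set s : R | (0 <= s)%R])
                      (psi beta H2 (V s f))%:E))%E].
Proof.
exact: (superprocess_limit_law lusinE h_gt0 h_continuous A1 A2 V_cumulant
  P_superprocess r_first_moment P_subcritical A3 H2_log).
Qed.
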